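(* Let $d\ge1$. The following statements are equivalent: (1) $Y_0\supset L^\infty(\mathbb{T}_t\times\mathbb{T}^d_x)$; (2) $\mathscr{S}_*$ is uniformly square integrable; (3) $|\mathscr{S}_*|^2$ is relatively compact with respect to the weak topology $\sigma(L^1,L^\infty)$ on $L^1(\mathbb{T}_t\times\mathbb{T}^d_x)$; (4) there exists a strict Young function $\Phi$ such that $\Phi(|\mathscr{S}_*|^2)=\{\Phi(|u|^2):u\in\mathscr{S}_*\}$ is a bounded family in $L^1(\mathbb{T}_t\times\mathbb{T}^d_x)$. In parallel, the following statements are also equivalent: (1) $Y_0\supset L^\infty(\mathbb{T}^d_x)$; (2) $\mathscr{E}_*$ is uniformly square integrable; (3) $|\mathscr{E}_*|^2$ is relatively compact with respect to the weak topology $\sigma(L^1,L^\infty)$ on $L^1(\mathbb{T}^d_x)$; (4) there exists a strict Young function $\Phi$ such that $\Phi(|\mathscr{E}_*|^2)=\{\Phi(|f|^2):f\in\mathscr{E}_*\}$ is a bounded family in $L^1(\mathbb{T}^d_x)$.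
   Context: $\mathbb{T}=\mathbb{R}/2\pi\mathbb{Z}$; $\mathbb{T}_t=\mathbb{T}$ and $\mathbb{T}^d_x=\mathbb{T}^d$ are the temporal and spatial tori. $\mathscr{S}=\{u:t\mapsto e^{it\Delta}u_0: u_0\in L^2(\mathbb{T}^d_x)\}$ is the space of free Schrödinger waves, a closed subspace of $L^2(\mathbb{T}_t\times\mathbb{T}^d_x)$ by time periodicity; $\mathscr{S}_*$ is the set of $L^2$-normalized elements of $\mathscr{S}$; $\mathscr{E}_*$ is the set of all $L^2$-normalized eigenfunctions of $\Delta$ on $\mathbb{T}^d_x$. For a set $S$ of functions, $|S|^2=\{|f|^2:f\in S\}$. A bounded set $S\subset L^2$ is uniformly square integrable if $|S|^2$ is uniformly integrable: for all $\epsilon>0$ there is $\delta>0$ such that $\|f\|_{L^2(\omega)}^2<\epsilon$ for all $f\in S$ and all measurable $\omega$ with $|\omega|<\delta$. A strict Young function is a convex, even, lower semicontinuous function $\Phi:\mathbb{R}\to[0,\infty)$ with $\lim_{s\to\infty}|s|^{-1}\Phi(s)=\infty$. $Y=\mathfrak{L}(\mathscr{S},L^2(\mathbb{T}_t\times\mathbb{T}^d_x))$ (bounded linear operators), in which $L^\infty(\mathbb{T}_t\times\mathbb{T}^d_x)$ embeds as multiplication operators, and $Y_0$ is the closure of $C^0(\mathbb{T}_t\times\mathbb{T}^d_x)$ in $Y$. Functions on $\mathbb{T}^d_x$ are regarded as time-independent functions on $\mathbb{T}_t\times\mathbb{T}^d_x$. *)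

(* Defs.v *)
From HB Require Import structures.
From mathcomp Require Import all_boot all_order all_algebra.
From mathcomp Require Import all_classical all_reals all_analysis.
From mathcomp Require Import complex.

Set Implicit Arguments.
Unset Strict Implicit.
Unset Printing Implicit Defensive.

Import Order.TTheory GRing.Theory Num.Theory.
Import numFieldNormedType.Exports.

Local Open Scope classical_set_scope.
Local Open Scope complex_scope.
Local Open Scope ring_scope.

(* Complex-valued L^p functions on a measure space.  Elements of L^2 and of
   L^oo are represented by functions; every notion below that is applied to
   them only depends on their classes modulo equality almost everywhere. *)

Section complex_functions.
Context (d : measure_display) (X : measurableType d) (R : realType).
Variable mu : {measure set X -> \bar R}.
Implicit Types (f g : X -> R[i]) (p : \bar R) (S : set (X -> R[i])).

Definition sqmod f (x : X) : R := Normc.normc (f x) ^+ 2.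

Definition cmeasurable f :=
  measurable_fun setT (fun x => complex.Re (f x)) /\
  measurable_fun setT (fun x => complex.Im (f x)).

Definition cintegral f : R[i] :=
  (\int[mu]_x complex.Re (f x)) +i* (\int[mu]_x complex.Im (f x)).

Definition cLnorm p f : \bar R := 'N[mu]_p[EFin \o (@Normc.normc R \o f)].

Definition cLfun p : set (X -> R[i]) :=
  [set f | cmeasurable f /\ (cLnorm p f < +oo)%E].

Definition normalized S := [set f | S f /\ cLnorm 2%:E f = 1%E].

Definition uniformly_square_integrable S :=
  [/\ S `<=` cLfun 2%:E,
      (exists M : R, forall f, S f -> (cLnorm 2%:E f <= M%:E)%E) &
      forall eps : R, 0 < eps -> exists2 delta : R, 0 < delta &
        forall f (w : set X), S f -> measurable w -> (mu w < delta%:E)%E ->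
          (\int[mu]_(x in w) (sqmod f x)%:E < eps%:E)%E].

(* The family {Phi(|f|^2) : f in S} is bounded in L^1. *)
Definition L1_bounded_image (Phi : R -> R) S :=
  exists M : R, forall f, S f ->
    (Phi \o sqmod f) \in Lfun mu 1 /\
    ('N[mu]_1[EFin \o (Phi \o sqmod f)] <= M%:E)%E.

End complex_functions.

(* The weak topology sigma(L^1, L^oo): the coarsest topology on the space L^1
   of classes of integrable functions that makes F |-> \int F g continuous for
   all g in L^oo.  Real scalars suffice, as the families |S|^2 are real: real L^1
   is weakly closed in complex L^1, which induces the same topology on it. *)

Section weak_L1.
Context (d : measure_display) (X : measurableType d) (R : realType).
Variable mu : {measure set X -> \bar R}.

HB.instance Definition _ := gen_eqMixin (LspaceType1 mu).
HB.instance Definition _ := gen_choiceMixin (LspaceType1 mu).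

Definition pairing (F : LspaceType1 mu) :
    prod_topology (fun _ : LfunType mu (leey 1 : (1 <= +oo)%E) => R) :=
  fun g => \int[mu]_x (F x * g x).

Definition weakL1 := initial_topology pairing.
HB.instance Definition _ := Topological.on weakL1.

Definition sqmod_family (S : set (X -> R[i])) : set weakL1 :=
  [set F : LspaceType1 mu |
    exists2 f, S f & (F : X -> R) = sqmod f %[ae mu]].

End weak_L1.
Arguments sqmod_family {d X R} mu S.

Definition strict_young (R : realType) (Phi : R -> R) :=
  [/\ forall s, 0 <= Phi s,
      convex_function (E := R^o) setT Phi,
      forall s, Phi (- s) = Phi s,
      lower_semicontinuous (EFin \o Phi) &
      (`|s|^-1 * Phi s @[s --> +oo] --> +oo) /\
      (`|s|^-1 * Phi s @[s --> -oo] --> +oo)].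

(* The tori.  A point of T = R/2piZ is represented by its representative in
   [0, 2pi[, so T is R endowed with [circle_measure], Lebesgue measure restricted
   to [0, 2pi[, and T^n is n.-tuple R endowed with the n-fold product of
   [circle_measure]; the values of a measurable function outside of [0, 2pi[^n
   are irrelevant.  Continuous and C^2 functions on T^n are the 2pi-periodic
   ones on R^n. *)

Section torus_measure.
Context (R : realType).

Definition fundamental_interval : set (measurableTypeR R) :=
  `[0, 2 * pi[%classic.

Lemma measurable_fundamental_interval : measurable fundamental_interval.
Proof. exact: measurable_itv. Qed.

Lemma fundamental_interval_lty :
  (lebesgue_measure fundamental_interval < +oo)%E.
Proof.
by rewrite /fundamental_interval lebesgue_measure_itv/=; case: ifP; rewrite ?ltry.
Qed.

Definition circle_measure : {finite_measure set (measurableTypeR R) -> \bar R} :=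
  mfrestr measurable_fundamental_interval fundamental_interval_lty.

Definition torus n := n.-tuple (measurableTypeR R).

Definition cons_pair n (x : measurableTypeR R * torus n) : torus n.+1 :=
  [tuple of x.1 :: x.2].

Lemma measurable_cons_pair n : measurable_fun setT (@cons_pair n).
Proof. exact: measurable_cons. Qed.

Section cons_measure.
Context n (mu : {finite_measure set (torus n) -> \bar R}).

Definition cons_measure : set (torus n.+1) -> \bar R :=
  pushforward (circle_measure \x mu)%E (@cons_pair n).

Let measurable_preimage (A : set (torus n.+1)) :
  measurable A -> measurable (@cons_pair n @^-1` A).
Proof.
by move=> mA; rewrite -[X in measurable X]setTI; exact: measurable_cons_pair.
Qed.

Let cons_measure0 : cons_measure set0 = 0%E.
Proof. by rewrite /cons_measure /pushforward preimage_set0; exact: measure0. Qed.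

Let cons_measure_ge0 A : (0 <= cons_measure A)%E.
Proof. exact: (measure_ge0 (circle_measure \x mu)%E). Qed.

Let cons_measure_sigma_additive : semi_sigma_additive cons_measure.
Proof.
move=> F mF tF mUF; rewrite /cons_measure /pushforward preimage_bigcup.
apply: (@measure_semi_sigma_additive _ _ _ (circle_measure \x mu)%E).
- by move=> k; exact: measurable_preimage.
- apply/trivIsetP => /= i j _ _ ij; rewrite -preimage_setI.
  by move/trivIsetP : tF => /(_ _ _ _ _ ij) ->//; rewrite preimage_set0.
- by rewrite -preimage_bigcup; exact: measurable_preimage.
Qed.

HB.instance Definition _ := isMeasure.Build _ _ _ cons_measure
  cons_measure0 cons_measure_ge0 cons_measure_sigma_additive.

Let cons_measure_fin : fin_num_fun cons_measure.
Proof.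
move=> A mA; rewrite ge0_fin_numE//.
have le : (cons_measure A <= (circle_measure \x mu)%E setT)%E.
  apply: (@le_measure _ _ _ (circle_measure \x mu)%E); rewrite ?inE//.
  exact: measurable_preimage.
apply: (le_lt_trans le); rewrite -setXTT product_measure1E//.
by apply: lte_mul_pinfty => //; [exact: fin_num_measure|
  rewrite -ge0_fin_numE//; exact: fin_num_measure].
Qed.

HB.instance Definition _ :=
  Measure_isFinite.Build _ _ _ cons_measure cons_measure_fin.

End cons_measure.

Fixpoint torus_measure n : {finite_measure set (torus n) -> \bar R} :=
  match n with
  | 0 => [the {finite_measure set (torus 0) -> \bar R} of dirac [tuple]]
  | n.+1 => [the {finite_measure set (torus n.+1) -> \bar R} of
             cons_measure (torus_measure n)]
  end.

Definition spacetime d := (measurableTypeR R * torus d)%type.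

Definition spacetime_measure d : {measure set (spacetime d) -> \bar R} :=
  [the {measure set (spacetime d) -> \bar R} of
   (circle_measure \x torus_measure d)%E].

End torus_measure.

Section torus_functions.
Context (R : realType) (n : nat).
Implicit Types (f g : torus R n -> R[i]) (h : 'rV[R]_n -> R) (k : 'I_n -> int).

Definition pt (v : 'rV[R]_n) : torus R n := [tuple v 0 j | j < n].

Definition dir (j : 'I_n) : 'rV[R]_n := delta_mx 0 j.

Definition torus_periodic f :=
  forall v j, f (pt (v + (2 * pi) *: dir j)) = f (pt v).

Definition C2 h :=
  [/\ continuous h,
      forall i, (forall v, derivable h v (dir i)) /\ continuous ('D_(dir i) h) &
      forall i j, (forall v, derivable ('D_(dir i) h) v (dir j)) /\
                  continuous ('D_(dir j) ('D_(dir i) h))].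

Definition real_laplacian h (v : 'rV[R]_n) : R :=
  \sum_(j < n) 'D_(dir j) ('D_(dir j) h) v.

Definition laplacian f (v : 'rV[R]_n) : R[i] :=
  real_laplacian (fun w => complex.Re (f (pt w))) v +i*
  real_laplacian (fun w => complex.Im (f (pt w))) v.

Definition eigenfunctions : set (torus R n -> R[i]) :=
  [set f | [/\ torus_periodic f,
               C2 (fun v => complex.Re (f (pt v))),
               C2 (fun v => complex.Im (f (pt v))),
               (exists v, f (pt v) != 0) &
               exists lambda : R[i], forall v, laplacian f v = lambda * f (pt v)]].

Definition expi (theta : R) : R[i] := cos theta +i* sin theta.

Definition dotp k (x : torus R n) : R := \sum_(j < n) (k j)%:~R * tnth x j.

Definition sqnorm k : R := \sum_(j < n) (k j)%:~R ^+ 2.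

Definition fourier_coef f k : R[i] :=
  ((2 * pi) ^- n)%:C *
  cintegral (torus_measure R n) (fun x => f x * expi (- dotp k x)).

Definition fourier_multiplier (m : ('I_n -> int) -> R[i]) f g :=
  [/\ cLfun (torus_measure R n) 2%:E f, cLfun (torus_measure R n) 2%:E g &
      forall k, fourier_coef g k = m k * fourier_coef f k].

(* g = e^{it Delta} f, as Delta multiplies the k-th Fourier mode by -|k|^2. *)
Definition schrodinger_flow (t : R) f g :=
  fourier_multiplier (fun k => expi (- (t * sqnorm k))) f g.

End torus_functions.

Section operators.
Context (R : realType) (d : nat).
Local Notation mu := (spacetime_measure R d).
Local Notation fct := (spacetime R d -> R[i]).
Implicit Types (u v : fct) (A B : fct -> fct).

Definition free_waves : set fct :=
  [set u | cLfun mu 2%:E u /\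
           exists u0 : torus R d -> R[i],
             {ae circle_measure R, forall t,
                schrodinger_flow t u0 (fun x => u (t, x))}].

Definition C0 : set fct :=
  [set a | [/\ continuous (fun z : R * 'rV[R]_d => complex.Re (a (z.1, pt z.2))),
               continuous (fun z : R * 'rV[R]_d => complex.Im (a (z.1, pt z.2))),
               (forall (t : R) x, a (t + 2 * pi, x) = a (t, x)) &
               forall t, torus_periodic (fun x => a (t, x))]].

(* Y: the bounded linear operators from the space of free waves to L^2; only
   the values of A on free waves matter, and linearity and boundedness imply
   that A is compatible with equality almost everywhere. *)
Definition Y : set (fct -> fct) :=
  [set A | [/\ forall u, free_waves u -> cLfun mu 2%:E (A u),
               forall (c : R[i]) u v, free_waves u -> free_waves v ->
                 A (fun z => c * u z + v z) = (fun z => c * A u z + A v z)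
                 %[ae mu] &
               exists M : R, forall u, free_waves u ->
                 (cLnorm mu 2%:E (A u) <= M%:E * cLnorm mu 2%:E u)%E]].

Definition opnorm A : \bar R :=
  ereal_sup [set cLnorm mu 2%:E (A u) |
             u in [set u | free_waves u /\ (cLnorm mu 2%:E u <= 1)%E]].

Definition multiplication (a : fct) : fct -> fct := fun u z => a z * u z.

Definition Y0 : set (fct -> fct) :=
  [set A | Y A /\ forall eps : R, 0 < eps ->
     exists2 a, C0 a &
       (opnorm (fun u z => (A u z - multiplication a u z)%R) < eps%:E)%E].

Definition time_independent (b : torus R d -> R[i]) : fct := fun z => b z.2.

End operators.

(* Main.v *)
(* In the weak topology an element of L^1 is the functional it induces on L^oo.
   The functionals obeying every two-sided bound satisfied by a uniformly
   integrable family form a compact set, and uniform integrability makes them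
   countably additive and absolutely continuous on indicators, hence, by
   Radon-Nikodym, elements of L^1.  Conversely, along sets of summable measure,
   a weak cluster point of a non uniformly integrable sequence would have an
   integral that is not absolutely continuous.  The Young function is the one of
   de la Vallee Poussin, sum_n max(|s| - c_n, 0).

   If free waves are uniformly square integrable, a bounded b is approximated as
   a multiplier by clipped trigonometric polynomials: |b - a| is small outside of
   a small set.  If they are not, there are free waves u_n and disjoint sets D_n
   carrying a fixed amount of their mass; C^0 being separable, given a countable
   dense family (a_n), let W be the union of the D_n on which |1 - a_n|^2 |u_n|^2
   has a large integral.  Then no a_n approximates the indicator of W.

   For time-independent multipliers only sets T x w matter.  By Parseval in time,
   the mass of a free wave on T x w is the sum of the masses on w of its modes,
   which are eigenfunctions; conversely, integration by parts shows that
   e^{i t lambda} f(x) is a free wave when f is an eigenfunction. *)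

Require Import Defs.
From HB Require Import structures.
From mathcomp Require Import all_boot all_order all_algebra.
From mathcomp Require Import all_classical all_reals all_analysis.
From mathcomp Require Import complex.
From mathcomp Require Import measurable_realfun ess_sup_inf lra ring.

Set Implicit Arguments.
Unset Strict Implicit.
Unset Printing Implicit Defensive.

Import Order.TTheory GRing.Theory Num.Theory.
Import numFieldNormedType.Exports HBNNSimple.

Local Open Scope classical_set_scope.
Local Open Scope complex_scope.
Local Open Scope ring_scope.

(** * Square-integrable functions *)

(** The two chains share one treatment of multipliers, for a measurable map [h] out of space-time
    along which sets and functions are pulled back: the identity for general multipliers, the
    projection to space for time-independent ones. Three obstacles shape the rest. An L^2
    approximant of a bounded function may be unbounded, and where the two are far apart only the
    mass of the wave is known to be small: hence the clipping. The countable family of the diagonal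
    argument need not be continuous: step functions with rational data on rational boxes suffice,
    since only measurability and uniform closeness almost everywhere are used. Fourier series are
    never summed: a trigonometric approximant of a free wave stays at least as close once its terms
    off the paraboloid are dropped, as these are orthogonal to the wave and to the kept terms;
    Parseval then concerns finite sums. Density of trigonometric polynomials comes from a Dynkin
    class argument, the indicators of half-lines being limits of explicit polynomials in a
    cosine. *)

Section modulus.
Context (R : realType).
Implicit Types (z w : R[i]).

(** A polynomial in the real and imaginary parts, within reach of [ring] and [nra], whereas [sqmod]
    passes through a square root. *)
Definition sqn z : R := complex.Re z ^+ 2 + complex.Im z ^+ 2.

Lemma normc_sqn z : Normc.normc z ^+ 2 = sqn z.
Proof. by case: z => a b; rewrite /= sqr_sqrtr// addr_ge0 ?sqr_ge0. Qed.

Lemma sqn_ge0 z : 0 <= sqn z.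
Proof. by rewrite addr_ge0 ?sqr_ge0. Qed.

Lemma sqnM z w : sqn (z * w) = sqn z * sqn w.
Proof. by case: z w => [a b] [a' b']; rewrite /sqn /=; ring. Qed.

Lemma sqnN z : sqn (- z) = sqn z.
Proof. by case: z => [a b]; rewrite /sqn /= !sqrrN. Qed.

(** The difference of the two sides is |z - w|^2. This inequality stands in for Minkowski's
    throughout. *)
Lemma sqn_add2 z w : sqn (z + w) <= 2 * sqn z + 2 * sqn w.
Proof.
case: z w => [a b] [a' b']; rewrite /sqn /=.
have := sqr_ge0 (a - a'); have := sqr_ge0 (b - b'); nra.
Qed.

Lemma sqn_real (a : R) : sqn a%:C = a ^+ 2.
Proof. by rewrite /sqn/= expr0n addr0. Qed.

Lemma sqn0 : sqn 0 = 0.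
Proof. by rewrite /sqn/= expr0n addr0. Qed.

Lemma sqn1 : sqn 1 = 1.
Proof. by rewrite /sqn/= expr0n addr0 expr1n. Qed.

End modulus.

Section L2.
Context (d : measure_display) (X : measurableType d) (R : realType).
Variable mu : {measure set X -> \bar R}.
Implicit Types (f g : X -> R[i]).
Local Open Scope ereal_scope.

Lemma sqmodE f x : sqmod f x = sqn (f x).
Proof. exact: normc_sqn. Qed.

Lemma sqmod_ge0 f x : (0 <= sqmod f x)%R.
Proof. exact: sqr_ge0. Qed.

Lemma measurable_sqmod f : cmeasurable f -> measurable_fun setT (sqmod f).
Proof.
move=> [mr mi]; rewrite (_ : sqmod f = fun x =>
  (complex.Re (f x) ^+ 2 + complex.Im (f x) ^+ 2)%R); last first.
  by apply/funext => x; rewrite sqmodE.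
by apply: measurable_funD; apply: measurable_funX.
Qed.

Lemma cLnorm2E f :
  cLnorm mu 2%:E f = (\int[mu]_x (sqmod f x)%:E) `^ 2^-1.
Proof.
rewrite /cLnorm unlock /Lnorm; congr (_ `^ _); apply: eq_integral => x _ /=.
by rewrite /= powR_mulrn ?normr_ge0// /sqmod real_normK ?num_real.
Qed.

Lemma int_sqmod_ge0 f w : 0 <= \int[mu]_(x in w) (sqmod f x)%:E.
Proof. by apply: integral_ge0 => x _; rewrite lee_fin sqmod_ge0. Qed.

Lemma cLnorm2_le f (c : R) : (0 <= c)%R ->
  (cLnorm mu 2%:E f <= c%:E) = (\int[mu]_x (sqmod f x)%:E <= (c ^+ 2)%:E).
Proof.
move=> c0; rewrite cLnorm2E poweR12_sqrt ?int_sqmod_ge0//.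
move: (int_sqmod_ge0 f setT); case: (\int[mu]_x _) => [r r0| |]//=.
by rewrite !lee_fin -{1}(ger0_norm c0) -sqrtr_sqr ler_sqrt// sqr_ge0.
Qed.

Lemma cLnorm2_lty f :
  (cLnorm mu 2%:E f < +oo) = (\int[mu]_x (sqmod f x)%:E < +oo).
Proof.
rewrite cLnorm2E poweR12_sqrt ?int_sqmod_ge0//.
move: (int_sqmod_ge0 f setT); case: (\int[mu]_x _) => [r r0| |]//=.
by rewrite !ltry.
Qed.

Lemma cLnorm2_eq1 f :
  (cLnorm mu 2%:E f = 1) <-> (\int[mu]_x (sqmod f x)%:E = 1).
Proof.
rewrite cLnorm2E poweR12_sqrt ?int_sqmod_ge0//.
move: (int_sqmod_ge0 f setT); case: (\int[mu]_x _) => [r r0| |]//=.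
rewrite lee_fin in r0.
split=> -[] h; last by rewrite h sqrtr1.
by rewrite -(sqr_sqrtr r0) h expr1n.
Qed.

Lemma cLfun2P f : cLfun mu 2%:E f <->
  cmeasurable f /\ \int[mu]_x (sqmod f x)%:E < +oo.
Proof. by rewrite /cLfun/= cLnorm2_lty. Qed.

Lemma measurable_sqmodE f D : cmeasurable f ->
  measurable_fun D (fun x => (sqmod f x)%:E).
Proof.
by move=> mf; apply/measurable_EFinP/measurable_funTS/measurable_sqmod.
Qed.

Lemma cLfun2_integrable f : cLfun mu 2%:E f ->
  mu.-integrable setT (EFin \o sqmod f).
Proof.
move=> /cLfun2P[mf fl]; apply/integrableP; split.
  exact: measurable_sqmodE.
by under eq_integral do rewrite /= ger0_norm ?sqmod_ge0//.
Qed.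

End L2.

Lemma decreasing_measure_small d (X : measurableType d) (R : realType)
    (mu : {finite_measure set X -> \bar R}) (F : (set X)^nat) (delta : R) :
  (forall i, measurable (F i)) -> {homo F : n m / (n <= m)%N >-> m `<=` n} ->
  \bigcap_n F n = set0 -> 0 < delta ->
  \forall n \near \oo, (mu (F n) < delta%:E)%E.
Proof.
move=> mF decF F0 d0.
have : (mu \o F) n @[n --> \oo] --> mu (\bigcap_n F n).
  apply: nonincreasing_cvg_mu => //.
  - by rewrite -ge0_fin_numE// fin_num_measure.
  - by rewrite F0.
  - by move=> n m nm; apply/subsetPset; exact: decF.
rewrite F0 measure0.
by move=> /(_ _ (@nbhs_open_ereal_lt R 0 (cst delta) d0)).
Qed.

Lemma ge0_lt_EFin (R : realType) (x : \bar R) (e : R) : (0 <= x)%E ->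
  (x < e%:E)%E -> exists2 a, x = a%:E & 0 <= a < e.
Proof.
case: x => [a| |]//; rewrite lee_fin lte_fin => a0 ae.
by exists a => //; rewrite a0.
Qed.

(** * Weak compactness of uniformly integrable families *)

Section ladder.
Context (R : realType).

(* For [0 <= y], the sum is the integer part of [y] truncated at [N]. *)
Lemma sum_ladder (y : R) (N : nat) : 0 <= y ->
  (N%:R <= y -> \sum_(j < N) (j.+1%:R <= y)%R%:R = N%:R :> R) /\
  (y < N%:R -> y - 1 < \sum_(j < N) (j.+1%:R <= y)%R%:R <= y).
Proof.
move=> y0; elim: N => [|N [IH1 IH2]].
  by split=> [_|]; rewrite ?big_ord0// ltNge y0.
rewrite !big_ord_recr/=; split=> [Ny|yN].
  rewrite IH1; last by rewrite (le_trans _ Ny)// ler_nat.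
  by rewrite Ny natr1.
rewrite leNgt yN/= addr0.
have [Ny|yN'] := lerP N%:R y; last exact: IH2.
by rewrite (IH1 Ny) Ny andbT ltrBlDr natr1.
Qed.

End ladder.

Section LpElements.
Context (d : measure_display) (X : measurableType d) (R : realType).
Variable mu : {finite_measure set X -> \bar R}.

Lemma Lspace1_integrable (F : LspaceType1 mu) :
  mu.-integrable setT (EFin \o F).
Proof.
apply/Lfun1_integrable; rewrite inE; apply/andP; split; rewrite inE/=.
  exact: (@measurable_funPT _ _ _ _ (repr (F : {mfun_ mu, X >-> measurableTypeR R}))).
exact: Lebesgue_finite.
Qed.

(** The witness is the class of [h] modulo equality almost everywhere. Its representative need not
    be [h] itself, but the L^1 norm does not see the difference. *)
Lemma Lspace1_of_integrable (h : X -> R) : mu.-integrable setT (EFin \o h) ->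
  exists F : LspaceType1 mu, (F : X -> R) = h %[ae mu].
Proof.
move=> hi.
have mh : measurable_fun setT h by apply/measurable_EFinP; exact: measurable_int hi.
pose h' : {mfun X >-> measurableTypeR R} := HB.pack h
  (isMeasurableFun.Build _ _ X (measurableTypeR R) h mh).
pose q : {mfun_ mu, X >-> measurableTypeR R} := (\pi_({mfun_ mu, X >-> measurableTypeR R}) h')%qT.
have qh : (q : X -> R) = h %[ae mu].
  have : (repr q == h' %[mod {mfun_ mu, X >-> measurableTypeR R}])%qT.
    by rewrite reprK.
  by rewrite generic_quotient.eqmodE => /asboolP.
have fq : finite_norm mu 1 q.
  rewrite /finite_norm Lnorm1.
  rewrite (@ae_eq_integral _ _ _ mu setT (fun x => `|h x|%:E))//.
  - by have /integrableP[] := hi.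
  - by apply/measurable_EFinP; apply: measurableT_comp => //;
      exact: (@measurable_funPT _ _ _ _ (repr q)).
  - by apply/measurable_EFinP; apply: measurableT_comp.
  - by apply: filterS qh => x /= + _ => ->.
by exists (HB.pack_for (LspaceType mu (@lexx _ _ 1%E)) q
  (isFinLebesgue.Build _ _ _ mu 1%E (@lexx _ _ 1%E) q fq)).
Qed.

Lemma indic_Lfunoo (w : set X) : measurable w -> (\1_w : X -> R) \in Lfun mu +oo%E.
Proof.
move=> mw; rewrite inE; apply/andP; split; rewrite inE/=.
  exact: measurable_indic.
rewrite /finite_norm unlock /Lnorm; case: ifPn => // mu0.
apply: (@le_lt_trans _ _ 1%E); last by rewrite ltry.
apply/ess_supP; apply/nearW => x /=; rewrite lee_fin indicE.
by case: (_ \in _); rewrite ?normr0 ?normr1.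
Qed.

Lemma Lnormoo_bounded (g : X -> R) : ('N[mu]_+oo[EFin \o g] < +oo)%E ->
  exists2 B, 0 <= B & {ae mu, forall x, `|g x| <= B}.
Proof.
rewrite unlock /Lnorm; case: ifPn => mu0.
  move=> gl; pose B := fine (ess_sup mu (abse \o (EFin \o g))).
  have e0 : (0 <= ess_sup mu (abse \o (EFin \o g)))%E.
    by apply: ess_sup_gee => //; apply/nearW => x /=; rewrite lee_fin.
  exists B; first by rewrite fine_ge0.
  apply: filterS (ess_sup_ge mu (abse \o (EFin \o g))) => x /=.
  by rewrite -lee_fin /B fineK// ge0_fin_numE.
(* The whole space is null here, so any bound holds almost everywhere. *)
move=> _; exists 0 => //; exists setT; split => //.
by apply/eqP; rewrite eq_le measure_ge0 leNgt andbT.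
Qed.

End LpElements.

Section DunfordPettis.
Context (d : measure_display) (X : measurableType d) (R : realType).
Variable mu : {finite_measure set X -> \bar R}.

Notation Loo := (LfunType mu (leey 1 : (1 <= +oo)%E)).

Definition indL (w : set X) (mw : measurable w) : Loo :=
  Lfun_Sub (leey 1) (indic_Lfunoo mu mw).

(** The relation is a pointwise one, so it applies to [k] however [k] was built, for instance as the
    indicator of a union. *)
Definition linear_on (L : Loo -> R) :=
  forall c (g h k : Loo), (forall x, k x = c * g x + h x) -> L k = c * L g + L h.

(** Any essential bound [B] is allowed, which avoids computing an essential supremum. *)
Definition bounded_on (L : Loo -> R) := exists2 C, 0 <= C &
  forall (g : Loo) B, 0 <= B -> {ae mu, forall x, `|g x| <= B} -> `|L g| <= B * C.

Lemma integrable_mul_bounded (h : X -> R) (g : Loo) B :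
  mu.-integrable setT (EFin \o h) -> 0 <= B -> {ae mu, forall x, `|g x| <= B} ->
  mu.-integrable setT (fun x => (h x * g x)%:E) /\
  `|\int[mu]_x (h x * g x)| <= B * \int[mu]_x `|h x|.
Proof.
move=> hi B0 gB.
have mg : measurable_fun setT g by exact: measurable_funPT.
have mh : measurable_fun setT h by apply/measurable_EFinP; exact: measurable_int hi.
have mhg : measurable_fun setT (fun x => (h x * g x)%:E).
  by apply/measurable_EFinP; exact: measurable_funM.
have mB : measurable_fun setT (fun x => (B * `|h x|)%:E).
  by apply/measurable_EFinP; apply: measurable_funM => //; apply: measurableT_comp.
have iBh : (\int[mu]_x (B * `|h x|)%:E = B%:E * \int[mu]_x `|h x|%:E)%E.
  by under eq_integral do rewrite EFinM; rewrite ge0_integralZl_EFin//;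
    apply/measurable_EFinP; apply: measurableT_comp.
have hfin : (\int[mu]_x `|h x|%:E \is a fin_num)%E.
  rewrite ge0_fin_numE ?integral_ge0//.
  by have /integrableP[] := hi.
have le : (\int[mu]_x `|(h x * g x)%:E| <= \int[mu]_x (B * `|h x|)%:E)%E.
  apply: ae_ge0_le_integral => //.
  - exact: measurableT_comp.
  - by move=> x _; rewrite lee_fin mulr_ge0.
  - apply: filterS gB => x gx _ /=.
    by rewrite lee_fin normrM mulrC ler_wpM2r.
have ihg : mu.-integrable setT (fun x => (h x * g x)%:E).
  apply/integrableP; split => //; apply: (le_lt_trans le).
  by rewrite iBh -(fineK hfin) -EFinM ltry.
split => //.
have := le_normr_Rintegral measurableT ihg.
move=> /le_trans; apply.
rewrite -lee_fin EFinM /Rintegral (fineK hfin) -iBh fineK//.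
by apply: integrable_fin_num => //; exact: integrable_norm ihg.
Qed.

Lemma pairing_linear (F : LspaceType1 mu) : linear_on (pairing F).
Proof.
move=> c g h k kE.
have iF := Lspace1_integrable F.
have [Bg Bg0 gB] := Lnormoo_bounded (Lfunction_finite _ g).
have [Bh Bh0 hB] := Lnormoo_bounded (Lfunction_finite _ h).
have [ig _] := integrable_mul_bounded iF Bg0 gB.
have [ih _] := integrable_mul_bounded iF Bh0 hB.
rewrite /pairing -RintegralZl// -RintegralD//.
  by apply: eq_Rintegral => x _; rewrite kE; ring.
by rewrite (_ : _ \o _ = (fun x => c%:E * (F x * g x)%:E)%E)//; exact: integrableZl.
Qed.

Lemma pairing_bounded (F : LspaceType1 mu) : bounded_on (pairing F).
Proof.
exists (\int[mu]_x `|F x|); first exact: Rintegral_ge0.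
by move=> g B B0 gB; have [] := integrable_mul_bounded (Lspace1_integrable F) B0 gB.
Qed.

Lemma linear_on0 L : linear_on L -> L 0 = 0.
Proof.
by move=> /(_ (-1) 0 0 0) ->; [rewrite mulN1r addNr|move=> x /=; rewrite mulN1r addNr].
Qed.

Lemma linear_onB L (g h : Loo) : linear_on L -> L (g - h) = L g - L h.
Proof.
by move=> /(_ (-1) h g (g - h)) ->; [rewrite mulN1r addrC|move=> x /=; rewrite mulN1r addrC].
Qed.

(** A single [k] serves all linear functionals, so that two of them can be compared on it. *)
Lemma linear_combination (n : nat) (a : nat -> R) (G : nat -> Loo) :
  exists k : Loo, (forall x, k x = \sum_(j < n) a j * G j x) /\
    forall L, linear_on L -> L k = \sum_(j < n) a j * L (G j).
Proof.
elim: n => [|n [k [kE kL]]].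
  by exists 0; split => [x|L /linear_on0]; rewrite big_ord0.
exists (a n *: G n + k); split=> [x|L lL].
  by rewrite big_ord_recr/= -kE addrC.
by rewrite big_ord_recr/= -(kL L lL) addrC; exact: lL.
Qed.

(** Staircases over the superlevel sets of [g] approach [g] uniformly almost everywhere; both
    functionals agree on them by linearity, and boundedness controls the remainder. *)
Lemma functional_ext (L1 L2 : Loo -> R) :
  linear_on L1 -> linear_on L2 -> bounded_on L1 -> bounded_on L2 ->
  (forall w (mw : measurable w), L1 (indL mw) = L2 (indL mw)) -> L1 =1 L2.
Proof.
move=> l1 l2 [C1 C10 b1] [C2 C20 b2] L12 g.
have [B0 B00 gB0] := Lnormoo_bounded (Lfunction_finite _ g).
pose B := B0 + 1; have B_gt0 : 0 < B by rewrite ltr_wpDl.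
have gB : {ae mu, forall x, `|g x| <= B}.
  by apply: filterS gB0 => x /le_trans; apply; rewrite lerDl.
(* For y = (n+1)(g+B)/(2B), which lies in [0, n+1] almost everywhere, the staircase is -B plus
   2B/(n+1) times the number of j in [1, n+1] with j <= y; it is within one step 2B/(n+1) of g. The
   index 0 carries the constant -B. The bound [B] was enlarged by 1 to allow the division. *)
pose A n (j : nat) := [set x | j%:R <= n.+1%:R * (g x + B) / (2 * B)].
have mA n j : measurable (A n j).
  rewrite -[A n j]setTI; apply: (measurable_fun_ler (measurable_cst _)) => //.
  apply: measurable_funM => //; apply: measurable_funM => //.
  by apply: measurable_funD => //; exact: measurable_funPT.
pose a n (j : nat) := if j == 0%N then - B else 2 * B / n.+1%:R.
pose G n (j : nat) := if j == 0%N then indL measurableT else indL (mA n j).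
have sP n := linear_combination n.+2 (a n) (G n).
have /choice[s {}sP] := sP.
have L1s n : L1 (s n) = L2 (s n).
  have [_ sL] := sP n; rewrite !sL//; apply: eq_bigr => j _.
  by rewrite /G; case: ifP => _; rewrite L12.
have gs n : {ae mu, forall x, `|(g - s n) x| <= 2 * B / n.+1%:R}.
  apply: filterS gB => x; rewrite ler_norml => /andP[gx1 gx2].
  have [sE _] := sP n; have -> : (g - s n) x = g x - s n x :> R by [].
  rewrite sE.
  rewrite big_ord_recl/=.
  have -> : \sum_(i < n.+1) a n (lift ord0 i) * G n (lift ord0 i) x =
    2 * B / n.+1%:R * \sum_(i < n.+1) (i.+1%:R <= n.+1%:R * (g x + B) / (2 * B))%R%:R.
    rewrite mulr_sumr; apply: eq_bigr => i _.
    rewrite /a /G /= indicE; congr (_ * _%:R); congr nat_of_bool.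
    by apply/idP/idP; rewrite inE.
  rewrite /a /G /= indicE in_setT mulr1 opprD opprK.
  have n0 : 0 < n.+1%:R :> R by rewrite ltr0n.
  have B2 : 0 < 2 * B by rewrite mulr_gt0.
  set y := n.+1%:R * (g x + B) / (2 * B).
  have -> : g x = 2 * B / n.+1%:R * y - B.
    by rewrite /y; field; rewrite !gt_eqF//=.
  have y0 : 0 <= y.
    have gxB : 0 <= g x + B by rewrite -lerBlDr sub0r.
    by apply: divr_ge0; [apply: mulr_ge0 => //; exact: ltW|exact: ltW].
  have yn : y <= n.+1%:R.
    rewrite ler_pdivrMr// ler_pM2l//.
    by rewrite mulrDl mul1r lerD2r.
  have [lad1 lad2] := sum_ladder n.+1 y0.
  set S := \sum_(i < n.+1) _ in lad1 lad2 *.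
  have -> : 2 * B / n.+1%:R * y - B + (B - 2 * B / n.+1%:R * S) = 2 * B / n.+1%:R * (y - S).
    by ring.
  rewrite normrM ger0_norm ?divr_ge0 ?(ltW n0) ?(ltW B2)//.
  rewrite ler_piMr ?divr_ge0 ?(ltW n0) ?(ltW B2)//.
  have [ny|yn'] := lerP n.+1%:R y.
    by rewrite lad1// (_ : y = n.+1%:R) ?subrr ?normr0//; apply/eqP; rewrite eq_le yn.
  have /andP[h1 h2] := lad2 yn'.
  by rewrite ger0_norm ?subr_ge0// lerBlDl -lerBlDr ltW.
have bd n : `|L1 g - L2 g| <= 2 * B / n.+1%:R * (C1 + C2).
  have -> : L1 g - L2 g = L1 (g - s n) - L2 (g - s n).
    by rewrite !linear_onB// L1s; ring.
  rewrite mulrDr; apply: (le_trans (ler_normB _ _)); apply: lerD.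
    by apply: b1 => //; rewrite divr_ge0// mulr_ge0// ltW.
  by apply: b2 => //; rewrite divr_ge0// mulr_ge0// ltW.
apply/eqP; rewrite -subr_eq0 -normr_le0; apply/ler_addgt0Pr => e e0; rewrite add0r.
have [n en] : exists n : nat, 2 * B * (C1 + C2) / e < n%:R.
  by exists (Num.trunc (2 * B * (C1 + C2) / e)).+1; exact: truncnS_gt.
apply: (le_trans (bd n)); rewrite mulrAC ler_pdivrMr ?ltr0n// -ler_pdivrMl//.
by rewrite [leLHS]mulrC (le_trans (ltW en))// ler_nat.
Qed.

End DunfordPettis.

Section WeakCompactness.
Context (d : measure_display) (X : measurableType d) (R : realType).
Variable mu : {finite_measure set X -> \bar R}.
Variable S : set (X -> R[i]).
Hypothesis usi : uniformly_square_integrable mu S.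

Notation Loo := (LfunType mu (leey 1 : (1 <= +oo)%E)).
Notation functionals := (prod_topology (fun _ : Loo => R)).

(* The closed convex hull of the functionals [g |-> \int |f|^2 g], [f] in [S],
   described by the inequalities that define it. *)
Definition hull : set functionals := [set L |
  (forall (g : Loo) a b, (forall f, S f -> a <= \int[mu]_x (sqmod f x * g x) <= b) ->
     a <= L g <= b) /\ linear_on L].

Lemma sqmod_bounded : exists2 M : R, 0 <= M & forall f, S f ->
  mu.-integrable setT (EFin \o sqmod f) /\ \int[mu]_x `|sqmod f x| <= M.
Proof.
have [SL2 [M SM] _] := usi.
exists (`|M| ^+ 2) => [|f Sf]; first exact: sqr_ge0.
have fi := cLfun2_integrable (SL2 _ Sf); split => //.
have := SM _ Sf => /le_trans /(_ (_ : (M%:E <= `|M|%:E)%E)).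
rewrite lee_fin ler_norm => /(_ isT); rewrite cLnorm2_le// => fM.
have -> : \int[mu]_x `|sqmod f x| = \int[mu]_x sqmod f x.
  by apply: eq_Rintegral => x _; rewrite ger0_norm ?sqmod_ge0.
rewrite -lee_fin; apply: le_trans fM.
by rewrite /Rintegral fineK//; exact: integrable_fin_num.
Qed.

Lemma Rintegral_mul_indic (h : X -> R) (w : set X) :
  \int[mu]_x (h x * \1_w x) = \int[mu]_(x in w) h x.
Proof.
rewrite [RHS]Rintegral_mkcond; apply: eq_Rintegral => x _.
by rewrite patchE indicE; case: ifP => _; rewrite ?mulr1 ?mulr0.
Qed.

Lemma hull_pairing f (F : LspaceType1 mu) : S f ->
  (F : X -> R) = sqmod f %[ae mu] -> hull (pairing F).
Proof.
move=> Sf Ff; split; last exact: pairing_linear.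
move=> g a b /(_ _ Sf).
suff -> : pairing F g = \int[mu]_x (sqmod f x * g x) by [].
rewrite /pairing /Rintegral; congr fine; apply: ae_eq_integral => //.
- apply/measurable_EFinP; apply: measurable_funM; last exact: measurable_funPT.
  by apply/measurable_EFinP; exact: measurable_int (Lspace1_integrable F).
- apply/measurable_EFinP; apply: measurable_funM; last exact: measurable_funPT.
  by have [SL2 _ _] := usi; have [mf _] := SL2 _ Sf; exact: measurable_sqmod.
- by apply: filterS Ff => x /(_ I) /= ->.
Qed.

Lemma eval_continuous (g : Loo) : continuous (fun L : functionals => L g).
Proof. exact: (@proj_continuous Loo (fun=> R) g). Qed.

Lemma combination_closed (c : R) (g h k : Loo) :
  closed [set L : functionals | L k - (c * L g + L h) = 0].
Proof.
have cg : continuous (fun L : functionals => c * L g).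
  move=> L; apply: (@continuousM R functionals (fun=> c) (fun L => L g)).
    exact: cst_continuous.
  exact: eval_continuous.
have cgh : continuous (fun L : functionals => c * L g + L h).
  move=> L; apply: (@continuousD R R^o functionals (fun L => c * L g) (fun L => L h)).
    exact: cg.
  exact: eval_continuous.
have ck : continuous (fun L : functionals => L k - (c * L g + L h)).
  move=> L; apply: (@continuousB R R^o functionals (fun L => L k)).
    exact: eval_continuous.
  exact: cgh.
apply: (@closed_comp _ _ (fun L : functionals => L k - (c * L g + L h)) [set 0]).
  by move=> L _; exact: ck.
exact: closed_eq.
Qed.

Lemma hull_closed : closed hull.
Proof.
rewrite (_ : hull =
  \bigcap_(t in [set t : Loo * R * R | forall f, S f ->
       t.1.2 <= \int[mu]_x (sqmod f x * t.1.1 x) <= t.2])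
     ((fun L : functionals => L t.1.1) @^-1` `[t.1.2, t.2]%classic) `&`
  \bigcap_(t in [set t : R * Loo * Loo * Loo |
       forall x, t.2 x = t.1.1.1 * t.1.1.2 x + t.1.2 x])
     [set L : functionals | L t.2 - (t.1.1.1 * L t.1.1.2 + L t.1.2) = 0]).
  apply: closedI; apply: closed_bigI => -[[t1 t2] t3] _ /=.
    apply: closed_comp; last exact: itv_closed.
    by move=> L _; exact: eval_continuous.
  exact: combination_closed.
apply/seteqP; split=> [L [Lb Ll]|L [Lb Ll]].
  split=> [[[g a] b] /= gab|[[[c g] h] k] /= kE]; first by rewrite in_itv/= Lb.
  by apply/eqP; rewrite subr_eq0; apply/eqP; exact: Ll.
split=> [g a b gab|c g h k kE].
  by have /= := Lb (g, a, b) gab; rewrite in_itv.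
by apply/eqP; rewrite -subr_eq0; apply/eqP; exact: (Ll (c, g, h, k)).
Qed.

(** A closed subset of a product of segments, which is compact by Tychonoff's theorem. The segment
    at [g] is given by an essential bound of [g] times the common L^1 bound. *)
Lemma hull_compact : compact hull.
Proof.
have [M M0 SM] := sqmod_bounded.
have /choice[b gb] : forall g : Loo, exists b : R,
    forall f, S f -> - b <= \int[mu]_x (sqmod f x * g x) <= b.
  move=> g; have [B B0 gB] := Lnormoo_bounded (Lfunction_finite _ g).
  exists (B * M) => f Sf; rewrite -ler_norml; have [fi fM] := SM f Sf.
  have [_ /le_trans] := integrable_mul_bounded fi B0 gB; apply.
  by rewrite ler_wpM2l.
apply: (@subclosed_compact _ _
  [set L : functionals | forall g, `[- b g, b g]%classic (L g)]).
- exact: hull_closed.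
- by apply: (@tychonoff Loo (fun=> R) (fun g => `[- b g, b g]%classic)) => g;
    exact: segment_compact.
- by move=> L [Lb _] g /=; rewrite in_itv/=; exact: (Lb _ _ _ (gb g)).
Qed.

Lemma hull_bounded L : hull L -> bounded_on L.
Proof.
move=> [Lb _]; have [M M0 SM] := sqmod_bounded.
exists M => // g B B0 gB; rewrite ler_norml; apply: Lb => f Sf.
rewrite -ler_norml; have [fi fM] := SM f Sf.
have [_ /le_trans] := integrable_mul_bounded fi B0 gB; apply.
by rewrite ler_wpM2l.
Qed.

Lemma indL_bounded w (mw : measurable w) :
  {ae mu, forall x, `|indL mu mw x| <= 1}.
Proof.
by apply/nearW => x /=; rewrite indicE; case: (_ \in _); rewrite ?normr0 ?normr1.
Qed.

Lemma hull_ge0 L w (mw : measurable w) : hull L -> 0 <= L (indL mu mw).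
Proof.
move=> hL; have [Lb _] := hL; have [M M0 SM] := sqmod_bounded.
suff /andP[] : 0 <= L (indL mu mw) <= M by [].
apply: Lb => f Sf; have [fi fM] := SM f Sf; apply/andP; split.
  by apply: Rintegral_ge0 => x _; rewrite mulr_ge0 ?sqmod_ge0//= indicE.
apply: (le_trans (ler_norm _)).
have [_ /le_trans] := integrable_mul_bounded fi ler01 (indL_bounded mw); apply.
by rewrite mul1r.
Qed.

Lemma hull_usi L : hull L -> forall eps, 0 < eps -> exists2 delta : R, 0 < delta &
  forall w (mw : measurable w), (mu w < delta%:E)%E -> L (indL mu mw) <= eps.
Proof.
move=> [Lb _] eps eps0; have [_ _ /(_ _ eps0)[delta d0 dP]] := usi.
exists delta => // w mw wd.
suff /andP[] : 0 <= L (indL mu mw) <= eps by [].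
apply: Lb => f Sf; apply/andP; split.
  by apply: Rintegral_ge0 => x _; rewrite mulr_ge0 ?sqmod_ge0//= indicE.
rewrite [leLHS](Rintegral_mul_indic (sqmod f) w).
have := dP f w Sf mw wd => /ltW; rewrite -lee_fin; apply: le_trans.
rewrite /Rintegral fineK// ge0_fin_numE ?int_sqmod_ge0//.
by apply: lt_trans (dP f w Sf mw wd) _; rewrite ltry.
Qed.

Lemma hull_range L : hull L -> exists F : LspaceType1 mu, pairing F = L.
Proof.
move=> hL; have [_ lL] := hL; have bL := hull_bounded hL.
(* The set function must be total: 0 is a dummy value on non-measurable sets. *)
pose v (w : set X) : R := if pselect (measurable w) is left mw then L (indL mu mw) else 0.
have vE w (mw : measurable w) : v w = L (indL mu mw).
  rewrite /v; case: pselect => // mw'; congr (L _).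
  by apply/LfuneqP.
have v_ge0 w : 0 <= v w.
  by rewrite /v; case: pselect => // mw; exact: hull_ge0.
have v0 : v set0 = 0.
  rewrite (vE _ measurable0) -(linear_on0 lL); congr (L _).
  by apply/LfuneqP => x /=; rewrite indic0.
have vU A B : measurable A -> measurable B -> A `&` B = set0 -> v (A `|` B) = v A + v B.
  move=> mA mB AB; rewrite (vE _ mA) (vE _ mB) (vE _ (measurableU _ _ mA mB)).
  rewrite (lL 1 (indL mu mA) (indL mu mB)) ?mul1r// => x /=.
  rewrite mul1r !indicE in_setU; have := AB.
  rewrite -subset0 => /(_ x) ABx.
  have [/set_mem xA|xA] := boolP (x \in A); have [/set_mem xB|xB] := boolP (x \in B).
  - by case: ABx.
  - by rewrite /= addr0.
  - by rewrite /= add0r.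
  - by rewrite /= addr0.
have v_usi eps : 0 < eps -> exists2 delta : R, 0 < delta &
    forall w, measurable w -> (mu w < delta%:E)%E -> v w <= eps.
  move=> /(hull_usi hL)[delta d0 dP]; exists delta => // w mw wd.
  by rewrite (vE _ mw); exact: dP.
have v_sigma : semi_sigma_additive (EFin \o v).
  move=> F mF tF mUF.
  pose U n := \bigcup_(i in `I_n) F i.
  have mU n : measurable (U n) by exact: bigcup_measurable.
  pose V n := \bigcup_i F i `\` U n.
  have mV n : measurable (V n) by exact: measurableD.
  have UV n : v (\bigcup_i F i) = v (U n) + v (V n).
    rewrite -vU//; last exact: setDIK.
    congr v; rewrite setDUK//; exact: bigcup_subset.
  have sumE n : (\sum_(0 <= i < n) (v (F i))%:E)%E = (v (U n))%:E.
    elim: n => [|n IH]; first by rewrite big_nil /U II0 bigcup_set0 v0.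
    rewrite big_nat_recr//= IH -EFinD -vU//.
      by congr (_%:E); congr v; rewrite /U !bigcup_mkord big_ord_recr.
    apply/seteqP; split => // x [[i /= ni Fi] Fn].
    move/trivIsetP : tF => /(_ i n I I); rewrite (ltn_eqF ni) => /(_ isT).
    by move=> Fin0; have : (F i `&` F n) x by []; rewrite Fin0.
  apply/fine_cvgP; split; first by apply: nearW => n /=; rewrite sumE.
  apply/cvgrPdist_le => e e0; have [delta d0 dP] := v_usi _ e0.
  (* The remainders [V n] decrease to the empty set, so that [mu], and with it [v], becomes small on
     them. *)
  have : \forall n \near \oo, (mu (V n) < delta%:E)%E.
    apply: decreasing_measure_small => //.
    - move=> n m nm x [UFx nU]; split => //; apply: contra_not nU => -[i /= ni Fi].
      by exists i => //=; exact: leq_trans ni nm.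
    - rewrite -subset0 => x Vx; have [[i _ Fi] _] := Vx 0%N I.
      by have [_] := Vx i.+1 I; apply; exists i => /=.
  apply: filterS => n Vn /=; rewrite sumE /= (UV n) addrAC subrr add0r.
  by rewrite ger0_norm//; exact: dP.
have ve_ge0 w : (0 <= (EFin \o v) w)%E by rewrite lee_fin.
have v_fin : fin_num_fun (EFin \o v) by move=> A mA.
have ve0 : (EFin \o v) set0 = 0%E by rewrite /= v0.
pose nu1 : {measure set X -> \bar R} := HB.pack (EFin \o v)
  (isMeasure.Build _ _ _ (EFin \o v) ve0 ve_ge0 v_sigma).
(* Restriction to the whole space leaves the values unchanged and supplies the structure of a finite
   measure. *)
pose nu : {finite_measure set X -> \bar R} := mfrestr measurableT
  (ltry (v setT) : (nu1 setT < +oo)%E).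
have nuE w : nu w = (v w)%:E by rewrite -[w in RHS]setIT.
have numu : nu `<< mu.
  apply/null_content_dominatesP => A mA A0; rewrite nuE; congr EFin.
  apply/eqP; rewrite eq_le v_ge0 andbT; apply/ler_addgt0Pr => e e0.
  rewrite add0r; have [delta d0 dP] := v_usi _ e0.
  by apply: dP => //; rewrite A0 lte_fin.
have [h [h_ge0 hfin hi hE]] := radon_nikodym_sigma_finite numu.
have hi' : mu.-integrable setT (EFin \o (fine \o h)).
  by apply: eq_integrable hi => // x _ /=; rewrite fineK.
have [F Fh] := Lspace1_of_integrable hi'.
exists F; apply/funext; apply: functional_ext => //.
- exact: pairing_linear.
- exact: pairing_bounded.
move=> w mw; rewrite -vE /pairing [LHS](Rintegral_mul_indic F w).
have := hE w mw; rewrite nuE => /(congr1 fine)/= ->.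
rewrite /Rintegral; congr fine; apply: ae_eq_integral => //.
- by apply: measurable_funTS; exact: measurable_int (Lspace1_integrable F).
- by apply: measurable_funTS; exact: measurable_int hi.
- by apply: filterS Fh => x /(_ I) /= -> _; rewrite fineK.
Qed.

(** The preimage of [hull] under [pairing] is the compact set. A filter on it is pushed to the
    functionals, where it clusters at a point of [hull]; that point is the image of some [F] by
    [hull_range], and [F] is a cluster point because the open sets of the initial topology are
    exactly preimages. *)
Lemma usi_precompact : precompact (sqmod_family mu S).
Proof.
exists (@pairing _ _ _ mu @^-1` hull : set (weakL1 mu)).
  by move=> F [f Sf Ff]; exact: hull_pairing Ff.
split.
  move=> G PG Ghull.
  have [L [hL GL]] := @hull_compact (@pairing _ _ _ mu @ G) _ Ghull.
  have [F FL] := hull_range hL.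
  exists F; split; first by rewrite /= FL.
  move=> A B GA [_ [[B' oB' <-] /= BF] sB].
  have GA' : (@pairing _ _ _ mu @ G) (@pairing _ _ _ mu @` A).
    by rewrite /= nbhs_filterE; apply: filterS GA => x Ax; exists x.
  have LB' : nbhs L B' by apply: open_nbhs_nbhs; split => //; rewrite -FL.
  have [_ [[F' AF' <-] BF']] := GL _ _ GA' LB'.
  by exists F'; split => //; exact: sB.
apply: (@closed_comp _ _ (@pairing _ _ _ mu : weakL1 mu -> functionals)).
  by move=> F _; exact: (@initial_continuous _ _ (@pairing _ _ _ mu)).
exact: hull_closed.
Qed.

End WeakCompactness.

(** * Young functions *)

Section Precompact.
Context (d : measure_display) (X : measurableType d) (R : realType).
Variable mu : {finite_measure set X -> \bar R}.
Implicit Types S : set (X -> R[i]).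

Lemma sqmod_absolutely_continuous f eps : cLfun mu 2%:E f -> 0 < eps ->
  exists2 delta : R, 0 < delta & forall w, measurable w ->
    (mu w < delta%:E)%E -> (\int[mu]_(x in w) (sqmod f x)%:E < eps%:E)%E.
Proof.
move=> fL2 eps0; have fi := cLfun2_integrable fL2.
have [delta [d0 dP]] := integral_normr_continuous fi eps0.
exists delta => // w mw wd; have := dP w mw wd.
have fin : (\int[mu]_(x in w) (sqmod f x)%:E \is a fin_num)%E.
  by apply: integrable_fin_num => //; exact: integrableS fi.
rewrite -[X in _ -> (X < _)%E](fineK fin) lte_fin; apply: le_lt_trans.
rewrite /Rintegral le_eqVlt; apply/orP; left; apply/eqP; congr fine.
by apply: eq_integral => x _; rewrite ger0_norm ?sqmod_ge0.
Qed.

Lemma precompact_usi S : S `<=` cLfun mu 2%:E ->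
  (exists M : R, forall f, S f -> (cLnorm mu 2%:E f <= M%:E)%E) ->
  precompact (sqmod_family mu S) -> uniformly_square_integrable mu S.
Proof.
move=> SL2 SM [U SU [cU _]]; split => // eps eps0; apply: contrapT => noeps.
(* Uniform integrability is refuted at delta = 2^-(n+1) for every n, which makes the measures of the
   sets summable. *)
have /choice[fw fwP] : forall n : nat, exists fw : (X -> R[i]) * set X,
    [/\ S fw.1, measurable fw.2, (mu fw.2 < (1 / (2 ^ n.+1)%:R)%:E)%E &
      (eps%:E <= \int[mu]_(x in fw.2) (sqmod fw.1 x)%:E)%E].
  move=> n; apply: contrapT => nofw; apply: noeps.
  exists (1 / (2 ^ n.+1)%:R); first by rewrite divr_gt0// ltr0n expn_gt0.
  move=> f w Sf mw wn; rewrite ltNge; apply/negP => le; apply: nofw.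
  by exists (f, w).
pose w n := (fw n).2; pose f n := (fw n).1.
have mw n : measurable (w n) by have [] := fwP n.
have /choice[phi phiP] : forall n, exists F : LspaceType1 mu,
    (F : X -> R) = sqmod (f n) %[ae mu].
  by move=> n; apply/Lspace1_of_integrable/cLfun2_integrable/SL2; have [] := fwP n.
(* The test function must not vary along the sequence: the indicator of [W N] captures every [w n]
   with n >= N, and the measure of [W N] tends to 0 by Borel-Cantelli. *)
pose W n := \bigcup_(k in [set k | (n <= k)%N]) w k.
have mW n : measurable (W n) by exact: bigcup_measurable.
have muW : mu (W n) @[n --> \oo] --> 0%E.
  have /lim_sup_set_cvg0 : (\sum_(0 <= n <oo) mu (w n) < +oo)%E.
    apply: (@le_lt_trans _ _ (\sum_(0 <= n <oo) (1 / (2 ^ n.+1)%:R)%:E)%E).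
      by apply: lee_nneseries => // n _; have [_ _ /ltW] := fwP n.
    by apply: (le_lt_trans (epsilon_trick0 _ _)); rewrite ?ltry.
  move=> /(_ mw) <-; apply: lim_sup_set_cvg => //.
  by rewrite -ge0_fin_numE// fin_num_measure//; exact: bigcup_measurable.
pose phin (n : nat) : weakL1 mu := phi n.
have phiU : (phin @ \oo) U.
  exists 0%N => // n _; apply: SU; exists (f n); first by have [] := fwP n.
  exact: phiP.
have [F [_ clF]] := cU (phin @ \oo) _ phiU.
have [delta [d0 dP]] := integral_normr_continuous (Lspace1_integrable F) eps0.
have [N _ WN] : \forall n \near \oo, (mu (W n) < delta%:E)%E.
  exact: (muW _ (@nbhs_open_ereal_lt R 0 (cst delta) d0)).
have {WN} := WN N (leqnn N); move=> /(dP _ (mW N)) FW.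
pose ind := indL mu (mW N).
have pairingE (G : LspaceType1 mu) : pairing G ind = \int[mu]_(x in W N) G x.
  exact: (Rintegral_mul_indic mu G (W N)).
have near_F : nbhs F [set G : weakL1 mu | pairing G ind < eps].
  have cont : continuous (fun G : weakL1 mu => pairing G ind).
    move=> G; apply: (@continuous_comp _ _ _ (@pairing _ _ _ mu : weakL1 mu -> _)
      (fun L : prod_topology (fun _ : LfunType mu (leey 1 : (1 <= +oo)%E) => R) => L ind)).
      exact: (@initial_continuous _ _ (@pairing _ _ _ mu)).
    exact: eval_continuous.
  apply: (@cvgr_lt R (weakL1 mu) (nbhs (F : weakL1 mu)) _ _ _ (cont F)).
  rewrite pairingE.
  apply: le_lt_trans FW; apply: (le_trans (ler_norm _)).
  apply: le_normr_Rintegral => //.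
  by apply: integrableS (Lspace1_integrable F).
have phiA : (phin @ \oo) (phin @` [set n | (N <= n)%N]).
  by exists N => // n /= Nn; exists n.
have [_ [[n /= Nn <-]]] := clF _ _ phiA near_F.
rewrite /= ltNge => /negP; apply.
have [Sf mwn _ fwn] := fwP n.
have fi := cLfun2_integrable (SL2 _ Sf).
have -> : pairing (phi n) ind = \int[mu]_(x in W N) sqmod (f n) x.
  rewrite pairingE /Rintegral; congr fine; apply: ae_eq_integral => //.
  - by apply: measurable_funTS; exact: measurable_int (Lspace1_integrable (phi n)).
  - by apply: measurable_funTS; exact: measurable_int fi.
  - by apply: filterS (phiP n) => x /(_ I) /= -> _.
rewrite -lee_fin /Rintegral fineK; last first.
  by apply: integrable_fin_num => //; exact: integrableS fi.
apply: (le_trans fwn); apply: ge0_subset_integral => //.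
- by apply: measurable_funTS; exact: measurable_int fi.
- by move=> x _; rewrite lee_fin sqmod_ge0.
- by move=> x wx; exists n.
Qed.

End Precompact.

Section YoungFunction.
Context (R : realType) (c : nat -> R).
Hypothesis c_ge : forall n, n%:R <= c n.

Definition young_sum (N : nat) (s : R) := \sum_(n < N) Num.max (`|s| - c n) 0.

(* Only the indices [n <= |s|] contribute to the infinite sum, as [n <= c n]. *)
Definition young (s : R) := young_sum (Num.trunc `|s|).+1 s.

Lemma le_young_sum N k s : young_sum N s <= young_sum (N + k) s.
Proof.
elim: k => [|k IH]; first by rewrite addn0.
by rewrite addnS /young_sum big_ord_recr/= -[leLHS]addr0 lerD// le_max lexx orbT.
Qed.

Lemma young_sum_stable N k s : `|s| <= N%:R -> young_sum (N + k) s = young_sum N s.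
Proof.
move=> sN; elim: k => [|k IH]; first by rewrite addn0.
rewrite addnS /young_sum big_ord_recr/= -/(young_sum _ _) IH.
rewrite (_ : Num.max _ _ = 0) ?addr0//; apply/max_idPr.
by rewrite subr_le0 (le_trans sN)// (le_trans _ (c_ge _))// ler_nat leq_addr.
Qed.

(** Any sufficiently large truncation computes the sum, so finitely many points can share one finite
    sum. *)
Lemma youngE N s : `|s| <= N%:R -> young s = young_sum N s.
Proof.
move=> sN; rewrite /young.
have sM : `|s| <= (Num.trunc `|s|).+1%:R by rewrite ltW// truncnS_gt.
have [NM|/ltnW MN] := leqP N (Num.trunc `|s|).+1.
  by rewrite -(subnKC NM) young_sum_stable.
by rewrite -[in RHS](subnKC MN) young_sum_stable.
Qed.

Lemma exists_nat_ge (x : R) : exists N : nat, x <= N%:R.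
Proof. by exists (Num.trunc x).+1; rewrite ltW// truncnS_gt. Qed.

Lemma young_ge_sum N s : young_sum N s <= young s.
Proof.
have [M sM] := exists_nat_ge `|s|.
by rewrite (@youngE (N + M)) ?le_young_sum// (le_trans sM)// ler_nat leq_addl.
Qed.

(** Each of the first N >= 2K terms is at least |s|/2 as soon as |s| >= 2 c_n; the threshold is the
    sum of these bounds, which dominates each of them. *)
Lemma young_superlinear K : exists2 A, 0 <= A &
  forall s, A <= `|s| -> 0 < `|s| -> K <= `|s|^-1 * young s.
Proof.
have [N KN] := exists_nat_ge (2 * K).
exists (\sum_(n < N) 2 * c n).
  by apply: sumr_ge0 => n _; rewrite mulr_ge0// (le_trans _ (c_ge _)).
move=> s As s0; rewrite ler_pdivlMl//; apply: le_trans (young_ge_sum N s).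
apply: (@le_trans _ _ (\sum_(n < N) `|s| / 2)).
  rewrite sumr_const card_ord -mulr_natr; have := normr_ge0 s.
  by move=> s0'; nra.
apply: ler_sum => n _; rewrite le_max; apply/orP; left.
suff : 2 * c n <= `|s| by lra.
apply: le_trans As; rewrite (bigD1 n)//= lerDl; apply: sumr_ge0 => m _.
by rewrite mulr_ge0// (le_trans _ (c_ge _)).
Qed.

Lemma continuous_young_sum N : continuous (young_sum N).
Proof.
move=> s; elim: N => [|N IH].
  rewrite (_ : young_sum 0 = cst 0); first exact: cst_continuous.
  by apply/funext => x; rewrite /young_sum big_ord0.
rewrite (_ : young_sum N.+1 = fun x => young_sum N x + Num.max (`|x| - c N) 0); last first.
  by apply/funext => x; rewrite /young_sum big_ord_recr.
apply: (@continuousD R R^o R^o (young_sum N) (fun x => Num.max (`|x| - c N) 0)).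
  exact: IH.
apply: (@continuous_max R R^o (fun x => `|x| - c N) (cst 0)).
  apply: (@continuousB R R^o R^o (fun x => `|x|) (cst (c N))).
    exact: norm_continuous.
  exact: cst_continuous.
exact: cst_continuous.
Qed.

Lemma young_superlinear_pinfty : `|s|^-1 * young s @[s --> +oo] --> +oo.
Proof.
apply/cvgryPge => K; have [A A0 AP] := young_superlinear K.
near=> s.
have s0 : 0 < s by near: s; exact: nbhs_pinfty_gt.
have sA : A <= s by near: s; apply: nbhs_pinfty_ge; exact: num_real.
by apply: AP; rewrite gtr0_norm.
Unshelve. all: by end_near. Qed.

Lemma young_convex (a x y : R) : 0 <= a -> 0 <= 1 - a ->
  young (a * x + (1 - a) * y) <= a * young x + (1 - a) * young y.
Proof.
move=> a0 a1.
have [N xyN] := exists_nat_ge (`|x| + `|y|).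
have xN : `|x| <= N%:R by have := normr_ge0 y; lra.
have yN : `|y| <= N%:R by have := normr_ge0 x; lra.
have nxy : `|a * x + (1 - a) * y| <= a * `|x| + (1 - a) * `|y|.
  by apply: (le_trans (ler_normD _ _)); rewrite !normrM (ger0_norm a0) (ger0_norm a1).
rewrite !(@youngE N)//; last by nra.
rewrite /young_sum !mulr_sumr -big_split/=; apply: ler_sum => n _.
rewrite !maxr_pMr//!mulr0 ge_max; apply/andP; split; last first.
  by rewrite -[leLHS]addr0 lerD// le_max lexx orbT.
apply: (@le_trans _ _ (a * (`|x| - c n) + (1 - a) * (`|y| - c n))).
  by lra.
by rewrite lerD// le_max lexx.
Qed.

Lemma strict_young_young : strict_young young.
Proof.
split.
- by move=> s; apply: sumr_ge0 => n _; rewrite le_max lexx orbT.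
- move=> t x y _ _; pose a : R := t%:num.
  have a0 : 0 <= t%:num by exact: ge0.
  have a1 : 0 <= 1 - t%:num by rewrite subr_ge0.
  change (young (a * x + (1 - a) * y) <= a * young x + (1 - a) * young y).
  exact: young_convex.
- by move=> s; rewrite /young /young_sum normrN.
(* Lower semicontinuity: [young] is bounded below by its continuous truncations, and one of them
   attains its value at x. *)
- move=> x a; rewrite /= lte_fin => ax.
  have [N xN] := exists_nat_ge `|x|.
  exists [set y | a < young_sum N y].
    apply: (@cvgr_gt R R (nbhs x) _ _ _ (@continuous_young_sum N x)).
    by rewrite -(youngE xN).
  by move=> y /= ay; rewrite lte_fin (lt_le_trans ay)// young_ge_sum.
- split; first exact: young_superlinear_pinfty.
  apply/cvgNy_compNP; rewrite (_ : _ \o _ = fun s => `|s|^-1 * young s).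
    exact: young_superlinear_pinfty.
  by apply/funext => s /=; rewrite normrN /young /young_sum normrN.
Qed.

End YoungFunction.

Section YoungUsi.
Context (d : measure_display) (X : measurableType d) (R : realType).
Variable mu : {finite_measure set X -> \bar R}.
Implicit Types S : set (X -> R[i]).

(** Markov's inequality. *)
Lemma tail_measure_le f (M a : R) : cLfun mu 2%:E f -> 0 < a ->
  (\int[mu]_x (sqmod f x)%:E <= M%:E)%E ->
  (mu [set x | (a <= sqmod f x)%R] <= (M / a)%:E)%E.
Proof.
move=> fL2 a0 fM.
have mf : measurable_fun setT (EFin \o sqmod f).
  exact: measurable_int (cLfun2_integrable fL2).
have h : (a%:E * mu (setT `&` [set x | a%:E <= `|(EFin \o sqmod f) x|]) <=
    \int[mu]_x `|(EFin \o sqmod f) x|)%E.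
  exact: le_integral_abse.
have setE : setT `&` [set x | (a%:E <= `|(EFin \o sqmod f) x|)%E] = [set x | a <= sqmod f x].
  by rewrite setTI; apply/seteqP; split => x /=; rewrite lee_fin ger0_norm ?sqmod_ge0.
rewrite setE in h.
have fin : mu [set x | a <= sqmod f x] \is a fin_num.
  apply: fin_num_measure; rewrite -[X in measurable X]setTI.
  by apply: measurable_fun_ler => //; exact/measurable_EFinP.
rewrite -(fineK fin) -EFinM in h; rewrite -(fineK fin) lee_fin ler_pdivlMr// mulrC -lee_fin.
apply: (le_trans h); rewrite (eq_integral (fun x => (sqmod f x)%:E))// => x _ /=.
by rewrite ger0_norm ?sqmod_ge0.
Qed.

Lemma usi_young S : uniformly_square_integrable mu S ->
  exists Phi : R -> R, strict_young Phi /\ L1_bounded_image mu Phi S.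
Proof.
move=> [SL2 [M0 SM0] SUI].
pose M := `|M0| ^+ 2.
have SM f : S f -> (\int[mu]_x (sqmod f x)%:E <= M%:E)%E.
  move=> Sf; rewrite -cLnorm2_le//; apply: (le_trans (SM0 _ Sf)).
  by rewrite lee_fin ler_norm.
have M_ge0 : 0 <= M by exact: sqr_ge0.
have e0 n : 0 < 1 / (2 ^ n.+1)%:R :> R by rewrite divr_gt0// ltr0n expn_gt0.
have /choice[delta dP] : forall n, exists delta : R, 0 < delta /\
    forall f w, S f -> measurable w -> (mu w < delta%:E)%E ->
    (\int[mu]_(x in w) (sqmod f x)%:E < (1 / (2 ^ n.+1)%:R)%:E)%E.
  by move=> n; have [delta d0 dP] := SUI _ (e0 n); exists delta.
(* By Markov's inequality the set where |f|^2 >= c_n has measure at most M / c_n < delta_n, so the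
   n-th term of the Young function has integral at most 2^-(n+1), and these bounds add up to 1. The
   summand n ensures c_n >= n. *)
pose c n := n%:R + (M + 1) / delta n.
have c_gt0 n : 0 < c n.
  by rewrite ltr_wpDl// divr_gt0//; [rewrite ltr_wpDl|have [] := dP n].
have c_ge n : n%:R <= c n.
  by rewrite lerDl divr_ge0//; [rewrite addr_ge0|have [/ltW] := dP n].
have young_ge0 : forall s, 0 <= young c s by have [] := strict_young_young c_ge.
have mY : measurable_fun setT (young c).
  apply/measurable_EFinP; apply: lower_semicontinuous_measurable.
  by have [_ _ _ lsc _] := strict_young_young c_ge.
exists (young c); split; first exact: strict_young_young.
have key f : S f -> (\int[mu]_x (young c (sqmod f x))%:E <= 1%:E)%E.
  move=> Sf.
  have mf : measurable_fun setT (sqmod f).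
    by apply: measurable_sqmod; have [] := SL2 _ Sf.
  pose h n x : \bar R := (Num.max (`|sqmod f x| - c n) 0)%:E.
  have h_ge0 n x : (0 <= h n x)%E by rewrite lee_fin le_max lexx orbT.
  have mh n : measurable_fun setT (h n).
    apply/measurable_EFinP; apply: measurable_maxr => //.
    by apply: measurable_funB => //; apply: measurableT_comp.
  apply: (@le_trans _ _ (\int[mu]_x (\sum_(0 <= n <oo) h n x)%E)%E).
    apply: ge0_le_integral => //.
    - by move=> x _; rewrite lee_fin.
    - by apply/measurable_EFinP; apply: measurableT_comp.
    - apply: (@emeasurable_fun_cvg _ _ _ setT (fun N x => \sum_(0 <= n < N) h n x)%E).
        by move=> N; apply: emeasurable_sum.
      by move=> x _; apply: is_cvg_nneseries.
    - move=> x _; have [N xN] := exists_nat_ge `|sqmod f x|.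
      rewrite (youngE c_ge xN) /young_sum -sumEFin.
      rewrite -(big_mkord xpredT (fun n => h n x)).
      by apply: nneseries_lim_ge.
  rewrite integral_nneseries//.
  apply: (@le_trans _ _ (\sum_(0 <= n <oo) (1 / (2 ^ n.+1)%:R)%:E)%E); last first.
    exact: epsilon_trick0.
  apply: lee_nneseries => [n _ _|n _]; first exact: integral_ge0.
  pose w := [set x | c n <= sqmod f x].
  have mw : measurable w by rewrite -[w]setTI; apply: measurable_fun_ler.
  have [d0 /(_ f w Sf mw) wP] := dP n.
  apply: (@le_trans _ _ (\int[mu]_(x in w) (sqmod f x)%:E)%E).
    rewrite [leRHS]integral_mkcond; apply: ge0_le_integral => //.
    - apply/(measurable_restrictT _ mw); apply/measurable_EFinP.
      exact: measurable_funTS.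
    - move=> x _; rewrite patchE /h ger0_norm ?sqmod_ge0//.
      case: ifPn => [xw|/negP xw]; rewrite lee_fin ge_max ?sqmod_ge0 ?andbT.
        by rewrite gerBl ltW.
      by rewrite lexx andbT subr_le0 leNgt; apply/negP => /ltW cw; apply: xw; rewrite inE.
  apply: ltW; apply: wP.
  apply: (le_lt_trans (tail_measure_le (SL2 _ Sf) (c_gt0 n) (SM _ Sf))).
  rewrite lte_fin ltr_pdivrMr// mulrDr mulrCA divff ?gt_eqF// mulr1.
  by rewrite ltr_wpDl ?ltrDl// mulr_ge0// ltW.
exists 1 => f Sf.
have mf : measurable_fun setT (young c \o sqmod f).
  apply: measurableT_comp => //.
  by apply: measurable_sqmod; have [] := SL2 _ Sf.
have fl : ('N[mu]_1[EFin \o (young c \o sqmod f)] <= 1%:E)%E.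
  rewrite Lnorm1 (eq_integral (fun x => (young c (sqmod f x))%:E)).
    exact: key.
  by move=> x _ /=; rewrite ger0_norm.
split => //; rewrite inE; apply/andP; split; rewrite inE//=.
by apply: (le_lt_trans fl); rewrite ltry.
Qed.

(** Superlinearity gives s <= A' + Phi(s) / K for all s >= 0, with K as large as desired; integrate
    this over a small set. *)
Lemma young_usi S (Phi : R -> R) : S `<=` cLfun mu 2%:E ->
  (exists M : R, forall f, S f -> (cLnorm mu 2%:E f <= M%:E)%E) ->
  strict_young Phi -> L1_bounded_image mu Phi S -> uniformly_square_integrable mu S.
Proof.
move=> SL2 SM [Phi0 _ _ _ [Phiy _]] [M PhiM]; split => // eps eps0.
(* With this K the term in Phi contributes at most |M| / K <= eps / 2; the choice delta = eps / (2
   A') below makes the constant A' contribute less than eps / 2. *)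
pose K := 2 * (`|M| + 1) / eps.
have K0 : 0 < K by rewrite divr_gt0// mulr_gt0// ltr_wpDl.
move/cvgryPge : Phiy => /(_ K)[A [_ AK]].
pose A' := `|A| + 1.
have A'0 : 0 < A' by rewrite ltr_wpDl.
have sP s : 0 <= s -> s <= A' + Phi s / K.
  move=> s0; have [sA|As] := lerP s A'.
    by rewrite (le_trans sA)// lerDl divr_ge0// ltW.
  have s_gt0 : 0 < s by exact: lt_trans As.
  have : K <= `|s|^-1 * Phi s.
    by apply: AK; rewrite (le_lt_trans (ler_norm A))// (lt_trans _ As)// ltrDl.
  rewrite gtr0_norm// ler_pdivlMl// => sK.
  apply: (@le_trans _ _ (Phi s / K)); first by rewrite ler_pdivlMr.
  by rewrite lerDr ltW.
exists (eps / (2 * A')); first by rewrite divr_gt0// mulr_gt0.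
move=> f w Sf mw wd; have [PhiL1 PhifM] := PhiM f Sf.
have iPhi : mu.-integrable setT (EFin \o (Phi \o sqmod f)) by apply/Lfun1_integrable.
have mPhi : measurable_fun setT (Phi \o sqmod f).
  by apply/measurable_EFinP; exact: measurable_int iPhi.
have mf : measurable_fun setT (sqmod f).
  by apply: measurable_sqmod; have [] := SL2 _ Sf.
apply: (@le_lt_trans _ _ (\int[mu]_(x in w) (A'%:E + K^-1%:E * (Phi (sqmod f x))%:E))%E).
  apply: ge0_le_integral => //.
  - by move=> x _; rewrite lee_fin sqmod_ge0.
  - by apply/measurable_EFinP; exact: measurable_funTS.
  - apply/measurable_EFinP; apply: measurable_funD => //.
    by apply: measurable_funM => //; exact: measurable_funTS.
  - by move=> x _; rewrite -EFinM -EFinD lee_fin mulrC sP// sqmod_ge0.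
rewrite ge0_integralD//; last 3 first.
- by move=> x _; rewrite lee_fin ltW.
- by move=> x _; rewrite -EFinM lee_fin mulr_ge0// invr_ge0 ltW.
- apply/measurable_EFinP.
  by apply: measurable_funM => //; exact: measurable_funTS.
rewrite integral_cst// ge0_integralZl_EFin//; last 3 first.
- by move=> x _; rewrite lee_fin.
- by apply/measurable_EFinP; exact: measurable_funTS.
- by rewrite invr_ge0 ltW.
have wfin : mu w \is a fin_num by exact: fin_num_measure.
have le1 : (\int[mu]_(x in w) (Phi (sqmod f x))%:E <= `|M|%:E)%E.
  apply: (@le_trans _ _ (\int[mu]_x (Phi (sqmod f x))%:E)%E).
    apply: ge0_subset_integral => //; first by apply/measurable_EFinP.
    by move=> x _; rewrite lee_fin.
  move: PhifM; rewrite Lnorm1 => PhifM.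
  apply: (@le_trans _ _ M%:E); last by rewrite lee_fin ler_norm.
  apply: le_trans PhifM; rewrite le_eqVlt; apply/orP; left; apply/eqP.
  by apply: eq_integral => x _ /=; rewrite ger0_norm.
apply: (@le_lt_trans _ _ (A'%:E * mu w + K^-1%:E * `|M|%:E)%E).
  by rewrite leeD2l// lee_wpmul2l// lee_fin invr_ge0 ltW.
have {}wd : (mu w < (eps / (2 * A'))%:E)%E := wd.
move: wd; rewrite -(fineK wfin) -!EFinM -EFinD !lte_fin => wd.
rewrite (splitr eps); apply: ltr_leD.
  have A2 : 0 < 2 * A' by rewrite mulr_gt0.
  rewrite ltr_pdivlMr// in wd; rewrite ltr_pdivlMr//; apply: le_lt_trans wd.
  by rewrite le_eqVlt; apply/orP; left; apply/eqP; ring.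
rewrite /K invf_div mulrAC ler_pdivrMr ?mulr_gt0 ?ltr_wpDl//.
by have := normr_ge0 M; nra.
Qed.

End YoungUsi.

(** * Density of trigonometric polynomials *)

Section complex_measurable.
Context (d : measure_display) (X : measurableType d) (R : realType).
Implicit Types f g : X -> R[i].

Lemma cmeasurable_cst (c : R[i]) : cmeasurable (fun _ : X => c).
Proof. by split. Qed.

Lemma cmeasurableD f g : cmeasurable f -> cmeasurable g ->
  cmeasurable (fun x => f x + g x).
Proof.
move=> [fr fi] [gr gi]; split.
  rewrite (_ : (fun x => _) = (fun x => complex.Re (f x) + complex.Re (g x))).
    exact: measurable_funD.
  by apply/funext => x; case: (f x) (g x) => ? ? [].
rewrite (_ : (fun x => _) = (fun x => complex.Im (f x) + complex.Im (g x))).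
  exact: measurable_funD.
by apply/funext => x; case: (f x) (g x) => ? ? [].
Qed.

Lemma cmeasurableM f g : cmeasurable f -> cmeasurable g ->
  cmeasurable (fun x => f x * g x).
Proof.
move=> [fr fi] [gr gi]; split.
  rewrite (_ : (fun x => _) = (fun x =>
      complex.Re (f x) * complex.Re (g x) - complex.Im (f x) * complex.Im (g x))).
    by apply: measurable_funB; apply: measurable_funM.
  by apply/funext => x; case: (f x) (g x) => ? ? [].
rewrite (_ : (fun x => _) = (fun x =>
    complex.Re (f x) * complex.Im (g x) + complex.Im (f x) * complex.Re (g x))).
  by apply: measurable_funD; apply: measurable_funM.
by apply/funext => x; case: (f x) (g x) => ? ? [].
Qed.

Lemma cmeasurableB f g : cmeasurable f -> cmeasurable g ->
  cmeasurable (fun x => f x - g x).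
Proof.
move=> mf mg; rewrite (_ : (fun x => _) = (fun x => f x + (-1) * g x)).
  by apply: cmeasurableD => //; apply: cmeasurableM => //; exact: cmeasurable_cst.
by apply/funext => x; rewrite mulN1r.
Qed.

Lemma cmeasurable_real (h : X -> R) : measurable_fun setT h ->
  cmeasurable (fun x => (h x)%:C).
Proof. by move=> mh; split => //=; exact: measurable_cst. Qed.

Lemma cmeasurable_expi (h : X -> R) : measurable_fun setT h ->
  cmeasurable (fun x => expi (h x)).
Proof.
move=> mh; split => /=; apply: measurableT_comp => //.
  by apply: continuous_measurable_fun; exact: continuous_cos.
by apply: continuous_measurable_fun; exact: continuous_sin.
Qed.

Lemma cmeasurable_comp (d' : measure_display) (Y : measurableType d') (f : X -> R[i])
    (phi : Y -> X) : cmeasurable f -> measurable_fun setT phi ->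
  cmeasurable (fun y => f (phi y)).
Proof.
by move=> [fr fi] mphi; split;
  [exact: measurableT_comp fr mphi|exact: measurableT_comp fi mphi].
Qed.

End complex_measurable.

Section exponential.
Context (R : realType).

Lemma expiD (a b : R) : expi (a + b) = expi a * expi b.
Proof. by rewrite /expi cosD sinD; apply/eqP; rewrite eq_complex/= eqxx/= addrC eqxx. Qed.

Lemma expi0 : expi 0 = 1 :> R[i].
Proof. by rewrite /expi cos0 sin0. Qed.

Lemma sqn_expi (a : R) : sqn (expi a) = 1.
Proof. by rewrite /sqn /expi/= cos2Dsin2. Qed.

End exponential.

Definition lin_closed (X : Type) (R : realType) (P : set (X -> R[i])) :=
  forall c p q, P p -> P q -> P (fun x => (c * p x + q x)%R).

Section L2_density.
Context (d : measure_display) (X : measurableType d) (R : realType).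
Variable mu : {finite_measure set X -> \bar R}.
Implicit Types f g : X -> R[i].
Local Open Scope ereal_scope.

Lemma int_sqmodD_on D f g : measurable D -> cmeasurable f -> cmeasurable g ->
  \int[mu]_(x in D) (sqmod (fun x => (f x + g x)%R) x)%:E <=
    2%:E * \int[mu]_(x in D) (sqmod f x)%:E + 2%:E * \int[mu]_(x in D) (sqmod g x)%:E.
Proof.
move=> mD mf mg.
rewrite -!ge0_integralZl_EFin//; try exact: measurable_sqmodE;
  try by (move=> x _; rewrite lee_fin sqmod_ge0).
rewrite -ge0_integralD//; last 4 first.
- by move=> x _; rewrite -EFinM lee_fin mulr_ge0// sqmod_ge0.
- by apply: measurable_funeM; exact: measurable_sqmodE.
- by move=> x _; rewrite -EFinM lee_fin mulr_ge0// sqmod_ge0.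
- by apply: measurable_funeM; exact: measurable_sqmodE.
apply: ge0_le_integral => //.
- by move=> x _; rewrite lee_fin sqmod_ge0.
- by apply: measurable_sqmodE; exact: cmeasurableD.
- by apply: emeasurable_funD; apply: measurable_funeM; exact: measurable_sqmodE.
- by move=> x _; rewrite -!EFinM -EFinD lee_fin !sqmodE sqn_add2.
Qed.

Lemma int_sqmodD f g : cmeasurable f -> cmeasurable g ->
  \int[mu]_x (sqmod (fun x => (f x + g x)%R) x)%:E <=
    2%:E * \int[mu]_x (sqmod f x)%:E + 2%:E * \int[mu]_x (sqmod g x)%:E.
Proof. exact: int_sqmodD_on. Qed.

Lemma int_sqmodZ (c : R[i]) f : cmeasurable f ->
  \int[mu]_x (sqmod (fun x => (c * f x)%R) x)%:E =
    (sqn c)%:E * \int[mu]_x (sqmod f x)%:E.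
Proof.
move=> mf; rewrite -ge0_integralZl_EFin ?sqn_ge0//.
- by apply: eq_integral => x _; rewrite -EFinM !sqmodE sqnM.
- by move=> x _; rewrite lee_fin sqmod_ge0.
- exact: measurable_sqmodE.
Qed.

Lemma cLfun2_lin (c : R[i]) f g : cLfun mu 2%:E f -> cLfun mu 2%:E g ->
  cLfun mu 2%:E (fun x => (c * f x + g x)%R).
Proof.
move=> /cLfun2P[mf fl] /cLfun2P[mg gl].
have mcf : cmeasurable (fun x => (c * f x)%R).
  by apply: cmeasurableM => //; exact: cmeasurable_cst.
apply/cLfun2P; split; first exact: cmeasurableD.
apply: (le_lt_trans (int_sqmodD mcf mg)); rewrite int_sqmodZ//.
rewrite -ge0_fin_numE ?int_sqmod_ge0// in fl.
rewrite -ge0_fin_numE ?int_sqmod_ge0// in gl.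
by rewrite -(fineK fl) -(fineK gl) -!EFinM -EFinD ltry.
Qed.

Lemma cLfun2_cst (c : R[i]) : cLfun mu 2%:E (fun=> c).
Proof.
apply/cLfun2P; split; first exact: cmeasurable_cst.
under eq_integral do rewrite sqmodE.
have fin : (sqn c)%:E * mu setT < +oo.
  by rewrite -(fineK (fin_num_measure mu setT measurableT)) -EFinM ltry.
by rewrite integral_cst.
Qed.

Lemma cLfun2B f g : cLfun mu 2%:E f -> cLfun mu 2%:E g ->
  cLfun mu 2%:E (fun x => (f x - g x)%R).
Proof.
move=> fL gL; rewrite (_ : (fun x => _) = (fun x => ((-1) * g x + f x)%R)).
  exact: cLfun2_lin.
by apply/funext => x; rewrite mulN1r addrC.
Qed.

Lemma le_cLfun2 f g : cmeasurable f -> cLfun mu 2%:E g ->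
  (forall x, sqmod f x <= sqmod g x)%R -> cLfun mu 2%:E f.
Proof.
move=> mf /cLfun2P[mg gl] fg; apply/cLfun2P; split => //.
apply: le_lt_trans gl; apply: ge0_le_integral => //.
- by move=> x _; rewrite lee_fin sqmod_ge0.
- exact: measurable_sqmodE.
- exact: measurable_sqmodE.
- by move=> x _; rewrite lee_fin.
Qed.

(** The closure for the L^2 distance, expressed with squared norms so that no square root occurs. *)
Definition L2closure (P : set (X -> R[i])) : set (X -> R[i]) :=
  [set f | cLfun mu 2%:E f /\ forall eta : R, (0 < eta)%R -> exists2 p, P p &
     \int[mu]_x (sqmod (fun x => (f x - p x)%R) x)%:E < eta%:E].

Section closure_theory.
Variable P : set (X -> R[i]).
Hypothesis PL2 : P `<=` cLfun mu 2%:E.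
Hypothesis Plin : lin_closed P.

Lemma subset_L2closure : P `<=` L2closure P.
Proof.
move=> p Pp; split=> [|eta eta0]; first exact: PL2.
exists p => //; rewrite integral0_eq ?lte_fin// => x _.
by rewrite sqmodE subrr sqn0.
Qed.

Lemma L2closure_lin : lin_closed (L2closure P).
Proof.
move=> c f g [fL fP] [gL gP]; split; first exact: cLfun2_lin.
move=> eta eta0.
(* The two errors enter as 2 |c|^2 eta / (4 (|c|^2 + 1)) and 2 eta / 4, each at most eta / 2. The
   added 1 covers c = 0. *)
have c1 : (0 < 4 * (sqn c + 1))%R by rewrite mulr_gt0// ltr_wpDl// sqn_ge0.
have [p Pp fp] := fP (eta / (4 * (sqn c + 1)))%R (divr_gt0 eta0 c1).
have [q Pq gq] := gP (eta / 4)%R (divr_gt0 eta0 (ltr0n _ 4)).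
exists (fun x => c * p x + q x)%R; first exact: Plin.
have mfp : cmeasurable (fun x => f x - p x)%R.
  by apply: cmeasurableB; [have [] := fL|have [] := PL2 Pp].
have mgq : cmeasurable (fun x => g x - q x)%R.
  by apply: cmeasurableB; [have [] := gL|have [] := PL2 Pq].
have mcfp : cmeasurable (fun x => c * (f x - p x))%R.
  by apply: cmeasurableM => //; exact: cmeasurable_cst.
have := int_sqmodD mcfp mgq; rewrite int_sqmodZ//.
rewrite (_ : (fun x => _) = (fun x => c * f x + g x - (c * p x + q x))%R); last first.
  by apply/funext => x; ring.
move=> /le_lt_trans; apply.
have [a -> /andP[a0 al]] := ge0_lt_EFin (int_sqmod_ge0 mu _ setT) fp.
have [b -> /andP[_ bl]] := ge0_lt_EFin (int_sqmod_ge0 mu _ setT) gq.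
rewrite -!EFinM -EFinD lte_fin.
move: al; rewrite ltr_pdivlMr// => al.
by have := sqn_ge0 c; nra.
Qed.

Lemma L2closure_closed f : cLfun mu 2%:E f ->
  (forall eta : R, (0 < eta)%R -> exists2 g, L2closure P g &
     \int[mu]_x (sqmod (fun x => (f x - g x)%R) x)%:E < eta%:E) -> L2closure P f.
Proof.
move=> fL fg; split => // eta eta0.
have [g [gL gP] fgl] := fg (eta / 4)%R (divr_gt0 eta0 (ltr0n _ 4)).
have [p Pp gp] := gP (eta / 4)%R (divr_gt0 eta0 (ltr0n _ 4)).
exists p => //.
have mfg : cmeasurable (fun x => f x - g x)%R.
  by apply: cmeasurableB; [have [] := fL|have [] := gL].
have mgp : cmeasurable (fun x => g x - p x)%R.
  by apply: cmeasurableB; [have [] := gL|have [] := PL2 Pp].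
have := int_sqmodD mfg mgp.
rewrite (_ : (fun x => _) = (fun x => f x - p x)%R); last first.
  by apply/funext => x; ring.
move=> /le_lt_trans; apply.
have -> : eta%:E = 2%:E * (eta / 4)%:E + 2%:E * (eta / 4)%:E.
  by rewrite -!EFinM -EFinD; congr EFin; field.
by apply: lteD; rewrite lte_pmul2l.
Qed.

Lemma L2closure_dominated f (g : nat -> X -> R[i]) (G : X -> R) :
  cLfun mu 2%:E f -> (forall n, L2closure P (g n)) ->
  mu.-integrable setT (EFin \o G) ->
  (forall n, {ae mu, forall x, sqn (f x - g n x) <= G x}%R) ->
  {ae mu, forall x, (sqn (f x - g n x) @[n --> \oo] --> 0)%R} -> L2closure P f.
Proof.
move=> fL gP iG fgG fg0; apply: L2closure_closed => // eta eta0.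
pose h n x : \bar R := (sqmod (fun x => (f x - g n x)%R) x)%:E.
have mh n : measurable_fun setT (h n).
  by apply: measurable_sqmodE; apply: cmeasurableB; [have [] := fL|have [[]] := gP n].
have [] := @dominated_convergence _ _ _ mu setT measurableT h (cst 0) (EFin \o G) mh.
- exact: measurable_cst.
- apply: filterS fg0 => x fgx _; rewrite /h; apply: cvg_EFin.
    by apply: nearW.
  by under eq_fun do rewrite /= sqmodE.
- exact: iG.
- have /ae_foralln : forall n, {ae mu, forall x, (sqn (f x - g n x) <= G x)%R} by [].
  apply: filterS => x fgx n _; rewrite /h lee_fin ger0_norm ?sqmod_ge0//.
  by rewrite sqmodE.
move=> _ _; rewrite integral0.
move=> /(_ _ (@nbhs_open_ereal_lt R 0 (cst eta) eta0))[N _ /(_ N (leqnn N)) gN].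
by exists (g N).
Qed.

End closure_theory.

End L2_density.

(** * Reduction of density to indicators *)

Section density_from_indicators.
Context (d : measure_display) (X : measurableType d) (R : realType).
Variable mu : {finite_measure set X -> \bar R}.
Variable P : set (X -> R[i]).
Hypothesis PL2 : P `<=` cLfun mu 2%:E.
Hypothesis Plin : lin_closed P.

Local Notation L2cl := (L2closure mu P).

Definition cindic (A : set X) (x : X) : R[i] := (\1_A x)%:C.

Lemma cmeasurable_cindic A : measurable A -> cmeasurable (cindic A).
Proof. by move=> mA; apply: cmeasurable_real; exact: measurable_indic. Qed.

Lemma cLfun2_cindic A : measurable A -> cLfun mu 2%:E (cindic A).
Proof.
move=> mA; apply: (@le_cLfun2 _ _ _ mu _ (fun=> 1)).
- exact: cmeasurable_cindic.
- exact: cLfun2_cst.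
- move=> x; rewrite !sqmodE sqn1 sqn_real indicE.
  by case: (_ \in _); rewrite ?expr1n ?expr0n.
Qed.

Hypothesis P0 : P (fun=> 0).
Hypothesis Pind : forall A, measurable A -> L2cl (cindic A).

Lemma L2closure0 : L2cl (fun=> 0).
Proof. exact: subset_L2closure. Qed.

Lemma L2closureZ c f : L2cl f -> L2cl (fun x => c * f x).
Proof.
move=> /(L2closure_lin PL2 Plin c) /(_ L2closure0).
by congr (L2cl _); apply/funext => x; rewrite addr0.
Qed.

Lemma L2closureD f g : L2cl f -> L2cl g -> L2cl (fun x => f x + g x).
Proof.
move=> /(L2closure_lin PL2 Plin 1) h /h.
by congr (L2cl _); apply/funext => x; rewrite mul1r.
Qed.

Lemma L2closure_nnsfun (g : {nnsfun X >-> R}) : L2cl (fun x => (g x)%:C).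
Proof.
rewrite (_ : (fun x => _) = fun x => \sum_(y <- finmap.enum_fset (fset_set (range g)))
    (y%:C * cindic (g @^-1` [set y]) x)); last first.
  apply/funext => x; rewrite {1}fimfunE fsbig_finite//= rmorph_sum/=.
  by apply: eq_bigr => y _; rewrite rmorphM.
elim: (finmap.enum_fset _) => [|y s IH].
  by under eq_fun do rewrite big_nil; exact: L2closure0.
under eq_fun do rewrite big_cons; apply: L2closureD => //.
by apply: L2closureZ; exact: Pind.
Qed.

Lemma L2closure_nonneg (h : X -> R) : (forall x, 0 <= h x) ->
  cLfun mu 2%:E (fun x => (h x)%:C) -> L2cl (fun x => (h x)%:C).
Proof.
move=> h0 hL.
have mh : measurable_fun setT h by have [[]] := hL.
have mh' : measurable_fun setT (EFin \o h) by apply/measurable_EFinP.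
have ndg := nd_nnsfun_approx measurableT mh'.
have cvg := cvg_nnsfun_approx measurableT mh' (fun x _ => h0 x).
set g := nnsfun_approx measurableT mh' in ndg cvg.
have cvgr x : g n x @[n --> \oo] --> h x.
  by have /fine_cvgP[_] := cvg x I.
have gh n x : g n x <= h x.
  rewrite -(cvg_lim _ (cvgr x))//; apply: nondecreasing_cvgn_le.
    by move=> m k mk; have /lefP := ndg _ _ mk; exact.
  by apply/cvg_ex; exists (h x).
apply: (L2closure_dominated PL2 hL (g := fun n x => (g n x)%:C)).
- by move=> n; exact: L2closure_nnsfun.
- exact: cLfun2_integrable hL.
- move=> n; apply: nearW => x; rewrite sqmodE -rmorphB/= !sqn_real.
  by rewrite ler_sqr ?nnegrE ?subr_ge0 ?gh// lerBlDr lerDl.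
- apply: nearW => x.
  rewrite (_ : (fun n => _) = fun n => (h x - g n x) ^+ 2); last first.
    by apply/funext => n; rewrite -rmorphB/= sqn_real.
  have : (h x - g n x) ^+ 2 @[n --> \oo] --> (h x - h x) ^+ 2.
    apply: (@cvgM _ _ _ _ (fun n => h x - g n x) (fun n => h x - g n x));
      by apply: cvgB => //; exact: cvg_cst.
  by rewrite subrr expr0n.
Qed.

Lemma L2closure_all f : cLfun mu 2%:E f -> L2cl f.
Proof.
move=> fL; have [[mr mi] _] := fL.
have real_case (h : X -> R) : measurable_fun setT h ->
    (forall x, h x ^+ 2 <= sqmod f x) -> L2cl (fun x => (h x)%:C).
  move=> mh hf.
  have part (k : X -> R) : measurable_fun setT k -> (forall x, 0 <= k x) ->
      (forall x, k x <= `|h x|) -> L2cl (fun x => (k x)%:C).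
    move=> mk k0 kh; apply: L2closure_nonneg => //.
    apply: le_cLfun2 fL _; first exact: cmeasurable_real.
    move=> x; rewrite sqmodE sqn_real; apply: le_trans (hf x).
    by rewrite -(real_normK (num_real (h x))) ler_sqr ?nnegrE.
  rewrite (_ : (fun x => _) =
      (fun x => (Num.max (h x) 0)%:C + (-1) * (Num.max (- h x) 0)%:C)).
    apply: L2closureD; [|apply: L2closureZ]; apply: part => //.
    - exact: measurable_maxr.
    - by move=> x; rewrite le_max lexx orbT.
    - by move=> x; rewrite ge_max ler_norm/=.
    - by apply: measurable_maxr => //; exact: measurable_funN.
    - by move=> x; rewrite le_max lexx orbT.
    - by move=> x; rewrite ge_max -normrN ler_norm/=.
  apply/funext => x.
  have {1}-> : h x = Num.max (h x) 0 - Num.max (- h x) 0.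
    have [h0|h0] := lerP 0 (h x).
      by rewrite max_r ?subr0// oppr_le0.
    by rewrite max_l ?sub0r ?opprK// oppr_ge0 ltW.
  by rewrite mulN1r rmorphB.
rewrite (_ : f = fun x => (complex.Re (f x))%:C + 'i * (complex.Im (f x))%:C).
  apply: L2closureD; [|apply: L2closureZ]; apply: real_case => // x;
    by rewrite sqmodE /sqn ?lerDl ?lerDr sqr_ge0.
by apply/funext => x; rewrite [LHS]complexE mulrC.
Qed.

End density_from_indicators.

Section lambda.
Context (d : measure_display) (X : measurableType d) (R : realType).
Variable mu : {finite_measure set X -> \bar R}.
Variable P : set (X -> R[i]).
Hypothesis PL2 : P `<=` cLfun mu 2%:E.
Hypothesis Plin : lin_closed P.
Hypothesis P0 : P (fun=> 0).

(** Differences of nested sets are handled by linearity and increasing unions by continuity of the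
    finite measure. Intersections would require products of approximants, which L^2 closures do not
    control; hence a Dynkin class instead of a sigma-algebra. *)
Lemma indicator_lambda_system :
  P (fun=> 1) -> lambda_system setT
    [set A | measurable A /\ L2closure mu P (cindic R A)].
Proof.
move=> P1; split => //.
- split => //; rewrite (_ : cindic R setT = fun=> 1).
    exact: subset_L2closure.
  by apply/funext => x; rewrite /cindic indicE in_setT.
- move=> A B BA [mA cA] [mB cB]; split; first exact: measurableD.
  rewrite (_ : cindic R _ = fun x => cindic R A x + (-1) * cindic R B x).
    by apply: L2closureD => //; exact: L2closureZ.
  apply/funext => x; rewrite mulN1r /cindic -rmorphB/= !indicE in_setD; congr (_%:C).
  have := BA x; have [xB|xB] := boolP (x \in B); have [xA|xA] := boolP (x \in A) => //=.
  - by rewrite subrr.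
  - by move=> /(_ (set_mem xB)) /mem_set; rewrite (negbTE xA).
  - by rewrite subr0.
  - by rewrite subr0.
- move=> F ndF FP; have mF n : measurable (F n) by have [] := FP n.
  have mU : measurable (\bigcup_n F n) by exact: bigcup_measurable.
  split => //; apply: (L2closure_closed PL2); first exact: cLfun2_cindic.
  move=> eta eta0.
  have : \forall n \near \oo, (mu (\bigcup_n F n `\` F n) < eta%:E)%E.
    apply: decreasing_measure_small => //.
    - by move=> n; exact: measurableD.
    - by move=> n m nm; apply: setDS; apply/subsetPset; exact: ndF.
    - by rewrite -subset0 => x Fx; have [[i _ Fi] _] := Fx 0%N I; have [_] := Fx i I.
  move=> [n _ /(_ n (leqnn n)) nP]; exists (cindic R (F n)); first by have [] := FP n.
  apply: le_lt_trans nP.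
  rewrite (eq_integral (fun x => (\1_(\bigcup_n F n `\` F n) x)%:E)); last first.
    move=> x _; rewrite sqmodE /cindic -rmorphB/= sqn_real !indicE in_setD; congr EFin.
    have [xF|xF] := boolP (x \in F n) => /=.
      rewrite (_ : x \in _ = true) ?subrr ?expr0n//; apply/mem_set.
      by exists n => //; exact: set_mem.
    by rewrite subr0 andbT; case: (_ \in _); rewrite ?expr1n ?expr0n.
  by rewrite integral_indic ?setIT//; exact: measurableD.
Qed.

(** Dynkin's theorem: only the indicators of a generating family stable under intersection have to
    be approximated. *)
Lemma L2closure_generated (G : set (set X)) :
  P (fun=> 1) -> setI_closed G -> @measurable d X = <<s G >> ->
  (forall A, G A -> measurable A /\ L2closure mu P (cindic R A)) ->
  forall f, cLfun mu 2%:E f -> L2closure mu P f.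
Proof.
move=> P1 GI GE GP; apply: L2closure_all => // A mA.
have [] // : [set A | measurable A /\ L2closure mu P (cindic R A)] A.
by apply: (lambda_system_subset GI (indicator_lambda_system P1) GP) => //; rewrite -GE.
Qed.

End lambda.

Section product_density.
Context d1 d2 (X1 : measurableType d1) (X2 : measurableType d2) (R : realType).
Variables (m1 : {finite_measure set X1 -> \bar R}) (m2 : {finite_measure set X2 -> \bar R}).

Lemma prod_finite : fin_num_fun (m1 \x m2)%E.
Proof.
move=> A mA; rewrite ge0_fin_numE//.
have le : ((m1 \x m2)%E A <= (m1 \x m2)%E setT)%E.
  by apply: le_measure; rewrite ?inE.
apply: (le_lt_trans le); rewrite -setXTT product_measure1E//.
by apply: lte_mul_pinfty => //; [exact: fin_num_measure|
  rewrite -ge0_fin_numE//; exact: fin_num_measure].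
Qed.

Definition finite_product : {finite_measure set (X1 * X2)%type -> \bar R} :=
  HB.pack (m1 \x m2)%E (Measure_isFinite.Build _ _ _ (m1 \x m2)%E prod_finite).

Variables (P1 : set (X1 -> R[i])) (P2 : set (X2 -> R[i])) (P : set (X1 * X2 -> R[i])).
Hypothesis PL2 : P `<=` cLfun finite_product 2%:E.
Hypothesis Plin : lin_closed P.
Hypothesis P0 : P (fun=> 0).
Hypothesis P1' : P (fun=> 1).
Hypothesis P12 : forall p1 p2, P1 p1 -> P2 p2 -> P (fun z => p1 z.1 * p2 z.2).
Hypothesis P1L2 : P1 `<=` cLfun m1 2%:E.
Hypothesis P2L2 : P2 `<=` cLfun m2 2%:E.
Hypothesis P1d : forall f, cLfun m1 2%:E f -> L2closure m1 P1 f.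
Hypothesis P2d : forall f, cLfun m2 2%:E f -> L2closure m2 P2 f.

Lemma int_sqmod_prod f1 f2 : cmeasurable f1 -> cmeasurable f2 ->
  (\int[finite_product]_z (sqmod (fun z => f1 z.1 * f2 z.2)%R z)%:E =
   (\int[m1]_x (sqmod f1 x)%:E) * (\int[m2]_y (sqmod f2 y)%:E))%E.
Proof.
move=> mf1 mf2.
have mf : cmeasurable (fun z : X1 * X2 => f1 z.1 * f2 z.2).
  by apply: cmeasurableM; [exact: cmeasurable_comp mf1 measurable_fst|
    exact: cmeasurable_comp mf2 measurable_snd].
transitivity (\int[m1]_x \int[m2]_y (sqmod (fun z => f1 z.1 * f2 z.2)%R (x, y))%:E)%E.
  rewrite /finite_product/= fubini_tonelli1//.
    exact: measurable_sqmodE.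
  by move=> x; rewrite lee_fin sqmod_ge0.
under eq_integral => x _.
  under eq_integral => y _ do rewrite sqmodE/= sqnM -!sqmodE EFinM.
  rewrite ge0_integralZl_EFin ?sqmod_ge0//; last 2 first.
    by move=> y _; rewrite lee_fin sqmod_ge0.
    exact: measurable_sqmodE.
  over.
rewrite ge0_integralZr//.
- exact: measurable_sqmodE.
- by move=> x _; rewrite lee_fin sqmod_ge0.
- exact: int_sqmod_ge0.
Qed.

(** Measurable rectangles form a generating family stable under intersection, and 1_A(x) 1_B(y) -
    p1(x) p2(y) = (1_A - p1)(x) 1_B(y) + p1(x) (1_B - p2)(y), where the norm of each term
    factors. *)
Lemma L2closure_product f : cLfun finite_product 2%:E f -> L2closure finite_product P f.
Proof.
apply: (@L2closure_generated _ _ _ finite_product P PL2 Plin P0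
  [set A `*` B | A in measurable & B in measurable]) => //.
- move=> _ _ [A1 mA1 [B1 mB1 <-]] [A2 mA2 [B2 mB2 <-]].
  rewrite -setXI; exists (A1 `&` A2); first exact: measurableI.
  by exists (B1 `&` B2) => //; exact: measurableI.
- by rewrite measurable_prod_measurableType.
move=> _ [A mA [B mB <-]]; split; first exact: measurableX.
have [_ AP] := P1d (cLfun2_cindic m1 mA).
have [_ BP] := P2d (cLfun2_cindic m2 mB).
split; first by apply: cLfun2_cindic; exact: measurableX.
move=> eta eta0.
have L2fin e (Y : measurableType e) (m : {finite_measure set Y -> \bar R}) (g : Y -> R[i]) :
    cLfun m 2%:E g -> exists2 c : R, 0 <= c & (\int[m]_x (sqmod g x)%:E = c%:E)%E.
  move=> /cLfun2P[_]; have := int_sqmod_ge0 m g setT.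
  by case: (\int[m]_x _)%E => // c; rewrite lee_fin => c0 _; exists c.
have [c2 c20 c2E] := L2fin _ _ _ _ (cLfun2_cindic m2 mB).
have c2' : 0 < 4 * (c2 + 1) by rewrite mulr_gt0// ltr_wpDl.
have [p1 Pp1 Ap1] := AP (eta / (4 * (c2 + 1))) (divr_gt0 eta0 c2').
(* The tolerance for [p2] depends on the norm of [p1], so [p1] has to be chosen before it. *)
have [c1 c10 c1E] := L2fin _ _ _ _ (P1L2 Pp1).
have c1' : 0 < 4 * (c1 + 1) by rewrite mulr_gt0// ltr_wpDl.
have [p2 Pp2 Bp2] := BP (eta / (4 * (c1 + 1))) (divr_gt0 eta0 c1').
exists (fun z => p1 z.1 * p2 z.2); first exact: P12.
have mA' := cmeasurable_cindic R mA; have mB' := cmeasurable_cindic R mB.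
have [mp1 _] := P1L2 Pp1; have [mp2 _] := P2L2 Pp2.
have mAp1 := cmeasurableB mA' mp1; have mBp2 := cmeasurableB mB' mp2.
have m12 (g1 : X1 -> R[i]) (g2 : X2 -> R[i]) : cmeasurable g1 -> cmeasurable g2 ->
    cmeasurable (fun z : X1 * X2 => g1 z.1 * g2 z.2).
  by move=> mg1 mg2; apply: cmeasurableM; [exact: cmeasurable_comp mg1 measurable_fst|
    exact: cmeasurable_comp mg2 measurable_snd].
have := int_sqmodD finite_product (m12 _ _ mAp1 mB') (m12 _ _ mp1 mBp2).
rewrite (_ : (fun z => _) = fun z => cindic R (A `*` B) z - p1 z.1 * p2 z.2); last first.
  apply/funext => z.
  have -> : cindic R (A `*` B) z = cindic R A z.1 * cindic R B z.2.
    rewrite /cindic -rmorphM/= !indicE; congr (_%:C); rewrite -natrM mulnb; congr (_%:R).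
    by congr nat_of_bool; apply/idP/andP => [/set_mem[/mem_set ? /mem_set]//|[/set_mem ? /set_mem ?]];
      exact/mem_set.
  by ring.
move=> /le_lt_trans; apply.
rewrite (int_sqmod_prod mAp1 mB') (int_sqmod_prod mp1 mBp2) c1E c2E.
have [a -> /andP[a0 al]] := ge0_lt_EFin (int_sqmod_ge0 m1 _ setT) Ap1.
have [b -> /andP[b0 bl]] := ge0_lt_EFin (int_sqmod_ge0 m2 _ setT) Bp2.
rewrite -!EFinM -EFinD lte_fin.
move: al bl; rewrite !ltr_pdivlMr// => al bl.
by nra.
Qed.

End product_density.

(** * The algebra of trigonometric polynomials *)

Section trigonometric_polynomials.
Context (X K : Type) (R : realType) (phi : K -> X -> R).

(** The phases are abstract so that the circle, the torus and space-time share the same lemmas.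
    Frequencies may repeat in the list, which makes addition a concatenation. *)
Definition trig : set (X -> R[i]) := [set p | exists s : seq (R[i] * K),
  p = fun x => \sum_(c <- s) c.1 * expi (phi c.2 x)].

Lemma trig_lin : lin_closed trig.
Proof.
move=> a _ _ [s ->] [t ->]; exists ([seq (a * c.1, c.2) | c <- s] ++ t).
apply/funext => x; rewrite big_cat big_map/= mulr_sumr; congr (_ + _).
by apply: eq_bigr => c _; rewrite mulrA.
Qed.

Lemma trig0 : trig (fun=> 0).
Proof. by exists [::]; apply/funext => x; rewrite big_nil. Qed.

Lemma trigD p q : trig p -> trig q -> trig (fun x => p x + q x).
Proof.
by move=> tp tq; have := trig_lin 1 tp tq; congr (trig _); apply/funext => x; rewrite mul1r.
Qed.

Lemma trigZ a p : trig p -> trig (fun x => a * p x).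
Proof.
by move=> tp; have := trig_lin a tp trig0; congr (trig _); apply/funext => x; rewrite addr0.
Qed.

Lemma trig_exp k : trig (fun x => expi (phi k x)).
Proof. by exists [:: (1, k)]; apply/funext => x; rewrite big_seq1 mul1r. Qed.

End trigonometric_polynomials.

(** Three families of phases, so that a product of polynomials in separate variables is covered as
    well as a product within one algebra. *)
Lemma trig_mul (X K1 K2 K : Type) (R : realType) (phi1 : K1 -> X -> R)
    (phi2 : K2 -> X -> R) (phi : K -> X -> R) p q :
  (forall k l, exists m, forall x, phi1 k x + phi2 l x = phi m x) ->
  trig phi1 p -> trig phi2 q -> trig phi (fun x => p x * q x).
Proof.
move=> phiD [s ->] tq; elim: s => [|c s IH].
  by under eq_fun do rewrite big_nil mul0r; exact: trig0.
under eq_fun do rewrite big_cons mulrDl -mulrA.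
apply: trigD => //; apply: trigZ => {IH}.
have [t ->] := tq; elim: t => [|d t IH].
  by under eq_fun do rewrite big_nil mulr0; exact: trig0.
under eq_fun do rewrite big_cons mulrDr mulrCA -expiD.
apply: trigD => //; apply: trigZ.
have [m mE] := phiD c.2 d.2; under eq_fun do rewrite mE.
exact: trig_exp.
Qed.

Section trigonometric_algebra.
Context (X K : Type) (R : realType) (phi : K -> X -> R).
Local Notation trig := (trig phi).
Hypothesis phi0 : exists k, forall x, phi k x = 0.
Hypothesis phiD : forall k l, exists m, forall x, phi k x + phi l x = phi m x.

Lemma trig_cst a : trig (fun=> a).
Proof.
by have [k k0] := phi0; exists [:: (a, k)]; apply/funext => x; rewrite big_seq1/= k0 expi0 mulr1.
Qed.

Lemma trigM p q : trig p -> trig q -> trig (fun x => p x * q x).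
Proof. exact: (trig_mul phiD). Qed.

Lemma trigX p n : trig p -> trig (fun x => p x ^+ n).
Proof.
move=> tp; elim: n => [|n IH].
  by under eq_fun do rewrite expr0; exact: trig_cst.
by under eq_fun do rewrite exprS; exact: trigM.
Qed.

End trigonometric_algebra.

Lemma trig_comp (X Y K : Type) (R : realType) (phi : K -> Y -> R) (h : X -> Y) p :
  trig phi p -> trig (fun k x => phi k (h x)) (fun x => p (h x)).
Proof. by move=> [s ->]; exists s. Qed.

Section trig_L2.
Context (d : measure_display) (X : measurableType d) (K : Type) (R : realType).
Variables (mu : {finite_measure set X -> \bar R}) (phi : K -> X -> R).
Hypothesis mphi : forall k, measurable_fun setT (phi k).

Lemma trig_cLfun2 : trig phi `<=` cLfun mu 2%:E.
Proof.
move=> _ [s ->]; elim: s => [|c s IH].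
  by under eq_fun do rewrite big_nil; exact: cLfun2_cst.
under eq_fun do rewrite big_cons; apply: cLfun2_lin => //.
apply: (@le_cLfun2 _ _ _ mu _ (fun=> 1)).
- exact: cmeasurable_expi.
- exact: cLfun2_cst.
- by move=> x; rewrite !sqmodE sqn_expi sqn1.
Qed.

End trig_L2.

Section stone_weierstrass_bump.
Context (R : realType).
Implicit Types q : R.

Lemma bernoulli_ge (x : R) n : 0 <= x -> x <= 1 -> 1 - n%:R * x <= (1 - x) ^+ n.
Proof.
move=> x0 x1; elim: n => [|n IH]; first by rewrite mul0r subr0 expr0.
rewrite exprS -natr1.
have : (1 - x) * (1 - n%:R * x) <= (1 - x) * (1 - x) ^+ n.
  by rewrite ler_wpM2l// subr_ge0.
have : 0 <= n%:R * (x * x) by rewrite !mulr_ge0.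
by lra.
Qed.

(** By Bernoulli's inequality the left-hand side is at most (1 - x)^n (1 + x)^n = (1 - x^2)^n. *)
Lemma bernoulli_le (x : R) n : 0 <= x -> x <= 1 -> (1 - x) ^+ n * (1 + n%:R * x) <= 1.
Proof.
move=> x0 x1.
have h : 1 + n%:R * x <= (1 + x) ^+ n.
  elim: n => [|n IH]; first by rewrite mul0r addr0 expr0.
  rewrite exprS -natr1.
  have : (1 + x) * (1 + n%:R * x) <= (1 + x) * (1 + x) ^+ n.
    by rewrite ler_wpM2l// addr_ge0.
  have : 0 <= n%:R * (x * x) by rewrite !mulr_ge0.
  by lra.
apply: (@le_trans _ _ ((1 - x) ^+ n * (1 + x) ^+ n)).
  by rewrite ler_wpM2l// exprn_ge0// subr_ge0.
rewrite -exprMn exprn_ile1//; nra.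
Qed.

(* As [m] grows, the bump tends to [1] for [q < 1 / 2] and to [0] for
   [1 / 2 < q <= 1]: the classical polynomials in proofs of the Stone-Weierstrass
   theorem. *)
Definition bump (m : nat) q := (1 - q ^+ m) ^+ (2 ^ m).

Lemma bump_ge0 m q : 0 <= q <= 1 -> 0 <= bump m q.
Proof.
by move=> /andP[q0 q1]; rewrite exprn_ge0// subr_ge0 exprn_ile1.
Qed.

Lemma bump_le1 m q : 0 <= q <= 1 -> bump m q <= 1.
Proof.
move=> /andP[q0 q1]; rewrite exprn_ile1// ?subr_ge0 ?exprn_ile1//.
by rewrite gerBl exprn_ge0.
Qed.

(** Bernoulli's inequality for x = q^m and the exponent 2^m bounds the bump below by 1 - (2q)^m. *)
Lemma bump_cvg1 q : 0 <= q < 1 / 2 -> bump m q @[m --> \oo] --> (1 : R).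
Proof.
move=> /andP[q0 q2].
apply: (@squeeze_cvgr _ _ _ _ (fun m => 1 - (2 * q) ^+ m) (cst 1)).
- apply: nearW => m /=; rewrite bump_le1 ?q0 ?andbT; last by lra.
  rewrite exprMn -natrX; apply: bernoulli_ge; first exact: exprn_ge0.
  by apply: exprn_ile1 => //; lra.
- rewrite -[X in _ --> X]subr0; apply: cvgB; first exact: cvg_cst.
  by apply: cvg_expr; rewrite ger0_norm; lra.
- exact: cvg_cst.
Qed.

(** The reverse estimate [bernoulli_le] bounds the bump above by (2q)^-m, where 2q > 1. *)
Lemma bump_cvg0 q : 1 / 2 < q <= 1 -> bump m q @[m --> \oo] --> (0 : R).
Proof.
move=> /andP[q2 q1].
apply: (@squeeze_cvgr _ _ _ _ (cst 0) (fun m => ((2 * q)^-1) ^+ m)).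
- apply: nearW => m /=; rewrite bump_ge0/=; last by lra.
  have qm : 0 < (2 * q) ^+ m by rewrite exprn_gt0//; lra.
  rewrite exprVn -[_^-1]mul1r ler_pdivlMr//.
  have q0 : 0 <= q by lra.
  have qm0 : 0 <= q ^+ m by exact: exprn_ge0.
  have qm1 : q ^+ m <= 1 by exact: exprn_ile1.
  have := bernoulli_le (2 ^ m) qm0 qm1; apply: le_trans.
  by rewrite ler_wpM2l ?bump_ge0 ?q0// natrX -exprMn lerDr.
- exact: cvg_cst.
- apply: cvg_expr; rewrite ger0_norm ?invr_ge0; last by lra.
  by rewrite invf_lt1; lra.
Qed.

End stone_weierstrass_bump.

(** * Density on the circle and on tori *)

Section circle.
Context (R : realType).
Local Notation circle := (circle_measure R).

(** Neither the complement of the open interval nor a single point is charged; the free point [c] is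
    meant for the jump of an indicator. *)
Lemma circle_ae (c : R) (Q : R -> Prop) :
  (forall t, 0 < t < 2 * pi -> t != c -> Q t) -> {ae circle, forall t, Q t}.
Proof.
move=> Qt; exists (~` `]0, 2 * pi[%classic `|` [set c]); split.
- by apply: measurableU => //; apply: measurableC; exact: measurable_itv.
- change (lebesgue_measure ((~` `]0, 2 * pi[%classic `|` [set c]) `&`
    @fundamental_interval R) = 0%E).
  apply/eqP; rewrite eq_le measure_ge0 andbT.
  apply: (@le_trans _ _ (lebesgue_measure ([set (0 : R)] `|` [set c] : set (measurableTypeR R)))).
    apply: le_measure; rewrite ?inE.
    + apply: measurableI; last exact: measurable_itv.
      by apply: measurableU => //; apply: measurableC; exact: measurable_itv.
    + exact: measurableU.
    + move=> t [[nt|->]]; last by right.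
      rewrite /fundamental_interval/= in_itv/= => /andP[t0 t2]; left.
      apply/eqP; rewrite eq_le t0 andbT leNgt; apply/negP => t0'.
      by apply: nt; rewrite /= in_itv/= t0'.
  apply: (le_trans (measureU2 lebesgue_measure _ _)) => //.
  by rewrite [X in (X + _)%E]lebesgue_measure_set1 [X in (_ + X)%E]lebesgue_measure_set1 adde0.
- move=> t /= nQ; apply: contrapT => /not_orP[/contrapT t2 tc]; apply: nQ.
  by apply: Qt; [move: t2; rewrite /= in_itv|exact/eqP].
Qed.

Definition circle_phase (m : int) (t : measurableTypeR R) : R := m%:~R * t.

Lemma measurable_circle_phase m : measurable_fun setT (circle_phase m).
Proof. by apply: measurable_funM. Qed.

Lemma circle_phase0 : exists k, forall t, circle_phase k t = 0.
Proof. by exists 0 => t; rewrite /circle_phase mul0r. Qed.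

Lemma circle_phaseD k l : exists m, forall t,
  circle_phase k t + circle_phase l t = circle_phase m t.
Proof. by exists (k + l) => t; rewrite /circle_phase intrD mulrDl. Qed.

(* For [0 < t < 2 pi], below [1 / 2] exactly when [t < c], see [ray_thresholdE]. *)
Definition ray_threshold (c t : R) : R := 1 / 2 - (cos (t - c / 2) - cos (c / 2)) / 4.

Lemma ray_threshold01 c t : 0 <= ray_threshold c t <= 1.
Proof.
have := cos_geN1 (t - c / 2); have := cos_le1 (t - c / 2).
have := cos_geN1 (c / 2); have := cos_le1 (c / 2).
by rewrite /ray_threshold; lra.
Qed.

(** A product-to-sum formula that exposes the sign: for t and c in (0, 2 pi) the first sine is
    positive and the second has the sign of t - c. *)
Lemma ray_thresholdE c t :
  ray_threshold c t = 1 / 2 + sin (t / 2) * sin ((t - c) / 2) / 2.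
Proof.
rewrite /ray_threshold.
have -> : t - c / 2 = t / 2 + (t - c) / 2 by field.
have -> : cos (c / 2) = cos (t / 2 - (t - c) / 2) by congr cos; field.
by rewrite cosD cosB; field.
Qed.

Lemma trig_ray_threshold c :
  trig circle_phase (fun t => (ray_threshold c t)%:C).
Proof.
rewrite (_ : (fun t => _) = (fun t => (1 / 2 + cos (c / 2) / 4)%:C +
   ((- (1 / 8))%:C * expi (- (c / 2)) * expi (circle_phase 1 t) +
    (- (1 / 8))%:C * expi (c / 2) * expi (circle_phase (-1) t)))).
  apply: trigD; first exact: (trig_cst circle_phase0).
  by apply: trigD; apply: trigZ; exact: trig_exp.
apply/funext => t.
have -> : circle_phase 1 t = t by rewrite /circle_phase mulr1z mul1r.
have -> : circle_phase (-1) t = - t by rewrite /circle_phase mulrN1z mulN1r.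
rewrite -!mulrA -!expiD (_ : c / 2 + - t = - (t - c / 2)); last by ring.
rewrite (_ : - (c / 2) + t = t - c / 2); last by ring.
rewrite /ray_threshold /expi cosN sinN; apply/eqP; rewrite eq_complex/=.
by apply/andP; split; apply/eqP; field.
Qed.

Lemma trig_bump c m : trig circle_phase (fun t => (1 - bump m (ray_threshold c t))%:C).
Proof.
rewrite (_ : (fun t => _) = (fun t => 1 + (-1) * (1 + (-1) * (ray_threshold c t)%:C ^+ m) ^+ (2 ^ m))).
  apply: trigD; first exact: (trig_cst circle_phase0).
  apply: trigZ; apply: (trigX circle_phase0 circle_phaseD).
  apply: trigD; first exact: (trig_cst circle_phase0).
  apply: trigZ; apply: (trigX circle_phase0 circle_phaseD).
  exact: trig_ray_threshold.
by apply/funext => t; rewrite /bump !mulN1r rmorphB/= rmorphXn/= rmorphB/= rmorphXn/= rmorph1.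
Qed.

(** For 0 < c < 2 pi the polynomials 1 - [bump] of the threshold converge to the indicator at every
    t in (0, 2 pi) other than c, and stay between 0 and 1. For any other c the indicator is constant
    almost everywhere on the circle. *)
Lemma L2closure_ray (c : R) :
  L2closure circle (trig circle_phase)
    (cindic R (`]c, +oo[%classic : set (measurableTypeR R))).
Proof.
have PL2 := @trig_cLfun2 _ _ _ _ circle circle_phase measurable_circle_phase.
have mray : measurable (`]c, +oo[%classic : set (measurableTypeR R)).
  exact: measurable_itv.
have fL := cLfun2_cindic circle mray.
have [c0|c0] := lerP c 0.
  apply: (L2closure_dominated PL2 fL (g := fun _ _ => 1) (G := cst 0)).
  - by move=> n; apply: subset_L2closure => //; exact: (trig_cst circle_phase0).
  - exact: finite_measure_integrable_cst.
  - move=> n; apply: (@circle_ae 0) => t /andP[t0 _] _.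
    by rewrite /cindic indicE mem_set ?subrr ?sqn0//= in_itv/= (le_lt_trans c0).
  - apply: (@circle_ae 0) => t /andP[t0 _] _.
    rewrite /cindic indicE mem_set ?subrr ?sqn0//= ?in_itv/= ?(le_lt_trans c0)//.
    exact: cvg_cst.
have [c2|c2] := lerP (2 * pi) c.
  apply: (L2closure_dominated PL2 fL (g := fun _ _ => 0) (G := cst 0)).
  - by move=> n; apply: subset_L2closure => //; exact: trig0.
  - exact: finite_measure_integrable_cst.
  - move=> n; apply: (@circle_ae 0) => t /andP[_ t2] _.
    by rewrite /cindic indicE memNset ?subrr ?sqn0//= in_itv/= andbT; apply/negP;
      rewrite -leNgt (le_trans (ltW t2)).
  - apply: (@circle_ae 0) => t /andP[_ t2] _.
    rewrite /cindic indicE memNset ?subrr ?sqn0//=; first exact: cvg_cst.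
    by rewrite in_itv/= andbT; apply/negP; rewrite -leNgt (le_trans (ltW t2)).
apply: (L2closure_dominated PL2 fL
  (g := fun m t => (1 - bump m (ray_threshold c t))%:C) (G := cst 1)).
- by move=> n; apply: subset_L2closure => //; exact: trig_bump.
- exact: finite_measure_integrable_cst.
- move=> n; apply: nearW => t; rewrite /cindic -rmorphB/= sqn_real indicE.
  have := bump_ge0 n (ray_threshold01 c t); have := bump_le1 n (ray_threshold01 c t).
  by case: (_ \in _) => /=; nra.
- apply: (@circle_ae c) => t /andP[t0 t2] tc.
  have st : 0 < sin (t / 2) by apply: sin_gt0_pi; lra.
  under eq_fun do rewrite /cindic -rmorphB/= sqn_real.
  have lim (l : R) : bump n (ray_threshold c t) @[n --> \oo] --> l ->
      (\1_`]c, +oo[%classic t - (1 - bump n (ray_threshold c t))) ^+ 2 @[n --> \oo] -->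
      (\1_`]c, +oo[%classic t - (1 - l)) ^+ 2.
    move=> bl; apply: (@cvgM _ _ _ _ (fun n => \1_`]c, +oo[%classic t - (1 - bump n (ray_threshold c t)))
       (fun n => \1_`]c, +oo[%classic t - (1 - bump n (ray_threshold c t))));
      by apply: cvgB; [exact: cvg_cst|apply: cvgB => //; exact: cvg_cst].
  have [tc'|ct|tc'] := ltrgtP t c; last by rewrite tc' eqxx in tc.
    have s2 : sin ((t - c) / 2) < 0.
      have : 0 < sin ((c - t) / 2) by apply: sin_gt0_pi; lra.
      by rewrite (_ : (c - t) / 2 = - ((t - c) / 2)) ?sinN ?oppr_gt0//; field.
    have := lim 1; rewrite indicE memNset; last by rewrite /= in_itv/= andbT; lra.
    rewrite subrr subr0 expr0n; apply; apply: bump_cvg1.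
    have /andP[-> _] /= := ray_threshold01 c t.
    by rewrite ray_thresholdE; nra.
  have s2 : 0 < sin ((t - c) / 2) by apply: sin_gt0_pi; lra.
  have := lim 0; rewrite indicE mem_set; last by rewrite /= in_itv/= andbT.
  rewrite subr0 subrr expr0n; apply; apply: bump_cvg0.
  have /andP[_ ->] /= := ray_threshold01 c t; rewrite andbT.
  by rewrite ray_thresholdE; nra.
Qed.

Lemma circle_density f : cLfun circle 2%:E f -> L2closure circle (trig circle_phase) f.
Proof.
apply: (@L2closure_generated _ _ _ circle _ _ (@trig_lin _ _ _ circle_phase)
  (@trig0 _ _ _ circle_phase) (@RGenOInfty.G R)).
- exact: (@trig_cLfun2 _ _ _ _ circle circle_phase measurable_circle_phase).
- exact: (trig_cst circle_phase0).
- move=> _ _ [x ->] [y ->]; exists (Num.max x y).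
  by apply/seteqP; split => t /=; rewrite !in_itv/= !andbT gt_max => /andP.
- exact: RGenOInfty.measurableE.
- move=> _ [x ->]; split; first exact: measurable_itv.
  exact: L2closure_ray.
Qed.

End circle.

Section torus_density.
Context (R : realType).
Local Notation circle := (circle_measure R).

Lemma measurable_dotp n (k : 'I_n -> int) : measurable_fun setT (@dotp R n k).
Proof.
apply: measurable_sum => j; apply: measurable_funM => //; exact: measurable_tnth.
Qed.

Lemma dotp0 n : exists k, forall x, @dotp R n k x = 0.
Proof. by exists (fun=> 0) => x; rewrite /dotp big1// => j _; rewrite mul0r. Qed.

Lemma dotp_cons n (k : 'I_n.+1 -> int) (t : R) (x : torus R n) :
  dotp k (cons_pair (t, x)) = circle_phase (k ord0) t + dotp (k \o lift ord0) x.
Proof.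
rewrite /dotp big_ord_recl; congr (_ + _); apply: eq_bigr => j _ /=.
by rewrite (tnth_nth 0) [in RHS](tnth_nth 0).
Qed.

Definition spacetime_phase n (k : int * ('I_n -> int)) (z : spacetime R n) : R :=
  circle_phase k.1 z.1 + dotp k.2 z.2.

Lemma measurable_spacetime_phase n k : measurable_fun setT (@spacetime_phase n k).
Proof.
apply: measurable_funD.
  exact: measurableT_comp (measurable_circle_phase _) measurable_fst.
exact: measurableT_comp (measurable_dotp _) measurable_snd.
Qed.

Lemma spacetime_phase0 n : exists k, forall z, @spacetime_phase n k z = 0.
Proof.
have [k kE] := dotp0 n; have [m mE] := circle_phase0 R.
by exists (m, k) => z; rewrite /spacetime_phase/= mE kE addr0.
Qed.

(* Convertible to [spacetime_measure], with its structure of finite measure. *)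
Definition spacetime_fin n : {finite_measure set (spacetime R n) -> \bar R} :=
  finite_product circle (torus_measure R n).

(** Through [cons_pair], space-time over T^n is also the torus of dimension n + 1: this serves both
    as the induction step for tori and, once they are done, as the passage to space-time. *)
Lemma spacetime_density_rec n :
  (forall f, cLfun (torus_measure R n) 2%:E f ->
    L2closure (torus_measure R n) (trig (@dotp R n)) f) ->
  forall f, cLfun (spacetime_fin n) 2%:E f ->
    L2closure (spacetime_fin n) (trig (@spacetime_phase n)) f.
Proof.
move=> IH f fL; apply: (@L2closure_product _ _ _ _ _ circle (torus_measure R n)
  (trig (@circle_phase R)) (trig (@dotp R n))) fL.
- exact: (@trig_cLfun2 _ _ _ _ _ _ (@measurable_spacetime_phase n)).
- exact: trig_lin.
- exact: trig0.
- exact: (trig_cst (spacetime_phase0 n)).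
- move=> p1 p2 /(trig_comp (fst : spacetime R n -> R)) tp1.
  move=> /(trig_comp (snd : spacetime R n -> torus R n)) tp2.
  by apply: (trig_mul _ tp1 tp2) => k l; exists (k, l).
- exact: (@trig_cLfun2 _ _ _ _ _ _ (@measurable_circle_phase R)).
- exact: (@trig_cLfun2 _ _ _ _ _ _ (@measurable_dotp n)).
- exact: circle_density.
- exact: IH.
Qed.

Lemma ge0_integral_torusS n (f : torus R n.+1 -> \bar R) :
  measurable_fun setT f -> (forall x, 0 <= f x)%E ->
  (\int[torus_measure R n.+1]_x f x = \int[spacetime_fin n]_z f (cons_pair z))%E.
Proof.
move=> mf f0.
have := @ge0_integral_pushforward _ _ _ _ _ _ (@measurable_cons_pair R n)
  (spacetime_fin n) setT f measurableT mf (fun x _ => f0 x).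
by rewrite preimage_setT.
Qed.

Definition uncons n (k : int * ('I_n -> int)) : 'I_n.+1 -> int :=
  fun j => if unlift ord0 j is Some i then k.2 i else k.1.

Lemma dotp_uncons n k (z : spacetime R n) :
  dotp (uncons k) (cons_pair z) = spacetime_phase k z.
Proof.
case: z => t x; rewrite dotp_cons /uncons unlift_none /spacetime_phase/=.
by congr (_ + _); apply: eq_bigr => j _ /=; rewrite liftK.
Qed.

Lemma torus_density n f : cLfun (torus_measure R n) 2%:E f ->
  L2closure (torus_measure R n) (trig (@dotp R n)) f.
Proof.
elim: n f => [|n IH] f fL.
  (* The torus of dimension 0 is a point, where every function is constant. *)
  have PL2 := @trig_cLfun2 _ _ _ _ (torus_measure R 0) _ (@measurable_dotp 0).
  apply: (subset_L2closure PL2).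
  rewrite (_ : f = fun=> f [tuple]); first exact: (trig_cst (dotp0 0)).
  by apply/funext => x; rewrite (tuple0 x).
have [mf fl] := fL; split => // eta eta0.
pose g : spacetime R n -> R[i] := f \o @cons_pair R n.
have mg : cmeasurable g.
  by apply: cmeasurable_comp mf _; exact: measurable_cons_pair.
have gL : cLfun (spacetime_fin n) 2%:E g.
  apply/cLfun2P; split => //; have /cLfun2P[_] := fL.
  rewrite ge0_integral_torusS//; first exact: measurable_sqmodE.
  by move=> x; rewrite lee_fin sqmod_ge0.
have [_ /(_ _ eta0)[_ [s ->] gs]] := spacetime_density_rec IH gL.
have tp : trig (@dotp R n.+1) (fun x => \sum_(c <- s) c.1 * expi (dotp (uncons c.2) x)).
  exists [seq (c.1, uncons c.2) | c <- s].
  by apply/funext => x; rewrite big_map.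
exists (fun x => \sum_(c <- s) c.1 * expi (dotp (uncons c.2) x)) => //.
rewrite ge0_integral_torusS.
- apply: le_lt_trans gs; rewrite le_eqVlt; apply/orP; left; apply/eqP.
  apply: eq_integral => z _; rewrite !sqmodE /g /=.
  by congr (sqn (_ - _))%:E; apply: eq_bigr => c _; rewrite dotp_uncons.
- apply: measurable_sqmodE; apply: cmeasurableB => //.
  by have [] := @trig_cLfun2 _ _ _ _ (torus_measure R n.+1) _ (@measurable_dotp n.+1) _ tp.
- by move=> x; rewrite lee_fin sqmod_ge0.
Qed.

Lemma spacetime_density n f : cLfun (spacetime_fin n) 2%:E f ->
  L2closure (spacetime_fin n) (trig (@spacetime_phase n)) f.
Proof. by apply: spacetime_density_rec => g; exact: torus_density. Qed.

End torus_density.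

(** * Multipliers *)

Section clipping.
Context (R : realType).
Implicit Types (B x y : R) (z w : R[i]).

Definition clipr B x : R := Num.max (- B) (Num.min B x).
(** The nearest-point projection onto the square of half-side B: it is continuous, and it brings z
    no farther from any point of the square. *)
Definition clip B z : R[i] := clipr B (complex.Re z) +i* clipr B (complex.Im z).

Lemma clipr_bound B x : 0 <= B -> - B <= clipr B x <= B.
Proof.
by move=> B0; rewrite /clipr le_max lexx/= ge_max ge_min lexx/= andbT; lra.
Qed.

Lemma clipr_id B x : - B <= x <= B -> clipr B x = x.
Proof. by move=> /andP[Bx xB]; rewrite /clipr (min_r xB) (max_r Bx). Qed.

Lemma clipr_contract B x y : - B <= y <= B -> (y - clipr B x) ^+ 2 <= (y - x) ^+ 2.
Proof.
move=> /andP[By yB]; rewrite /clipr.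
have [xB|Bx] := lerP x B.
  have [Bx'|xB'] := lerP (- B) x; first by [].
  by nra.
by rewrite max_r; [nra|lra].
Qed.

Definition boxed B z := - B <= complex.Re z <= B /\ - B <= complex.Im z <= B.

Lemma boxed_clip B z : 0 <= B -> boxed B (clip B z).
Proof. by move=> B0; split; exact: clipr_bound. Qed.

Lemma clip_id B z : boxed B z -> clip B z = z.
Proof. by case: z => a b [/= hr hi]; rewrite /clip/= !clipr_id. Qed.

Lemma clip_contract B z w : boxed B w -> sqn (w - clip B z) <= sqn (w - z).
Proof.
case: z w => [a b] [a' b'] [/= hr hi]; rewrite /sqn/=.
by apply: lerD; exact: clipr_contract.
Qed.

(** Each of the two components differs by at most 2B. *)
Lemma sqn_boxed B z w : boxed B z -> boxed B w -> sqn (z - w) <= 8 * B ^+ 2.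
Proof.
case: z w => [a b] [a' b'] [/= h1 h2] [/= h3 h4]; rewrite /sqn/=.
by move: h1 h2 h3 h4 => /andP[? ?] /andP[? ?] /andP[? ?] /andP[? ?]; nra.
Qed.

Lemma boxed_sqn B z : 0 <= B -> sqn z <= B ^+ 2 -> boxed B z.
Proof.
case: z => a b B0; rewrite /sqn/= => h; rewrite /boxed/= -!ler_norml.
have := sqr_ge0 a; have := sqr_ge0 b => b0 a0.
by split; rewrite -(ler_sqr (normr_ge0 _)) ?nnegrE// real_normK ?num_real//; lra.
Qed.

End clipping.

Lemma cmeasurable_clip d (X : measurableType d) (R : realType) (f : X -> R[i]) B :
  cmeasurable f -> cmeasurable (fun x => clip B (f x)).
Proof.
by move=> [mr mi]; split => /=; apply: measurable_maxr => //; exact: measurable_minr.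
Qed.

Section multipliers.
Context d d' (X : measurableType d) (X' : measurableType d') (R : realType).
Variables (mu : {finite_measure set X -> \bar R}) (mu' : {finite_measure set X' -> \bar R}).
Variable h : X -> X'.
Hypothesis mh : measurable_fun setT h.

(** Where |b - a|^2 < s, the mass of u, at most 1, is multiplied by at most s; on the remaining set,
    small by Markov's inequality, |b - a|^2 <= 8 B^2 and u has little mass. The same [p] serves all
    u in [U]. *)
Lemma multiplier_approximation (U : set (X -> R[i])) (b : X' -> R[i]) (B : R)
    (P : set (X' -> R[i])) :
  (forall u, U u -> cmeasurable u /\ (\int[mu]_z (sqmod u z)%:E <= 1)%E) ->
  (forall eps : R, 0 < eps -> exists2 delta : R, 0 < delta &
     forall w u, measurable w -> (mu' w < delta%:E)%E -> U u ->
       (\int[mu]_(z in h @^-1` w) (sqmod u z)%:E <= eps%:E)%E) ->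
  0 <= B -> cmeasurable b -> (forall x, boxed B (b x)) ->
  P `<=` cLfun mu' 2%:E -> L2closure mu' P b ->
  forall eps : R, 0 < eps -> exists2 p, P p & forall u, U u ->
    (\int[mu]_z (sqmod (fun z => (b (h z) - clip B (p (h z))) * u z)%R z)%:E <= eps%:E)%E.
Proof.
move=> UL UI B0 mb bB PL [bL bP] eps eps0.
(* The exceptional set contributes at most 8 B^2 eps / (2 (8 B^2 + 1)) <= eps / 2; the added 1 keeps
   the denominator positive. *)
have C0 : 0 < 2 * (8 * B ^+ 2 + 1) by rewrite mulr_gt0// ltr_wpDl// mulr_ge0// sqr_ge0.
have [delta d0 dP] := UI (eps / (2 * (8 * B ^+ 2 + 1))) (divr_gt0 eps0 C0).
pose s := eps / 2; have s0 : 0 < s by rewrite divr_gt0.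
(* Markov's inequality at level s then gives measure at most delta / 2 < delta. *)
have [p Pp bp] := bP (delta * s / 2) (divr_gt0 (mulr_gt0 d0 s0) (ltr0n _ 2)).
exists p => // u Uu; have [mu_u u1] := UL u Uu.
have [mp _] := PL _ Pp.
pose a x := clip B (p x); have ma : cmeasurable a by exact: cmeasurable_clip.
have mba := cmeasurableB mb ma.
have baL : cLfun mu' 2%:E (fun x => b x - a x).
  (* The clipped polynomial is dominated by the constant 3B, since its squared modulus is at most 2
     B^2. *)
  apply: cLfun2B => //; apply: (@le_cLfun2 _ _ _ mu' _ (fun=> (3 * B)%:C)) => //.
    exact: cLfun2_cst.
  move=> x; rewrite !sqmodE.
  have [/andP[? ?] /andP[? ?]] := boxed_clip (p x) B0.
  by rewrite (sqn_real (3 * B)) /a /sqn; nra.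
pose w := [set x | s <= sqmod (fun x => b x - a x) x].
have mw : measurable w.
  rewrite -[w]setTI; apply: measurable_fun_ler => //; exact: measurable_sqmod.
have wd : (mu' w < delta%:E)%E.
  have le : (\int[mu']_x (sqmod (fun x => b x - a x) x)%:E <= (delta * s / 2)%:E)%E.
    apply: le_trans (ltW bp); apply: ge0_le_integral => //.
    - by move=> x _; rewrite lee_fin sqmod_ge0.
    - exact: measurable_sqmodE.
    - by apply: measurable_sqmodE; exact: cmeasurableB.
    - by move=> x _; rewrite lee_fin !sqmodE clip_contract.
  apply: (le_lt_trans (tail_measure_le baL s0 le)).
  by rewrite lte_fin ltr_pdivrMr//; have := mulr_gt0 d0 s0; lra.
have mhw : measurable (h @^-1` w) by rewrite -[X in measurable X]setTI; exact: mh.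
have wu := dP w u mw wd Uu.
have mpatch : measurable_fun setT ((fun z => (sqmod u z)%:E) \_ (h @^-1` w)).
  by apply/(measurable_restrictT _ mhw); exact: measurable_sqmodE.
have patch_ge0 z : (0 <= ((fun z => (sqmod u z)%:E) \_ (h @^-1` w)) z)%E.
  by rewrite patchE; case: ifP => // _; rewrite lee_fin sqmod_ge0.
apply: (@le_trans _ _ (\int[mu]_z (s%:E * (sqmod u z)%:E +
    (8 * B ^+ 2)%:E * ((fun z => (sqmod u z)%:E) \_ (h @^-1` w)) z))%E).
  apply: ge0_le_integral => //.
  - by move=> z _; rewrite lee_fin sqmod_ge0.
  - apply: measurable_sqmodE; apply: cmeasurableM => //.
    exact: cmeasurable_comp mba mh.
  - apply: emeasurable_funD; apply: measurable_funeM => //; exact: measurable_sqmodE.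
  - move=> z _; rewrite patchE !sqmodE sqnM.
    have u0 := sqn_ge0 (u z).
    case: ifPn => [zw|/negP zw].
      rewrite -!EFinM -EFinD lee_fin -mulrDl ler_wpM2r//.
      apply: (@le_trans _ _ (8 * B ^+ 2)); last by rewrite lerDr ltW.
      by apply: sqn_boxed => //; exact: boxed_clip.
    rewrite mule0 adde0 -EFinM lee_fin ler_wpM2r// leNgt; apply/negP => sb.
    by apply: zw; apply/mem_set; rewrite /w /= sqmodE ltW.
rewrite ge0_integralD//; last 4 first.
- by move=> z _; rewrite -EFinM lee_fin mulr_ge0 ?(ltW s0)// sqmod_ge0.
- by apply: measurable_funeM; exact: measurable_sqmodE.
- by move=> z _; rewrite mule_ge0// lee_fin mulr_ge0// sqr_ge0.
- exact: measurable_funeM.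
rewrite !ge0_integralZl_EFin//; last 4 first.
- by rewrite mulr_ge0// sqr_ge0.
- by move=> z _; rewrite lee_fin sqmod_ge0.
- exact: measurable_sqmodE.
- exact: ltW.
rewrite -integral_mkcond (splitr eps) EFinD; apply: leeD.
  by rewrite -[leRHS]mule1; apply: lee_wpmul2l => //; rewrite lee_fin ltW.
have B8 : (0 <= (8 * B ^+ 2)%:E)%E by rewrite lee_fin mulr_ge0// sqr_ge0.
apply: (le_trans (lee_wpmul2l B8 wu)).
rewrite -EFinM lee_fin mulrA ler_pdivrMr//.
by have := sqr_ge0 B; nra.
Qed.

End multipliers.

Section Loo.
Context d (X : measurableType d) (R : realType).
Variable mu : {finite_measure set X -> \bar R}.

Lemma cLfunoo_boxed b : cLfun mu +oo%E b ->
  cmeasurable b /\ exists2 B : R, 0 <= B & {ae mu, forall x, boxed B (b x)}.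
Proof.
move=> [mb bl]; split => //; have [B B0 bB] := Lnormoo_bounded bl.
exists B => //; apply: filterS bB => x /= bx; apply: boxed_sqn => //.
rewrite -normc_sqn -(real_normK (num_real (Normc.normc _))) ler_sqr ?nnegrE//.
Qed.

Lemma sqn_boxed0 (B : R) z : boxed B z -> sqn z <= 2 * B ^+ 2.
Proof.
case: z => a b [/= h1 h2]; rewrite /sqn/=.
by move: h1 h2 => /andP[? ?] /andP[? ?]; nra.
Qed.

End Loo.

Section Y0_multipliers.
Context (R : realType) (d : nat).
Local Notation mu := (spacetime_fin R d).

Lemma multiplication_bounded (b : spacetime R d -> R[i]) (B : R) u :
  cmeasurable b -> {ae mu, forall z, boxed B (b z)} -> cLfun mu 2%:E u ->
  cLfun mu 2%:E (multiplication b u) /\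
  (cLnorm mu 2%:E (multiplication b u) <=
     (Num.sqrt (2 * B ^+ 2))%:E * cLnorm mu 2%:E u)%E.
Proof.
move=> mb bB uL; have [mu_u _] := uL.
have B0 : 0 <= 2 * B ^+ 2 by rewrite mulr_ge0// sqr_ge0.
have mbu : cmeasurable (multiplication b u) by exact: cmeasurableM.
have le : (\int[mu]_z (sqmod (multiplication b u) z)%:E <=
    (2 * B ^+ 2)%:E * \int[mu]_z (sqmod u z)%:E)%E.
  rewrite -ge0_integralZl_EFin//; last 2 first.
  - by move=> z _; rewrite lee_fin sqmod_ge0.
  - exact: measurable_sqmodE.
  apply: ae_ge0_le_integral => //.
  - by move=> z _; rewrite lee_fin sqmod_ge0.
  - exact: measurable_sqmodE.
  - by move=> z _; rewrite -EFinM lee_fin mulr_ge0// sqmod_ge0.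
  - by apply: measurable_funeM; exact: measurable_sqmodE.
  - apply: filterS bB => z bz _; rewrite -EFinM lee_fin !sqmodE sqnM.
    by rewrite ler_wpM2r ?sqn_ge0// sqn_boxed0.
have /cLfun2P[_ ul] := uL.
have [r rE] : exists r, (\int[mu]_z (sqmod u z)%:E = r%:E)%E.
  by move: (int_sqmod_ge0 mu u setT) ul; case: (\int[mu]_z _)%E => // r _ _; exists r.
have r0 : 0 <= r by have := int_sqmod_ge0 mu u setT; rewrite rE lee_fin.
rewrite rE -EFinM in le.
split; first by apply/cLfun2P; split => //; apply: (le_lt_trans le); rewrite ltry.
rewrite [in leRHS]cLnorm2E rE poweR12_sqrt ?lee_fin//= -EFinM -sqrtrM//.
by rewrite cLnorm2_le ?sqrtr_ge0// sqr_sqrtr// mulr_ge0.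
Qed.

Lemma multiplication_Y (b : spacetime R d -> R[i]) (B : R) :
  cmeasurable b -> {ae mu, forall z, boxed B (b z)} -> Y (multiplication b).
Proof.
move=> mb bB; split.
- by move=> u [uL _]; have [] := multiplication_bounded mb bB uL.
- move=> c u v _ _; apply: nearW => z _ /=; rewrite /multiplication; ring.
- exists (Num.sqrt (2 * B ^+ 2)) => u [uL _].
  by have [] := multiplication_bounded mb bB uL.
Qed.

Lemma multiplication_Y0 d' (X' : measurableType d')
    (mu' : {finite_measure set X' -> \bar R}) (h : spacetime R d -> X')
    (P : set (X' -> R[i])) (b : X' -> R[i]) :
  measurable_fun setT h ->
  (forall Q : X' -> Prop, {ae mu', forall x, Q x} -> {ae mu, forall z, Q (h z)}) ->
  (forall eps : R, 0 < eps -> exists2 delta : R, 0 < delta &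
     forall w u, measurable w -> (mu' w < delta%:E)%E -> free_waves u ->
       (\int[mu]_z (sqmod u z)%:E <= 1)%E ->
       (\int[mu]_(z in h @^-1` w) (sqmod u z)%:E <= eps%:E)%E) ->
  P `<=` cLfun mu' 2%:E -> (forall f, cLfun mu' 2%:E f -> L2closure mu' P f) ->
  (forall B p, P p -> C0 (fun z => clip B (p (h z)))) ->
  cLfun mu' +oo%E b -> Y0 (multiplication (b \o h)).
Proof.
move=> mh aeh UI PL Pd PC0 /cLfunoo_boxed[mb [B B0 bB]].
have mbh : cmeasurable (b \o h) by exact: cmeasurable_comp mb mh.
split; first exact: multiplication_Y mbh (aeh _ bB).
(* [b] lies in the square only almost everywhere; [b'] does so everywhere and defines the same
   multiplier almost everywhere. *)
move=> eps eps0; pose b' x := clip B (b x).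
have mb' : cmeasurable b' by exact: cmeasurable_clip.
have b'L : cLfun mu' 2%:E b'.
  apply: (@le_cLfun2 _ _ _ mu' _ (fun=> (2 * B)%:C)) => //; first exact: cLfun2_cst.
  move=> x; rewrite !sqmodE (sqn_real (2 * B)).
  apply: (le_trans (sqn_boxed0 (boxed_clip (b x) B0))).
  by have := sqr_ge0 B; nra.
(* Squared because integrals are squared norms, and halved because the supremum of norms below eps
   could equal eps. *)
have e0 : 0 < (eps / 2) ^+ 2 by rewrite exprn_gt0// divr_gt0.
pose U := [set u : spacetime R d -> R[i] | free_waves u /\ (\int[mu]_z (sqmod u z)%:E <= 1)%E].
have [|eps' eps'0|p Pp pU] := @multiplier_approximation _ _ _ _ R mu mu' h mh U b' B P
  _ _ B0 mb' (fun x => boxed_clip (b x) B0) PL (Pd _ b'L) _ e0.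
- by move=> u [[[mu_u _] _] u1].
- have [delta d0 dP] := UI _ eps'0; exists delta => // w u mw wd [fu u1].
  exact: dP.
exists (fun z => clip B (p (h z))); first exact: PC0.
apply: (@le_lt_trans _ _ (eps / 2)%:E); last by rewrite lte_fin; lra.
apply: ub_ereal_sup => _ [u [fu u1] <-].
have u1' : (\int[mu]_z (sqmod u z)%:E <= 1)%E.
  by have := u1; rewrite (cLnorm2_le mu u ler01) expr1n.
have [[mu_u _] _] := fu.
rewrite cLnorm2_le; last by rewrite ltW// divr_gt0.
have := pU u (conj fu u1'); apply: le_trans.
have mp : cmeasurable p by have [] := PL _ Pp.
have mcp : cmeasurable (fun z => clip B (p (h z))).
  exact: cmeasurable_comp (cmeasurable_clip B mp) mh.
rewrite le_eqVlt; apply/orP; left; apply/eqP; apply: ae_eq_integral => //.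
- by apply: measurable_sqmodE; apply: cmeasurableB; exact: cmeasurableM.
- apply: measurable_sqmodE; apply: cmeasurableM => //; apply: cmeasurableB => //.
  exact: cmeasurable_comp mb' mh.
- apply: filterS (aeh _ bB) => z bz _; rewrite !sqmodE /multiplication /b' /=.
  by rewrite (clip_id bz) mulrBl.
Qed.

End Y0_multipliers.

(** * Continuity and periodicity of trigonometric polynomials *)

Section complex_continuous.
Context (T : topologicalType) (R : realType).
Implicit Types f g : T -> R[i].

Definition ccontinuous f :=
  continuous (fun x => complex.Re (f x)) /\ continuous (fun x => complex.Im (f x)).

Lemma ccontinuous_cst c : ccontinuous (fun=> c).
Proof. by split => x; exact: cst_continuous. Qed.

Lemma ccontinuousD f g : ccontinuous f -> ccontinuous g ->
  ccontinuous (fun x => f x + g x).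
Proof.
move=> [fr fi] [gr gi]; split => x.
  rewrite (_ : (fun y => _) = (fun y => complex.Re (f y) + complex.Re (g y))).
    by apply: (@continuousD R R^o T); [exact: fr|exact: gr].
  by apply/funext => y; case: (f y) (g y) => ? ? [].
rewrite (_ : (fun y => _) = (fun y => complex.Im (f y) + complex.Im (g y))).
  by apply: (@continuousD R R^o T); [exact: fi|exact: gi].
by apply/funext => y; case: (f y) (g y) => ? ? [].
Qed.

Lemma ccontinuousM f g : ccontinuous f -> ccontinuous g ->
  ccontinuous (fun x => f x * g x).
Proof.
move=> [fr fi] [gr gi]; split => x.
  rewrite (_ : (fun y => _) = (fun y => complex.Re (f y) * complex.Re (g y) -
      complex.Im (f y) * complex.Im (g y))).
    apply: (@continuousB R R^o T (fun y => complex.Re (f y) * complex.Re (g y))).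
      by apply: (@continuousM R T); [exact: fr|exact: gr].
    by apply: (@continuousM R T); [exact: fi|exact: gi].
  by apply/funext => y; case: (f y) (g y) => ? ? [].
rewrite (_ : (fun y => _) = (fun y => complex.Re (f y) * complex.Im (g y) +
    complex.Im (f y) * complex.Re (g y))).
  apply: (@continuousD R R^o T (fun y => complex.Re (f y) * complex.Im (g y))).
    by apply: (@continuousM R T); [exact: fr|exact: gi].
  by apply: (@continuousM R T); [exact: fi|exact: gr].
by apply/funext => y; case: (f y) (g y) => ? ? [].
Qed.

Lemma ccontinuous_expi (h : T -> R) : continuous h -> ccontinuous (fun x => expi (h x)).
Proof.
move=> ch; split => x /=; apply: continuous_comp; try exact: ch.
  exact: continuous_cos.
exact: continuous_sin.
Qed.

Lemma ccontinuous_trig (K : Type) (phi : K -> T -> R) p :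
  (forall k, continuous (phi k)) -> trig phi p -> ccontinuous p.
Proof.
move=> cphi [s ->]; elim: s => [|c s IH].
  by under eq_fun do rewrite big_nil; exact: ccontinuous_cst.
under eq_fun do rewrite big_cons; apply: ccontinuousD => //.
by apply: ccontinuousM; [exact: ccontinuous_cst|exact: ccontinuous_expi].
Qed.

Lemma continuous_clipr (B : R) (h : T -> R) : continuous h ->
  continuous (fun x => clipr B (h x)).
Proof.
move=> ch x; apply: (@continuous_max R T (cst (- B)) (fun x => Num.min B (h x))).
  exact: cst_continuous.
apply: (@continuous_min R T (cst B) h); first exact: cst_continuous.
exact: ch.
Qed.

Lemma ccontinuous_clip (B : R) f : ccontinuous f -> ccontinuous (fun x => clip B (f x)).
Proof. by move=> [fr fi]; split; exact: continuous_clipr. Qed.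

Lemma continuous_sumr (I : Type) (s : seq I) (h : I -> T -> R) :
  (forall i, continuous (h i)) -> continuous (fun x => \sum_(i <- s) h i x).
Proof.
move=> ch; elim: s => [|i s IH] x.
  by under eq_fun do rewrite big_nil; exact: cst_continuous.
under eq_fun do rewrite big_cons.
by apply: (@continuousD R R^o T (h i)); [exact: ch|exact: IH].
Qed.

End complex_continuous.

Section periodicity.
Context (R : realType).

Lemma expi_2pi : expi (2 * pi) = 1 :> R[i].
Proof. by rewrite /expi mulr_natl cos2pi sin2pi. Qed.

Lemma expiN (a : R) : expi (- a) * expi a = 1.
Proof. by rewrite -expiD addNr expi0. Qed.

Lemma expi_int (m : int) : expi (m%:~R * (2 * pi)) = 1 :> R[i].
Proof.
have nat_case (n : nat) : expi (n%:R * (2 * pi)) = 1 :> R[i].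
  elim: n => [|n IH]; first by rewrite mul0r expi0.
  by rewrite -natr1 mulrDl mul1r expiD IH expi_2pi mulr1.
case: m => n; first exact: nat_case.
rewrite NegzE mulrNz mulNr -[LHS]mulr1 -(nat_case n.+1) expiN.
by rewrite nat_case.
Qed.

Lemma dotp_pt n (k : 'I_n -> int) (v : 'rV[R]_n) :
  dotp k (pt v) = \sum_(j < n) (k j)%:~R * v 0 j.
Proof. by apply: eq_bigr => j _; rewrite tnth_mktuple. Qed.

Lemma dotp_dir n (k : 'I_n -> int) (v : 'rV[R]_n) (s : R) j :
  dotp k (pt (v + s *: dir R j)) = dotp k (pt v) + (k j)%:~R * s.
Proof.
rewrite !dotp_pt; under eq_bigr do rewrite !mxE mulrDr.
rewrite big_split/=; congr (_ + _); rewrite (bigD1 j)//= eqxx mulr1 big1 ?addr0//.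
by move=> i /negbTE ij; rewrite ij mulr0 mulr0.
Qed.

Lemma expi_dotp_periodic n (k : 'I_n -> int) : torus_periodic (fun x => expi (@dotp R n k x)).
Proof. by move=> v j; rewrite dotp_dir expiD expi_int mulr1. Qed.

Lemma continuous_dotp n (k : 'I_n -> int) : continuous (fun v : 'rV[R]_n => dotp k (pt v)).
Proof.
rewrite (_ : (fun v => _) = fun v : 'rV[R]_n => \sum_(j < n) (k j)%:~R * v 0 j); last first.
  by apply/funext => v; rewrite dotp_pt.
apply: continuous_sumr => j v.
apply: (@continuousM R _ (cst (k j)%:~R) (fun v : 'rV[R]_n => v 0 j)).
  exact: cst_continuous.
exact: coord_continuous.
Qed.

Lemma continuous_circle_phase m : continuous (fun t : R => circle_phase m t).
Proof. by move=> t; apply: cvgM; [exact: cvg_cst|exact: cvg_id]. Qed.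

Lemma trig_periodic n p : trig (@dotp R n) p -> torus_periodic p.
Proof.
by move=> [s ->] v j; apply: eq_bigr => c _; rewrite (expi_dotp_periodic c.2 v j).
Qed.

Lemma continuous_spacetime_phase d k :
  continuous (fun z : R * 'rV[R]_d => @spacetime_phase R d k (z.1, pt z.2)).
Proof.
move=> z; apply: (@continuousD R R^o _ (fun z => circle_phase k.1 z.1)
  (fun z : R * 'rV[R]_d => dotp k.2 (pt z.2))).
  apply: (@continuous_comp _ _ _ (fst : R * 'rV[R]_d -> R) (fun t : R => circle_phase k.1 t)).
    exact: cvg_fst.
  exact: continuous_circle_phase.
apply: (@continuous_comp _ _ _ (snd : R * 'rV[R]_d -> _) (fun v => dotp k.2 (pt v))).
  exact: cvg_snd.
exact: continuous_dotp.
Qed.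

Lemma clip_trig_C0 d (B : R) p : trig (@spacetime_phase R d) p ->
  C0 (fun z => clip B (p z)).
Proof.
move=> tp; have tp' : trig (fun k z => spacetime_phase k (z.1, pt z.2))
    (fun z : R * 'rV[R]_d => p (z.1, pt z.2)).
  by have [s ->] := tp; exists s.
have [cr ci] := ccontinuous_clip B (ccontinuous_trig (@continuous_spacetime_phase d) tp').
split => //.
- have [s ->] := tp => t x; congr clip; apply: eq_bigr => c _; congr (_ * _).
  rewrite /spacetime_phase/= /circle_phase.
  rewrite (_ : c.2.1%:~R * (t + 2 * pi) + dotp c.2.2 x =
    c.2.1%:~R * (2 * pi) + (c.2.1%:~R * t + dotp c.2.2 x)); last by ring.
  by rewrite [LHS]expiD expi_int mul1r.
- move=> t v j; congr clip; have [s ->] := tp; apply: eq_bigr => c _; congr (_ * _).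
  by rewrite /spacetime_phase/= dotp_dir addrA [LHS]expiD expi_int mulr1.
Qed.

Lemma clip_trig_time_independent_C0 d (B : R) p : trig (@dotp R d) p ->
  @C0 R d (fun z => clip B (p z.2)).
Proof.
move=> [s ->]; apply: (clip_trig_C0 B (p := fun z => \sum_(c <- s) c.1 * expi (dotp c.2 z.2))).
exists [seq (c.1, (0, c.2)) | c <- s].
apply/funext => z; rewrite big_map; apply: eq_bigr => c _ /=.
by rewrite /spacetime_phase /circle_phase mul0r add0r.
Qed.

End periodicity.

Lemma ae_snd d1 d2 (X1 : measurableType d1) (X2 : measurableType d2) (R : realType)
  (m1 : {finite_measure set X1 -> \bar R}) (m2 : {finite_measure set X2 -> \bar R})
  (Q : X2 -> Prop) : {ae m2, forall x, Q x} ->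
  {ae finite_product m1 m2, forall z, Q z.2}.
Proof.
move=> [N [mN N0 QN]]; exists (setT `*` N); split; first exact: measurableX.
  transitivity (m1 setT * m2 N)%E; first exact: product_measure1E.
  by rewrite [X in (_ * X)%E](N0 : m2 N = 0%E) mule0.
by move=> z nQ; split => //=; apply: QN.
Qed.

(** * Fourier coefficients *)

Section circle_integral.
Context (R : realType).
Local Notation circle := (circle_measure R).

(** The closed interval is the form required by the fundamental theorem of calculus. *)
Lemma integral_circleE (g : R -> \bar R) : measurable_fun setT g ->
  (\int[circle]_t g t = \int[lebesgue_measure]_(t in `[0%R, (2 * pi)%R]) g t)%E.
Proof.
move=> mg; pose I : set (measurableTypeR R) := `[0, 2 * pi[%classic.
have mI : measurable I by exact: measurable_itv.
transitivity (\int[circle]_(t in I) g t)%E.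
  rewrite [RHS]integral_mkcond; apply: ae_eq_integral => //.
    by apply/(measurable_restrictT _ mI); exact: measurable_funTS.
  apply: (@circle_ae R 0) => t /andP[t0 t2] _ _.
  by rewrite patchE mem_set// /I/= in_itv/= t2 ltW.
transitivity (\int[lebesgue_measure]_(t in I) g t)%E.
  apply: (@eq_measure_integral _ (measurableTypeR R) _ I lebesgue_measure circle) => A mA AI.
  by change (lebesgue_measure (A `&` I) = lebesgue_measure A); rewrite setIidl.
by apply: integral_itv_bndo_bndc; exact: measurable_funTS.
Qed.

Lemma circle_FTC (F f : R -> R) : (forall t, is_derive t (1 : R) F (f t)) ->
  continuous f -> \int[circle]_t f t = F (2 * pi) - F 0.
Proof.
move=> Ff cf.
have mf : measurable_fun setT f by exact: continuous_measurable_fun.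
have cF : continuous F by move=> t; apply/differentiable_continuous/derivable1_diffP.
rewrite /Rintegral integral_circleE; last exact/measurable_EFinP.
rewrite (@continuous_FTC2 _ f F)//.
- by rewrite mulr_gt0 ?pi_gt0.
- exact: continuous_subspaceT.
- split.
  + by move=> t _; have [] := Ff t.
  + by apply: cvg_at_right_filter; exact: cF.
  + by apply: cvg_at_left_filter; exact: cF.
- by move=> t _; rewrite derive1E; have [_ ->] := Ff t.
Qed.

End circle_integral.

Section complex_integral.
Context (d : measure_display) (X : measurableType d) (R : realType).
Variable mu : {finite_measure set X -> \bar R}.
Implicit Types f g : X -> R[i].

Definition cintegrable f :=
  mu.-integrable setT (EFin \o (fun x => complex.Re (f x))) /\
  mu.-integrable setT (EFin \o (fun x => complex.Im (f x))).

Lemma cLfun2_cintegrable f : cLfun mu 2%:E f -> cintegrable f.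
Proof.
move=> fL; have [[mr mi] _] := fL; have fi := cLfun2_integrable fL.
have i1 : mu.-integrable setT (fun x => (1 + sqmod f x)%:E).
  rewrite (_ : (fun x => _) = (cst 1%:E \+ (EFin \o sqmod f))%E)//.
  by apply: integrableD => //; exact: finite_measure_integrable_cst.
have bound (r : X -> R) : measurable_fun setT r -> (forall x, r x ^+ 2 <= sqmod f x) ->
    mu.-integrable setT (EFin \o r).
  move=> mr' rf; apply: le_integrable i1 => //; first exact/measurable_EFinP.
  move=> x _ /=; rewrite lee_fin [leRHS]ger0_norm ?addr_ge0 ?sqmod_ge0//.
  have := rf x; rewrite -(real_normK (num_real (r x))).
  by have := normr_ge0 (r x); nra.
by split; apply: bound => // x; rewrite sqmodE /sqn ?lerDl ?lerDr sqr_ge0.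
Qed.

Lemma cintegralD f g : cintegrable f -> cintegrable g ->
  cintegral mu (fun x => f x + g x) = cintegral mu f + cintegral mu g.
Proof.
move=> [fr fi] [gr gi]; rewrite /cintegral.
apply/eqP; rewrite eq_complex/=; apply/andP; split; apply/eqP.
  by rewrite -RintegralD//; apply: eq_Rintegral => x _; case: (f x) (g x) => ? ? [].
by rewrite -RintegralD//; apply: eq_Rintegral => x _; case: (f x) (g x) => ? ? [].
Qed.

Lemma cintegralZ c f : cintegrable f ->
  cintegral mu (fun x => c * f x) = c * cintegral mu f.
Proof.
case: c => a b [fr fi]; rewrite /cintegral.
have iZ (s : R) (r : X -> R) : mu.-integrable setT (EFin \o r) ->
    mu.-integrable setT (EFin \o (fun x => s * r x)).
  by move=> ir; rewrite (_ : _ \o _ = (fun x => s%:E * (EFin \o r) x)%E)//; exact: integrableZl.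
apply/eqP; rewrite eq_complex/=; apply/andP; split; apply/eqP.
  rewrite -!RintegralZl// -RintegralB//; [|exact: iZ|exact: iZ].
  by apply: eq_Rintegral => x _; case: (f x).
rewrite -!RintegralZl// -RintegralD//; [|exact: iZ|exact: iZ].
by apply: eq_Rintegral => x _; case: (f x).
Qed.

Lemma cintegrableZ c f : cintegrable f -> cintegrable (fun x => c * f x).
Proof.
case: c => a b [fr fi].
have iZ (s : R) (r : X -> R) : mu.-integrable setT (EFin \o r) ->
    mu.-integrable setT (EFin \o (fun x => s * r x)).
  by move=> ir; rewrite (_ : _ \o _ = (fun x => s%:E * (EFin \o r) x)%E)//; exact: integrableZl.
split.
  rewrite (_ : _ \o _ = ((EFin \o (fun x => a * complex.Re (f x))%R) \-
      (EFin \o (fun x => b * complex.Im (f x))%R))%E).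
    by apply: integrableB => //; exact: iZ.
  by apply/funext => x /=; case: (f x).
rewrite (_ : _ \o _ = ((EFin \o (fun x => a * complex.Im (f x))%R) \+
    (EFin \o (fun x => b * complex.Re (f x))%R))%E).
  by apply: integrableD => //; exact: iZ.
by apply/funext => x /=; case: (f x).
Qed.

Lemma cintegrableD f g : cintegrable f -> cintegrable g ->
  cintegrable (fun x => f x + g x).
Proof.
move=> [fr fi] [gr gi]; split.
  rewrite (_ : _ \o _ = ((EFin \o (fun x => complex.Re (f x))) \+
      (EFin \o (fun x => complex.Re (g x))))%E); first exact: integrableD.
  by apply/funext => x /=; case: (f x) (g x) => ? ? [].
rewrite (_ : _ \o _ = ((EFin \o (fun x => complex.Im (f x))) \+
    (EFin \o (fun x => complex.Im (g x))))%E); first exact: integrableD.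
by apply/funext => x /=; case: (f x) (g x) => ? ? [].
Qed.

Lemma cintegral0 : cintegral mu (fun=> 0) = 0.
Proof. by rewrite /cintegral /Rintegral/= integral0. Qed.

Lemma cintegrable0 : cintegrable (fun=> 0).
Proof. by split; exact: integrable0. Qed.

Lemma cintegral_sum (I : Type) (s : seq I) (h : I -> X -> R[i]) :
  (forall i, cintegrable (h i)) ->
  cintegrable (fun x => \sum_(i <- s) h i x) /\
  cintegral mu (fun x => \sum_(i <- s) h i x) = \sum_(i <- s) cintegral mu (h i).
Proof.
move=> hi; elim: s => [|i s [IH1 IH2]].
  under eq_fun do rewrite big_nil; rewrite big_nil.
  by split; [exact: cintegrable0|exact: cintegral0].
under eq_fun do rewrite big_cons.
rewrite big_cons -IH2; split; first exact: cintegrableD.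
exact: cintegralD.
Qed.

Lemma eq_cintegral f g : {ae mu, forall x, f x = g x} -> cmeasurable f -> cmeasurable g ->
  cintegral mu f = cintegral mu g.
Proof.
move=> fg [fr fi] [gr gi]; rewrite /cintegral /Rintegral.
congr (fine _ +i* fine _); apply: ae_eq_integral => //; try exact/measurable_EFinP;
  by apply: filterS fg => x -> _.
Qed.

Lemma cLfun2M_bounded f e : cLfun mu 2%:E f -> cmeasurable e ->
  (forall x, sqn (e x) <= 1) -> cLfun mu 2%:E (fun x => f x * e x).
Proof.
move=> fL me e1; have [mf _] := fL; apply: le_cLfun2 fL _; first exact: cmeasurableM.
by move=> x; rewrite !sqmodE sqnM ler_piMr ?sqn_ge0.
Qed.

End complex_integral.

Section complex_fubini.
Context d1 d2 (X1 : measurableType d1) (X2 : measurableType d2) (R : realType).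
Variables (m1 : {finite_measure set X1 -> \bar R}) (m2 : {finite_measure set X2 -> \bar R}).
Local Notation m := (finite_product m1 m2).

(** The inner real integral is the true one only where the section is integrable, which holds almost
    everywhere. *)
Lemma Rintegral_fubini (r : X1 * X2 -> R) : m.-integrable setT (EFin \o r) ->
  \int[m]_z r z = \int[m1]_x \int[m2]_y r (x, y).
Proof.
move=> ir.
have ir' : (m1 \x m2)%E.-integrable setT (EFin \o r) by exact: ir.
rewrite /Rintegral; congr fine.
transitivity (\int[m1]_x fubini_F m2 (EFin \o r) x)%E.
  by rewrite (integral12_prod_meas1 ir').
have mF := measurable_fubini_F ir'.
apply: ae_eq_integral => //.
  by apply/measurable_EFinP; apply: measurableT_comp mF => //; exact: fine_measurable.
apply: filterS (ae_integrable1 ir') => x ix _.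
by rewrite /fubini_F fineK//; exact: integrable_fin_num.
Qed.

Lemma cintegral_fubini f : cintegrable m f ->
  cintegral m f = cintegral m1 (fun x => cintegral m2 (fun y => f (x, y))).
Proof. by move=> [fr fi]; rewrite /cintegral/= !Rintegral_fubini. Qed.

Lemma cLfun2_prod f1 f2 : cLfun m1 2%:E f1 -> cLfun m2 2%:E f2 ->
  cLfun m 2%:E (fun z => f1 z.1 * f2 z.2).
Proof.
move=> /cLfun2P[mf1 f1l] /cLfun2P[mf2 f2l]; apply/cLfun2P; split.
  by apply: cmeasurableM; [exact: cmeasurable_comp mf1 measurable_fst|
    exact: cmeasurable_comp mf2 measurable_snd].
rewrite int_sqmod_prod//; apply: lte_mul_pinfty => //; first exact: int_sqmod_ge0.
by rewrite ge0_fin_numE// int_sqmod_ge0.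
Qed.

Lemma cintegral_prod f1 f2 : cLfun m1 2%:E f1 -> cLfun m2 2%:E f2 ->
  cintegral m (fun z => f1 z.1 * f2 z.2) = cintegral m1 f1 * cintegral m2 f2.
Proof.
move=> f1L f2L.
have i1 := cLfun2_cintegrable f1L; have i2 := cLfun2_cintegrable f2L.
rewrite cintegral_fubini; last exact: cLfun2_cintegrable (cLfun2_prod f1L f2L).
rewrite mulrC -cintegralZ//; congr (cintegral m1 _); apply/funext => x.
by rewrite /= cintegralZ// mulrC.
Qed.

End complex_fubini.

Section characters.
Context (R : realType).
Local Notation circle := (circle_measure R).

Lemma is_derive_scale (c : R) (h : R -> R) (t dh : R) : is_derive t (1 : R) h dh ->
  is_derive t (1 : R) (fun t => c * h t) (c * dh).
Proof. exact: (@is_deriveZ _ _ R^o h c t 1 dh). Qed.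

Lemma is_derive_cos_phase (m : int) (t : R) :
  is_derive t (1 : R) (fun t : R => cos (circle_phase m t)) (- (m%:~R * sin (circle_phase m t))).
Proof.
have dp : is_derive t (1 : R) (fun t : R => circle_phase m t) (m%:~R * 1).
  exact: (@is_derive_scale m%:~R id t 1).
have := is_derive1_comp (is_derive_cos (circle_phase m t)) dp.
by move=> /is_derive_eq; apply; ring.
Qed.

Lemma is_derive_sin_phase (m : int) (t : R) :
  is_derive t (1 : R) (fun t : R => sin (circle_phase m t)) (m%:~R * cos (circle_phase m t)).
Proof.
have dp : is_derive t (1 : R) (fun t : R => circle_phase m t) (m%:~R * 1).
  exact: (@is_derive_scale m%:~R id t 1).
have := is_derive1_comp (is_derive_sin (circle_phase m t)) dp.
by move=> /is_derive_eq; apply; ring.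
Qed.

(** The antiderivatives sin(mt)/m and -cos(mt)/m are 2 pi-periodic because m is an integer. *)
Lemma cintegral_circle_character m : m != 0 ->
  cintegral circle (fun t => expi (circle_phase m t)) = 0.
Proof.
move=> m0; have m0' : m%:~R != 0 :> R by rewrite intr_eq0.
have e2 : expi (circle_phase m (2 * pi)) = 1 :> R[i] by exact: expi_int.
have c2 : cos (circle_phase m (2 * pi)) = 1 :> R by have := congr1 (@complex.Re R) e2.
have s2 : sin (circle_phase m (2 * pi)) = 0 :> R by have := congr1 (@complex.Im R) e2.
have cphase := @continuous_circle_phase R m.
have ds t : is_derive t (1 : R) (fun t => m%:~R^-1 * sin (circle_phase m t))
    (cos (circle_phase m t)).
  have := is_derive_scale m%:~R^-1 (is_derive_sin_phase m t).
  by rewrite mulrA mulVf// mul1r.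
have dc t : is_derive t (1 : R) (fun t => - m%:~R^-1 * cos (circle_phase m t))
    (sin (circle_phase m t)).
  have := is_derive_scale (- m%:~R^-1) (is_derive_cos_phase m t).
  by rewrite mulrNN mulrA mulVf// mul1r.
have cs : continuous (fun t : R => sin (circle_phase m t)).
  by move=> t; apply: continuous_comp; [exact: cphase|exact: continuous_sin].
have cc : continuous (fun t : R => cos (circle_phase m t)).
  by move=> t; apply: continuous_comp; [exact: cphase|exact: continuous_cos].
rewrite /cintegral /expi/= (circle_FTC ds cc) (circle_FTC dc cs) s2 c2.
by rewrite /circle_phase !mulr0 sin0 cos0 mulr0 !subrr.
Qed.

Lemma cLfun2_unimodular d (X : measurableType d) (mu : {finite_measure set X -> \bar R})
  (h : X -> R) : measurable_fun setT h -> cLfun mu 2%:E (fun x => expi (h x)).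
Proof.
move=> mh; apply: (@le_cLfun2 _ _ _ mu _ (fun=> 1)).
- exact: cmeasurable_expi.
- exact: cLfun2_cst.
- by move=> x; rewrite !sqmodE sqn_expi sqn1.
Qed.

Lemma cintegral_spacetime_character n k :
  cintegral (spacetime_fin R n) (fun z => expi (spacetime_phase k z)) =
  cintegral circle (fun t => expi (circle_phase k.1 t)) *
  cintegral (torus_measure R n) (fun x => expi (dotp k.2 x)).
Proof.
rewrite -cintegral_prod; last 2 first.
- exact: cLfun2_unimodular (measurable_circle_phase _).
- exact: cLfun2_unimodular (measurable_dotp _).
by congr (cintegral _ _); apply/funext => z; rewrite -expiD.
Qed.

Lemma Rintegral_torusS n (r : torus R n.+1 -> R) :
  measurable_fun setT r -> (spacetime_fin R n).-integrable setT (EFin \o (r \o @cons_pair R n)) ->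
  \int[torus_measure R n.+1]_x r x = \int[spacetime_fin R n]_z r (cons_pair z).
Proof.
move=> mr ir; rewrite /Rintegral; congr fine.
have := @integral_pushforward _ _ _ _ _ _ (@measurable_cons_pair R n)
  (spacetime_fin R n) setT (EFin \o r); rewrite preimage_setT; apply => //.
exact/measurable_EFinP.
Qed.

Lemma cintegral_torusS n f : cmeasurable f ->
  cintegrable (spacetime_fin R n) (f \o @cons_pair R n) ->
  cintegral (torus_measure R n.+1) f = cintegral (spacetime_fin R n) (f \o @cons_pair R n).
Proof. by move=> [mr mi] [ir ii]; rewrite /cintegral !Rintegral_torusS. Qed.

Lemma cintegral_torus_character n (k : 'I_n -> int) j : k j != 0 ->
  cintegral (torus_measure R n) (fun x => expi (dotp k x)) = 0.
Proof.
elim: n k j => [|n IH] k j kj; first by case: j kj.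
have e : (fun x => expi (dotp k x)) \o @cons_pair R n =
    fun z => expi (spacetime_phase (k ord0, k \o lift ord0) z).
  by apply/funext => -[t x] /=; rewrite dotp_cons.
rewrite cintegral_torusS ?e; last 2 first.
- by apply: cmeasurable_expi; exact: measurable_dotp.
- apply: cLfun2_cintegrable; apply: cLfun2_unimodular; exact: measurable_spacetime_phase.
rewrite cintegral_spacetime_character/=.
have [k0|k0] := eqVneq (k ord0) 0; last by rewrite cintegral_circle_character// mul0r.
move: kj; case: (unliftP ord0 j) => [i ->|->]; last by rewrite k0 eqxx.
by move=> ki; rewrite (IH (k \o lift ord0) i)// mulr0.
Qed.

End characters.

(** * Free waves and their modes *)

Section pythagoras.
Context (d : measure_display) (X : measurableType d) (R : realType).
Variable mu : {finite_measure set X -> \bar R}.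
Implicit Types f g : X -> R[i].

Lemma conjc_expi (a : R) : conjc (expi a) = expi (- a).
Proof. by rewrite /expi/= cosN sinN. Qed.

Lemma sqnD_conj (z w : R[i]) : sqn (z + w) = sqn z + sqn w + 2 * complex.Re (z * conjc w).
Proof. by case: z w => [a b] [a' b']; rewrite /sqn/=; ring. Qed.

Lemma cmeasurable_conjc f : cmeasurable f -> cmeasurable (fun x => conjc (f x)).
Proof.
move=> [mr mi]; split.
  by rewrite (_ : (fun x => _) = fun x => complex.Re (f x))//; apply/funext => x; case: (f x).
rewrite (_ : (fun x => _) = fun x => - complex.Im (f x)); first exact: measurable_funN.
by apply/funext => x; case: (f x).
Qed.

Lemma cLfun2_mul_conjc f g : cLfun mu 2%:E f -> cLfun mu 2%:E g ->
  cintegrable mu (fun x => f x * conjc (g x)).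
Proof.
move=> fL gL; have [mf _] := fL; have [mg _] := gL.
have mfg : cmeasurable (fun x => f x * conjc (g x)).
  by apply: cmeasurableM => //; exact: cmeasurable_conjc.
have i1 : mu.-integrable setT (fun x => (sqmod f x + sqmod g x)%:E).
  rewrite (_ : (fun x => _) = ((EFin \o sqmod f) \+ (EFin \o sqmod g))%E)//.
  by apply: integrableD => //; exact: cLfun2_integrable.
have bound (r : X -> R) : measurable_fun setT r ->
    (forall x, `|r x| <= sqmod f x + sqmod g x) -> mu.-integrable setT (EFin \o r).
  move=> mr rf; apply: le_integrable i1 => //; first exact/measurable_EFinP.
  by move=> x _ /=; rewrite lee_fin (le_trans (rf x))// ler_norm.
have [mr mi] := mfg; split; apply: bound => // x; rewrite !sqmodE.
  case: (f x) (g x) => [a b] [a' b']; rewrite /sqn/= ler_norml.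
  have := sqr_ge0 (a - a'); have := sqr_ge0 (a + a').
  have := sqr_ge0 (b - b'); have := sqr_ge0 (b + b').
  by move=> ? ? ? ?; apply/andP; split; nra.
case: (f x) (g x) => [a b] [a' b']; rewrite /sqn/= ler_norml.
have := sqr_ge0 (a - b'); have := sqr_ge0 (a + b').
have := sqr_ge0 (b - a'); have := sqr_ge0 (b + a').
by move=> ? ? ? ?; apply/andP; split; nra.
Qed.

Lemma int_sqmod_fin f : cLfun mu 2%:E f ->
  (\int[mu]_x (sqmod f x)%:E)%E = (\int[mu]_x sqmod f x)%:E.
Proof.
by move=> fL; rewrite /Rintegral fineK//; apply: integrable_fin_num => //; exact: cLfun2_integrable.
Qed.

(** By homogeneity. The rescaled function must belong to [S] only when [f] has non-zero norm:
    eigenfunctions are not identically zero, whereas a mode of a wave may be. *)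
Lemma int_sqmod_le_of_normalized f D (eps : R) (S : set (X -> R[i])) :
  cLfun mu 2%:E f -> measurable D -> 0 < eps ->
  (forall g, normalized mu S g -> (\int[mu]_(x in D) (sqmod g x)%:E < eps%:E)%E) ->
  (forall a : R, 0 < a -> \int[mu]_x sqmod f x != 0 -> S (fun x => a%:C * f x)) ->
  (\int[mu]_(x in D) (sqmod f x)%:E <= eps%:E * \int[mu]_x (sqmod f x)%:E)%E.
Proof.
move=> fL mD eps0 bound Sf; have [mf _] := fL.
have sub : (\int[mu]_(x in D) (sqmod f x)%:E <= \int[mu]_x (sqmod f x)%:E)%E.
  apply: ge0_subset_integral => //; first exact: measurable_sqmodE.
  by move=> x _; rewrite lee_fin sqmod_ge0.
have IE := int_sqmod_fin fL; set r := \int[mu]_x sqmod f x in IE Sf.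
have r0 : 0 <= r by apply: Rintegral_ge0 => x _; exact: sqmod_ge0.
rewrite IE in sub *; have [r00|rn0] := eqVneq r 0.
  by move: sub; rewrite r00 mule0.
have r_gt0 : 0 < r by rewrite lt_def rn0.
pose a : R := (Num.sqrt r)^-1.
have fint E : measurable E -> (\int[mu]_(x in E) (sqmod (fun x => a%:C * f x) x)%:E =
    (r^-1)%:E * \int[mu]_(x in E) (sqmod f x)%:E)%E.
  move=> mE; rewrite -ge0_integralZl_EFin//.
  - by apply: eq_integral => x _; rewrite -EFinM !sqmodE sqnM sqn_real /a exprVn sqr_sqrtr.
  - by move=> x _; rewrite lee_fin sqmod_ge0.
  - exact: measurable_sqmodE.
  - by rewrite invr_ge0.
have : normalized mu S (fun x => a%:C * f x).
  split; first by apply: Sf; rewrite ?invr_gt0 ?sqrtr_gt0.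
  by apply/cLnorm2_eq1; rewrite fint// IE -EFinM mulVf.
move=> /bound; rewrite fint//.
move: sub (int_sqmod_ge0 mu f D); case: (\int[mu]_(x in D) _)%E => // b _ _.
by rewrite -!EFinM lte_fin lee_fin ltr_pdivrMl// mulrC => /ltW.
Qed.

Lemma pythagorasD f g : cLfun mu 2%:E f -> cLfun mu 2%:E g ->
  cintegral mu (fun x => f x * conjc (g x)) = 0 ->
  (\int[mu]_x (sqmod (fun x => (f x + g x)%R) x)%:E =
    \int[mu]_x (sqmod f x)%:E + \int[mu]_x (sqmod g x)%:E)%E.
Proof.
move=> fL gL fg0.
have fgL : cLfun mu 2%:E (fun x => f x + g x).
  by have := cLfun2_lin 1 fL gL; under eq_fun do rewrite mul1r.
have [ir _] := cLfun2_mul_conjc fL gL.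
have re0 : \int[mu]_x complex.Re (f x * conjc (g x)) = 0.
  by have := congr1 (@complex.Re R) fg0.
rewrite !int_sqmod_fin// -EFinD; congr EFin.
have fi := cLfun2_integrable fL; have gi := cLfun2_integrable gL.
have ir2 : mu.-integrable setT (EFin \o (fun x => 2 * complex.Re (f x * conjc (g x)))).
  by rewrite (_ : _ \o _ = (fun x =>
    2%:E * (EFin \o (fun x => complex.Re (f x * conjc (g x))%R)) x)%E)//; exact: integrableZl.
rewrite -RintegralD// -[RHS]addr0 -(mulr0 2) -re0 -RintegralZl// -RintegralD//.
  by apply: eq_Rintegral => x _; rewrite !sqmodE sqnD_conj.
rewrite (_ : _ \o _ = ((EFin \o sqmod f) \+ (EFin \o sqmod g))%E)//.
exact: integrableD.
Qed.

End pythagoras.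

Section orthogonality.
Context (R : realType) (n : nat).
Local Notation circle := (circle_measure R).
Local Notation mu := (spacetime_fin R n).
Local Notation phase := (@spacetime_phase R n).

(** An integer, to be compared with the time frequency. *)
Definition isqnorm (k : 'I_n -> int) : int := \sum_(j < n) (k j) ^+ 2.

Lemma isqnormE k : (isqnorm k)%:~R = @sqnorm R n k.
Proof. by rewrite /isqnorm /sqnorm rmorph_sum/=; apply: eq_bigr => j _; rewrite rmorphXn. Qed.

(* The frequencies (in t and x) of free waves. *)
Definition paraboloid (k : int * ('I_n -> int)) := k.1 == - isqnorm k.2.

Lemma cmeasurable_fubini d1 d2 (X1 : measurableType d1) (X2 : measurableType d2)
    (m1 : {finite_measure set X1 -> \bar R}) (m2 : {finite_measure set X2 -> \bar R}) f :
  cintegrable (finite_product m1 m2) f ->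
  cmeasurable (fun x => cintegral m2 (fun y => f (x, y))).
Proof.
move=> [fr fi]; split.
  have ir : (m1 \x m2)%E.-integrable setT (EFin \o (fun z => complex.Re (f z))) by exact: fr.
  exact: measurableT_comp (@fine_measurable R setT measurableT) (measurable_fubini_F ir).
have ii : (m1 \x m2)%E.-integrable setT (EFin \o (fun z => complex.Im (f z))) by exact: fi.
exact: measurableT_comp (@fine_measurable R setT measurableT) (measurable_fubini_F ii).
Qed.

Lemma cLfun2_character k : cLfun mu 2%:E (fun z : spacetime R n => expi (phase k z)).
Proof. by apply: cLfun2_unimodular; exact: measurable_spacetime_phase. Qed.

Lemma free_wave_cLfun2 u : free_waves u -> cLfun mu 2%:E u.
Proof. by move=> [uL _]. Qed.

(** For almost every t the integral in x is a constant times exp(-i t (k.1 + |k.2|^2)), a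
    non-trivial character in t off the paraboloid. *)
Lemma free_wave_orthogonal u k : free_waves u -> ~~ paraboloid k ->
  cintegral mu (fun z : spacetime R n => u z * conjc (expi (phase k z))) = 0.
Proof.
move=> fu kpar; have uL := free_wave_cLfun2 fu; have [_ [u0 u0P]] := fu.
have eL := cLfun2_character k.
have ci := cLfun2_mul_conjc uL eL.
rewrite cintegral_fubini//.
pose C := cintegral (torus_measure R n) (fun x => u0 x * expi (- dotp k.2 x)).
pose q := - (k.1 + isqnorm k.2).
transitivity (cintegral circle (fun t => C * expi (circle_phase q t))).
  apply: eq_cintegral; last 2 first.
  - exact: cmeasurable_fubini ci.
  - apply: cmeasurableM; first exact: cmeasurable_cst.
    by apply: cmeasurable_expi; exact: measurable_circle_phase.
  apply: (@filterS _ _ (ae_filter_ringOfSetsType circle) _ _ _ u0P) => t [u0L uL_t /(_ k.2)].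
  rewrite /fourier_coef mulrCA => /mulfI coefE.
  have pin : ((2 * pi) ^- n)%:C != 0 :> R[i].
    by rewrite eq_complex/= eqxx andbT invr_neq0// expf_neq0// mulf_neq0// gt_eqF// pi_gt0.
  rewrite (_ : (fun y => _) = fun x => expi (- circle_phase k.1 t) *
      (u (t, x) * expi (- dotp k.2 x))); last first.
    by apply/funext => x; rewrite conjc_expi /spacetime_phase/= opprD expiD; ring.
  rewrite cintegralZ.
    rewrite (coefE pin) mulrA -expiD -/C mulrC; congr (_ * expi _).
    rewrite /circle_phase /q -isqnormE rmorphN rmorphD/=; ring.
  apply: cLfun2_cintegrable; apply: cLfun2M_bounded uL_t _ _.
    by apply: cmeasurable_expi; apply: measurable_funN; exact: measurable_dotp.
  by move=> x; rewrite sqn_expi.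
rewrite cintegralZ; last first.
  by apply: cLfun2_cintegrable; apply: cLfun2_unimodular; exact: measurable_circle_phase.
rewrite cintegral_circle_character ?mulr0// /q oppr_eq0.
by rewrite addr_eq0.
Qed.

Lemma characters_orthogonal k l : paraboloid k -> ~~ paraboloid l ->
  cintegral mu (fun z : spacetime R n => expi (phase k z) * conjc (expi (phase l z))) = 0.
Proof.
move=> kp lp.
rewrite (_ : (fun z => _) = fun z => expi (phase (k.1 - l.1, fun j => k.2 j - l.2 j) z)).
  rewrite cintegral_spacetime_character/=.
  have [kl1|kl1] := eqVneq (k.1 - l.1) 0; last by rewrite cintegral_circle_character// mul0r.
  have [j kl2] : exists j, k.2 j - l.2 j != 0.
    apply: contrapT => nokl; move/negP : lp; apply.
    have kl1' : k.1 = l.1 by apply/eqP; rewrite -subr_eq0 kl1.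
    rewrite /paraboloid -kl1' (_ : l.2 = k.2)//; apply/funext => j; apply/esym/eqP.
    by rewrite -subr_eq0; apply/negPn/negP => klj; apply: nokl; exists j.
  by rewrite [X in _ * X](@cintegral_torus_character _ _ _ j)// mulr0.
apply/funext => z; rewrite conjc_expi -expiD; congr expi.
rewrite /spacetime_phase/= /circle_phase rmorphB/= mulrBl opprD addrACA; congr (_ + _).
rewrite /dotp -sumrN -big_split/=; apply: eq_bigr => j _.
by rewrite rmorphB/= mulrBl.
Qed.

(** Split a trigonometric approximant into p1 + p2, on and off the paraboloid. As u - p1 is
    orthogonal to p2, Pythagoras shows that dropping p2 does not increase the distance to u. *)
Lemma free_wave_paraboloid_approx u eta : free_waves u -> 0 < eta ->
  exists2 s : seq (R[i] * (int * ('I_n -> int))), all (fun c => paraboloid c.2) s &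
    (\int[mu]_z (sqmod (fun z => u z - \sum_(c <- s) c.1 * expi (phase c.2 z))%R z)%:E < eta%:E)%E.
Proof.
move=> fu eta0; have uL := free_wave_cLfun2 fu.
have [_ /(_ _ eta0)[_ [s ->] us]] := spacetime_density uL.
pose s1 := [seq c <- s | paraboloid c.2]; pose s2 := [seq c <- s | ~~ paraboloid c.2].
exists s1; first exact: filter_all.
apply: le_lt_trans us.
pose p1 z := \sum_(c <- s1) c.1 * expi (phase c.2 z).
pose p2 z := \sum_(c <- s2) c.1 * expi (phase c.2 z).
have trigL p : trig phase p -> cLfun mu 2%:E p.
  exact: (@trig_cLfun2 _ _ _ _ mu _ (@measurable_spacetime_phase R n)).
have p1L : cLfun mu 2%:E p1 by apply: trigL; exists s1.
have p2L : cLfun mu 2%:E p2 by apply: trigL; exists s2.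
have np2L : cLfun mu 2%:E (fun z => - p2 z).
  by have := cLfun2_lin (-1) p2L (cLfun2_cst mu 0); under eq_fun do rewrite mulN1r addr0.
have up1L := cLfun2B uL p1L.
have eL := cLfun2_character.
have ortho k : ~~ paraboloid k ->
    cintegral mu (fun z => (u z - p1 z) * conjc (expi (phase k z))) = 0.
  move=> kp.
  rewrite (_ : (fun z => _) = (fun z : spacetime R n => u z * conjc (expi (phase k z)) +
      (-1) * (\sum_(c <- s1) c.1 * (expi (phase c.2 z) * conjc (expi (phase k z)))))); last first.
    apply/funext => z; rewrite mulrBl mulN1r; congr (_ - _).
    by rewrite mulr_suml; apply: eq_bigr => c _; rewrite mulrA.
  have ich c : cintegrable mu (fun z => c.1 * (expi (phase c.2 z) * conjc (expi (phase k z)))).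
    by apply: cintegrableZ; exact: cLfun2_mul_conjc.
  have [isum sumE] := cintegral_sum s1 ich.
  rewrite cintegralD; [|exact: cLfun2_mul_conjc|exact: cintegrableZ].
  rewrite free_wave_orthogonal// add0r cintegralZ// sumE big_filter big1 ?mulr0// => c cp.
  by rewrite cintegralZ ?characters_orthogonal ?mulr0//; exact: cLfun2_mul_conjc.
have ortho2 : cintegral mu (fun z => (u z - p1 z) * conjc (- p2 z)) = 0.
  rewrite (_ : (fun z => _) = (fun z => \sum_(c <- s2) - conjc c.1 *
      ((u z - p1 z) * conjc (expi (phase c.2 z))))); last first.
    apply/funext => z.
    have -> : conjc (- p2 z) = \sum_(c <- s2) - (conjc c.1 * conjc (expi (phase c.2 z))).
      rewrite /p2 rmorphN rmorph_sum sumrN; congr (- _).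
      by apply: eq_bigr => c _; rewrite rmorphM.
    by rewrite mulr_sumr; apply: eq_bigr => c _; ring.
  have ich c : cintegrable mu (fun z => - conjc c.1 *
      ((u z - p1 z) * conjc (expi (phase c.2 z)))).
    by apply: cintegrableZ; exact: cLfun2_mul_conjc.
  have [_ ->] := cintegral_sum s2 ich.
  rewrite big_filter big1// => c cp.
  by rewrite cintegralZ ?ortho ?mulr0//; exact: cLfun2_mul_conjc.
have pyth := pythagorasD up1L np2L ortho2.
have le : (\int[mu]_z (sqmod (fun z => u z - p1 z)%R z)%:E <=
    \int[mu]_z (sqmod (fun z => u z - p1 z + - p2 z)%R z)%:E)%E.
  by rewrite pyth; apply: leeDl; exact: int_sqmod_ge0.
apply: (le_trans le); rewrite le_eqVlt; apply/orP; left; apply/eqP.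
apply: eq_integral => z _; rewrite !sqmodE; congr (sqn _)%:E.
rewrite -addrA -opprD; congr (_ - _).
by rewrite /p1 /p2 !big_filter [RHS](bigID (fun c => paraboloid c.2)).
Qed.

End orthogonality.

Section parseval.
Context (R : realType) (n : nat).
Local Notation circle := (circle_measure R).
Local Notation mu := (spacetime_fin R n).
Local Notation phase := (@spacetime_phase R n).

Lemma cLfun2_circle_character m : cLfun circle 2%:E (fun t => expi (circle_phase m t)).
Proof. by apply: cLfun2_unimodular; exact: measurable_circle_phase. Qed.

Lemma circle_parseval (s : seq int) (z : int -> R[i]) : uniq s ->
  (\int[circle]_t (sqmod (fun t => \sum_(m <- s) z m * expi (circle_phase m t))%R t)%:E =
   (\sum_(m <- s) sqn (z m))%:E * circle setT)%E.
Proof.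
elim: s => [_|m s IH /= /andP[ms us]].
  rewrite big_nil mul0e integral0_eq// => t _.
  by rewrite sqmodE big_nil sqn0.
have L2 (r : seq int) : cLfun circle 2%:E
    (fun t => \sum_(m <- r) z m * expi (circle_phase m t)).
  apply: (@trig_cLfun2 _ _ _ _ circle _ (@measurable_circle_phase R)).
  by exists [seq (z m, m) | m <- r]; apply/funext => t; rewrite big_map.
have L1 : cLfun circle 2%:E (fun t => z m * expi (circle_phase m t)).
  by have := L2 [:: m]; under eq_fun do rewrite big_seq1.
rewrite big_cons EFinD ge0_muleDl ?lee_fin ?sqn_ge0 ?sumr_ge0//; last first.
  by move=> i _; exact: sqn_ge0.
rewrite -IH//.
transitivity (\int[circle]_t (sqmod (fun t => z m * expi (circle_phase m t) +
    \sum_(m <- s) z m * expi (circle_phase m t))%R t)%:E)%E.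
  by apply: eq_integral => t _; rewrite !sqmodE big_cons.
rewrite pythagorasD//.
  congr (_ + _)%E; under eq_integral do rewrite sqmodE sqnM sqn_expi mulr1.
  by rewrite integral_cst.
have ich i : cintegrable circle (fun t => z m * conjc (z i) *
    (expi (circle_phase m t) * conjc (expi (circle_phase i t)))).
  by apply: cintegrableZ; apply: cLfun2_mul_conjc; exact: cLfun2_circle_character.
rewrite (_ : (fun t => _) = fun t => \sum_(i <- s) z m * conjc (z i) *
    (expi (circle_phase m t) * conjc (expi (circle_phase i t)))); last first.
  apply/funext => t; rewrite rmorph_sum/= mulr_sumr; apply: eq_bigr => i _.
  by rewrite rmorphM/=; ring.
have [_ ->] := cintegral_sum s ich; rewrite big_seq big1// => i si.
rewrite cintegralZ; last by apply: cLfun2_mul_conjc; exact: cLfun2_circle_character.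
rewrite (_ : (fun t => _) = fun t => expi (circle_phase (m - i) t)); last first.
  by apply/funext => t; rewrite conjc_expi -expiD /circle_phase rmorphB/= mulrBl.
rewrite cintegral_circle_character ?mulr0// subr_eq0.
by apply: contraNneq ms => ->.
Qed.

Lemma integral_slab (f : spacetime R n -> \bar R) (w : set (torus R n)) :
  measurable w -> measurable_fun setT f -> (forall z, 0 <= f z)%E ->
  (\int[mu]_(z in snd @^-1` w) f z =
   \int[torus_measure R n]_(x in w) \int[circle]_t f (t, x))%E.
Proof.
move=> mw mf f0.
have mw' : measurable ((snd : spacetime R n -> torus R n) @^-1` w).
  by rewrite -[X in measurable X]setTI; exact: measurable_snd.
rewrite integral_mkcond [RHS]integral_mkcond.
transitivity (\int[torus_measure R n]_x fubini_G circle (f \_ (snd @^-1` w)) x)%E.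
  rewrite -fubini_tonelli2//; first exact/(measurable_restrictT _ mw')/measurable_funTS.
  by move=> z; rewrite patchE; case: ifP.
apply: eq_integral => x _; rewrite /fubini_G patchE; case: ifPn => xw.
  by apply: eq_integral => t _; rewrite patchE ifT//; apply/mem_set; exact: (set_mem xw).
rewrite [RHS](_ : _ = 0%E)// integral0_eq// => t _; rewrite patchE ifN//.
Qed.

(** The coefficient of exp(imt) in the wave, as a function of x. On the paraboloid all its
    frequencies k satisfy |k|^2 = -m, which makes it an eigenfunction unless it vanishes. *)
Definition mode (s : seq (R[i] * (int * ('I_n -> int)))) (m : int) (x : torus R n) : R[i] :=
  \sum_(c <- s | c.2.1 == m) c.1 * expi (dotp c.2.2 x).

(** Without repetition, as [circle_parseval] requires. *)
Definition frequencies (s : seq (R[i] * (int * ('I_n -> int)))) : seq int :=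
  undup [seq c.2.1 | c <- s].

Lemma trig_modes s t x :
  \sum_(c <- s) c.1 * expi (phase c.2 (t, x)) =
  \sum_(m <- frequencies s) mode s m x * expi (circle_phase m t).
Proof.
under [RHS]eq_bigr => m _ do rewrite /mode big_mkcond mulr_suml.
rewrite exchange_big/= [LHS]big_seq [RHS]big_seq; apply: eq_bigr => c cs.
rewrite (bigD1_seq c.2.1) ?undup_uniq//=; last by rewrite mem_undup; apply/mapP; exists c.
rewrite eqxx big1 ?addr0; last first.
  by move=> m /negbTE mc; rewrite eq_sym mc mul0r.
by rewrite /spacetime_phase/= expiD; ring.
Qed.

Lemma cmeasurable_mode s m : cmeasurable (mode s m).
Proof.
have := @trig_cLfun2 _ _ _ _ (torus_measure R n) _ (@measurable_dotp R n) (mode s m).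
move=> /(_ _)[]//; exists [seq (c.1, c.2.2) | c <- s & c.2.1 == m].
by apply/funext => x; rewrite /mode big_map big_filter.
Qed.

Lemma wave_parseval s (w : set (torus R n)) : measurable w ->
  (\int[mu]_(z in snd @^-1` w) (sqmod (fun z => \sum_(c <- s) c.1 * expi (phase c.2 z))%R z)%:E =
   (\sum_(m <- frequencies s) \int[torus_measure R n]_(x in w) (sqmod (mode s m) x)%:E)
     * circle setT)%E.
Proof.
move=> mw.
have mP : cmeasurable (fun z : spacetime R n => \sum_(c <- s) c.1 * expi (phase c.2 z)).
  have [] // := @trig_cLfun2 _ _ _ _ mu _ (@measurable_spacetime_phase R n)
    (fun z : spacetime R n => \sum_(c <- s) c.1 * expi (phase c.2 z)).
  by exists s.
rewrite integral_slab//; last 2 first.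
- exact: measurable_sqmodE.
- by move=> z; rewrite lee_fin sqmod_ge0.
transitivity (\int[torus_measure R n]_(x in w)
    ((\sum_(m <- frequencies s) (sqmod (mode s m) x)%:E) * circle setT))%E.
  apply: eq_integral => x _; rewrite sumEFin.
  under [in RHS]eq_bigr do rewrite sqmodE.
  rewrite -circle_parseval ?undup_uniq//; apply: eq_integral => t _.
  by rewrite !sqmodE trig_modes.
have sum_ge0 x : (0 <= \sum_(m <- frequencies s) (sqmod (mode s m) x)%:E)%E.
  by apply: sume_ge0 => m _; rewrite lee_fin sqmod_ge0.
have mmode m : measurable_fun w (fun x => (sqmod (mode s m) x)%:E).
  by apply: measurable_sqmodE; exact: cmeasurable_mode.
rewrite ge0_integralZr//; last exact: emeasurable_sum.
rewrite ge0_integral_sum// => m x _; by rewrite lee_fin sqmod_ge0.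
Qed.

Lemma free_wave_slab_bound :
  (forall eps : R, 0 < eps -> exists2 delta : R, 0 < delta &
    forall w s m, measurable w -> (torus_measure R n w < delta%:E)%E ->
      all (fun c => paraboloid c.2) s ->
      (\int[torus_measure R n]_(x in w) (sqmod (mode s m) x)%:E <=
       eps%:E * \int[torus_measure R n]_x (sqmod (mode s m) x)%:E)%E) ->
  forall eps : R, 0 < eps -> exists2 delta : R, 0 < delta &
    forall w u, measurable w -> (torus_measure R n w < delta%:E)%E -> free_waves u ->
      (\int[mu]_z (sqmod u z)%:E <= 1)%E ->
      (\int[mu]_(z in snd @^-1` w) (sqmod u z)%:E <= eps%:E)%E.
Proof.
move=> UI eps eps0; have [delta d0 dP] := UI (eps / 16) (divr_gt0 eps0 (ltr0n _ 16)).
exists delta => // w u mw wd fu u1.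
(* If a < eta is the squared distance from u to the finite sum P, the mass of P is at most 2 + 2a <=
   4, and the total 2a + 2 (eps / 16) (2 + 2a) is at most eps / 2 + eps / 2. *)
pose eta := Num.min 1 (eps / 4).
have eta0 : 0 < eta by rewrite lt_min ltr01 divr_gt0.
have eta1 : eta <= 1 by rewrite ge_min lexx.
have eta4 : eta <= eps / 4 by rewrite ge_min lexx orbT.
have [s ps us] := free_wave_paraboloid_approx fu eta0.
pose P (z : spacetime R n) := \sum_(c <- s) c.1 * expi (phase c.2 z).
have PL : cLfun mu 2%:E P.
  by apply: (@trig_cLfun2 _ _ _ _ mu _ (@measurable_spacetime_phase R n)); exists s.
have [mP _] := PL.
have uL := free_wave_cLfun2 fu; have [mu_u _] := uL.
pose v (z : spacetime R n) := u z - P z.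
have mv : cmeasurable v by exact: cmeasurableB.
have mw' : measurable ((snd : spacetime R n -> torus R n) @^-1` w).
  by rewrite -[X in measurable X]setTI; exact: measurable_snd.
have [a aE /andP[a0 ae]] := ge0_lt_EFin (int_sqmod_ge0 mu _ setT) us.
have mNv : cmeasurable (fun z => - v z).
  rewrite (_ : (fun z => _) = fun z => (-1) * v z); last by apply/funext => z; rewrite mulN1r.
  by apply: cmeasurableM => //; exact: cmeasurable_cst.
have Ple : (\int[mu]_z (sqmod P z)%:E <= (2 + 2 * a)%:E)%E.
  have := int_sqmodD mu mu_u mNv.
  rewrite (_ : (fun z => _) = P); last by apply/funext => z; rewrite /v opprB addrC subrK.
  move=> /le_trans; apply.
  rewrite (_ : (\int[mu]_z (sqmod (fun z => - v z)%R z)%:E = a%:E)%E); last first.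
    by rewrite -aE; apply: eq_integral => z _; rewrite !sqmodE sqnN.
  have -> : (2 + 2 * a)%:E = (2%:E * 1 + 2%:E * a%:E)%E by rewrite mule1 -EFinM -EFinD.
  by apply: leeD => //; exact: lee_wpmul2l.
have PT : (\int[mu]_z (sqmod P z)%:E =
   (\sum_(m <- frequencies s) \int[torus_measure R n]_x (sqmod (mode s m) x)%:E)
     * circle setT)%E.
  by rewrite -wave_parseval// preimage_setT.
have Pw : (\int[mu]_(z in snd @^-1` w) (sqmod P z)%:E <=
    (eps / 16)%:E * \int[mu]_z (sqmod P z)%:E)%E.
  rewrite PT wave_parseval// muleA; apply: lee_wpmul2r => //.
  rewrite ge0_sume_distrr; last by move=> m _; exact: int_sqmod_ge0.
  by apply: lee_sum => m _; exact: dP.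
have := int_sqmodD_on mu mw' mv mP.
rewrite (_ : (fun z => _) = u); last by apply/funext => z; rewrite /v subrK.
move=> /le_trans; apply.
have vw : (\int[mu]_(z in snd @^-1` w) (sqmod v z)%:E <= a%:E)%E.
  rewrite -aE; apply: ge0_subset_integral => //; first exact: measurable_sqmodE.
  by move=> z _; rewrite lee_fin sqmod_ge0.
apply: (@le_trans _ _ (2%:E * a%:E + 2%:E * ((eps / 16)%:E * (2 + 2 * a)%:E))%E).
  apply: leeD; first exact: lee_wpmul2l.
  apply: lee_wpmul2l => //; apply: (le_trans Pw); apply: lee_wpmul2l => //.
  by rewrite lee_fin divr_ge0// ltW.
rewrite -!EFinM -EFinD lee_fin.
by nra.
Qed.

End parseval.

(** * Directional derivatives and eigenfunctions among trigonometric polynomials *)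

Section line_derivative.
Context (R : realType) (V : normedModType R).

Lemma line_quotient (f : V -> R) (a v : V) (s : R) :
  (fun h : R => h^-1 *: ((f \o shift (a + s *: v)) (h *: v) - f (a + s *: v))) =
  (fun h : R => h^-1 *: (((fun s : R => f (a + s *: v)) \o shift s) (h *: 1) - f (a + s *: v))).
Proof.
apply/funext => h /=; congr (_ *: (f _ - _)).
have -> : h *: (1 : R^o) = h by exact: mulr1.
by rewrite scalerDl addrCA.
Qed.

(** The difference quotients coincide. It gives access to the rules for functions of one real
    variable, the chain rule and the fundamental theorem of calculus among them. *)
Lemma derive_line (f : V -> R) (a v : V) (s df : R) :
  is_derive (a + s *: v) v f df <-> is_derive s (1 : R) (fun s : R => f (a + s *: v)) df.
Proof.
have e := line_quotient f a v s.
split=> -[d dE]; split.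
- by move: d; rewrite /derivable e.
- by move: dE; rewrite /derive e.
- by move: d; rewrite /derivable e.
- by move: dE; rewrite /derive e.
Qed.

End line_derivative.

Section trigonometric_derivatives.
Context (R : realType) (n : nat).
Local Notation term := (R * ('I_n -> int) * R)%type.

(** A term (A, k, p) stands for A cos(k.x + p). The phase makes the class stable under partial
    derivatives, which multiply A by k_j and add pi/2 to p. *)
Definition cosines (s : seq term) (v : 'rV[R]_n) : R :=
  \sum_(c <- s) c.1.1 * cos (dotp c.1.2 (pt v) + c.2).

Definition dcosines (j : 'I_n) (s : seq term) : seq term :=
  [seq (c.1.1 * (c.1.2 j)%:~R, c.1.2, c.2 + pi / 2) | c <- s].

Lemma continuous_cosines s : continuous (cosines s).
Proof.
apply: continuous_sumr => c v.
apply: (@continuousM R _ (cst c.1.1)); first exact: cst_continuous.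
apply: (@continuous_comp _ _ _ (fun v : 'rV[R]_n => dotp c.1.2 (pt v) + c.2) cos).
  apply: (@continuousD R R^o _ (fun v : 'rV[R]_n => dotp c.1.2 (pt v)) (cst c.2)).
    exact: continuous_dotp.
  exact: cst_continuous.
exact: continuous_cos.
Qed.

Lemma is_derive_cosine_line (A b p t : R) :
  is_derive t (1 : R) (fun t => A * cos (p + b * t)) (A * b * cos (p + b * t + pi / 2)).
Proof.
have d1 : is_derive t (1 : R) (fun t => p + b * t) (0 + b * 1).
  have db := is_derive_scale b (@is_derive_id R R^o t 1).
  exact: (@is_deriveD R R^o R^o (cst p) _ t 1 0 _ (is_derive_cst _ _ _) db).
have d2 := @is_derive1_comp R cos (fun t => p + b * t) t _ _ (is_derive_cos _) d1.
have := is_derive_scale A d2.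
move=> /is_derive_eq; apply.
by rewrite cosDpihalf; ring.
Qed.

Lemma is_derive_cosines j s v :
  is_derive v (dir R j) (cosines s) (cosines (dcosines j s) v).
Proof.
rewrite -{1}[v]addr0 -(scale0r (dir R j)); apply/derive_line.
elim: s => [|c s IH].
  rewrite (_ : (fun t => _) = cst 0); last by apply/funext => t; rewrite /cosines big_nil.
  rewrite /cosines big_nil; exact: is_derive_cst.
rewrite (_ : (fun t => _) = (fun t => c.1.1 * cos (dotp c.1.2 (pt v) + c.2 + (c.1.2 j)%:~R * t)) +
    (fun t => cosines s (v + t *: dir R j))); last first.
  apply/funext => t; rewrite /cosines big_cons dotp_dir; congr (_ * cos _ + _).
  by rewrite addrAC.
have -> : cosines (dcosines j (c :: s)) v =
    c.1.1 * (c.1.2 j)%:~R * cos (dotp c.1.2 (pt v) + (c.2 + pi / 2)) +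
    cosines (dcosines j s) v by rewrite /cosines big_cons.
have dc := is_derive_cosine_line c.1.1 (c.1.2 j)%:~R (dotp c.1.2 (pt v) + c.2) 0.
rewrite mulr0 addr0 -addrA in dc.
exact: (@is_deriveD R R^o R^o _ _ 0 1 _ _ dc IH).
Qed.

Lemma derive_cosines j s : 'D_(dir R j) (cosines s) = cosines (dcosines j s).
Proof. by apply/funext => v; have [_ ->] := is_derive_cosines j s v. Qed.

Lemma C2_cosines s : C2 (cosines s).
Proof.
split.
- exact: continuous_cosines.
- move=> i; split; first by move=> v; have [] := is_derive_cosines i s v.
  by rewrite derive_cosines; exact: continuous_cosines.
- move=> i j; rewrite derive_cosines; split.
    by move=> v; have [] := is_derive_cosines j (dcosines i s) v.
  by rewrite derive_cosines; exact: continuous_cosines.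
Qed.

Lemma dcosines2 j s v : cosines (dcosines j (dcosines j s)) v =
  \sum_(c <- s) - (c.1.2 j)%:~R ^+ 2 * (c.1.1 * cos (dotp c.1.2 (pt v) + c.2)).
Proof.
rewrite /cosines /dcosines !big_map; apply: eq_bigr => c _ /=.
by rewrite !addrA cosDpihalf sinDpihalf; ring.
Qed.

Lemma laplacian_cosines s (l : int) v : all (fun c => isqnorm c.1.2 == l) s ->
  real_laplacian (cosines s) v = - l%:~R * cosines s v.
Proof.
move=> sl; rewrite /real_laplacian.
have E j : 'D_(dir R j) ('D_(dir R j) (cosines s)) v =
    \sum_(c <- s) - (c.1.2 j)%:~R ^+ 2 * (c.1.1 * cos (dotp c.1.2 (pt v) + c.2)).
  by rewrite derive_cosines; have [_ ->] := is_derive_cosines j (dcosines j s) v; rewrite dcosines2.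
rewrite (eq_bigr _ (fun j _ => E j)) exchange_big/= /cosines mulr_sumr.
clear E; elim: s sl => [|c s IH /= /andP[/eqP cl sl]]; first by rewrite !big_nil.
rewrite !big_cons IH//; congr (_ + _).
rewrite -mulr_suml; congr (_ * _).
by rewrite sumrN -cl isqnormE.
Qed.

End trigonometric_derivatives.

Section modes.
Context (R : realType) (n : nat).

Lemma trig_mode_eigenfunction (s : seq (R[i] * ('I_n -> int))) (l : int) :
  all (fun c => isqnorm c.2 == l) s ->
  (exists v, \sum_(c <- s) c.1 * expi (dotp c.2 (@pt R n v)) != 0) ->
  eigenfunctions (fun x : torus R n => \sum_(c <- s) c.1 * expi (dotp c.2 x)).
Proof.
move=> sl nz.
(* Since cos(x + pi/2) = -sin x, the real part of (a + ib) e^{ix} is a cos x + b cos(x + pi/2), and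
   its imaginary part is b cos x - a cos(x + pi/2). *)
pose sr := flatten [seq [:: (complex.Re c.1, c.2, 0 : R); (complex.Im c.1, c.2, pi / 2)] | c <- s].
pose si := flatten [seq [:: (complex.Im c.1, c.2, 0 : R); (- complex.Re c.1, c.2, pi / 2)] | c <- s].
have reE : (fun v => complex.Re (\sum_(c <- s) c.1 * expi (dotp c.2 (@pt R n v)))) = cosines sr.
  apply/funext => v; rewrite /sr /cosines; elim: (s) => [|c s' IH]; first by rewrite !big_nil.
  rewrite /= !big_cons -IH/= cosDpihalf addr0.
  by case: (\sum_(_ <- _) _) => a b; case: (c.1) => a' b' /=; ring.
have imE : (fun v => complex.Im (\sum_(c <- s) c.1 * expi (dotp c.2 (@pt R n v)))) = cosines si.
  apply/funext => v; rewrite /si /cosines; elim: (s) => [|c s' IH]; first by rewrite !big_nil.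
  rewrite /= !big_cons -IH/= cosDpihalf addr0.
  by case: (\sum_(_ <- _) _) => a b; case: (c.1) => a' b' /=; ring.
have all_sr : all (fun c => isqnorm c.1.2 == l) sr.
  by rewrite /sr; elim: (s) sl => //= c s' IH /andP[-> /IH ->].
have all_si : all (fun c => isqnorm c.1.2 == l) si.
  by rewrite /si; elim: (s) sl => //= c s' IH /andP[-> /IH ->].
split => //.
- by apply: trig_periodic; exists s.
- by rewrite reE; exact: C2_cosines.
- by rewrite imE; exact: C2_cosines.
- exists (- l%:~R)%:C => v; rewrite /laplacian reE imE.
  rewrite !(laplacian_cosines (l := l))//.
  rewrite -[cosines sr v]/((fun v => cosines sr v) v) -reE -imE.
  case: (\sum_(_ <- _) _) => a b /=; apply/eqP; rewrite eq_complex/=.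
  by apply/andP; split; apply/eqP; ring.
Qed.

Lemma pt_surjective (x : torus R n) : exists v, pt v = x.
Proof.
exists (\row_j tnth x j); apply: eq_from_tnth => j.
by rewrite tnth_mktuple mxE.
Qed.

Lemma mode_uniform_bound :
  uniformly_square_integrable (torus_measure R n)
    (normalized (torus_measure R n) (@eigenfunctions R n)) ->
  forall eps : R, 0 < eps -> exists2 delta : R, 0 < delta &
    forall w s m, measurable w -> (torus_measure R n w < delta%:E)%E ->
      all (fun c : R[i] * (int * ('I_n -> int)) => paraboloid c.2) s ->
      (\int[torus_measure R n]_(x in w) (sqmod (mode s m) x)%:E <=
       eps%:E * \int[torus_measure R n]_x (sqmod (mode s m) x)%:E)%E.
Proof.
move=> [_ _ UI] eps eps0; have [delta d0 dP] := UI eps eps0.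
exists delta => // w s m mw wd sp.
have mL : cLfun (torus_measure R n) 2%:E (mode s m).
  apply: (@trig_cLfun2 _ _ _ _ (torus_measure R n) _ (@measurable_dotp R n)).
  exists [seq (c.1, c.2.2) | c <- s & c.2.1 == m].
  by apply/funext => x; rewrite /mode big_map big_filter.
apply: (@int_sqmod_le_of_normalized _ _ _ _ _ _ _ (@eigenfunctions R n) mL mw eps0) => [f fS|a a0 rn0]; first exact: (dP f w fS mw wd).
pose f x := a%:C * mode s m x.
pose sf := [seq (a%:C * c.1, c.2.2) | c <- s & c.2.1 == m].
have fE : f = fun x => \sum_(c <- sf) c.1 * expi (dotp c.2 x).
  apply/funext => x; rewrite /f /mode /sf big_map big_filter mulr_sumr.
  by apply: eq_bigr => c _; rewrite mulrA.
rewrite -/f fE; apply: (@trig_mode_eigenfunction _ (- m)).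
  rewrite /sf; elim: (s) sp => //= c s' IH /andP[/eqP pc /IH {}IH].
  by case: ifPn => //= /eqP cm; rewrite IH andbT -cm pc opprK.
(* A mode that vanishes at every point has zero norm, which [rn0] excludes. *)
apply: contrapT => nz; move/eqP : rn0; apply.
rewrite /Rintegral integral0_eq// => x _; rewrite sqmodE.
have [v <-] := pt_surjective x.
have : f (pt v) = 0.
  apply/eqP/negPn/negP => fv; apply: nz; exists v.
  by rewrite -[\sum_(_ <- _) _]/((fun x => \sum_(c <- sf) c.1 * expi (dotp c.2 x)) (pt v)) -fE.
rewrite /f => /eqP; rewrite mulf_eq0 => /orP[|/eqP ->]; last by rewrite sqn0.
by rewrite eq_complex/= eqxx andbT gt_eqF.
Qed.

End modes.

(** * Countable nets of continuous functions *)

Section rational_boxes.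
Context (R : realType) (n : nat).
Local Notation V := (R * 'rV[R]_n)%type.

(** Centre and radius range over a countable type, hence the finite function for the spatial centre;
    the coordinate form makes preimages measurable from coordinatewise measurability. *)
Definition rational_box (c : rat * {ffun 'I_n -> rat} * rat) : set V :=
  [set z : V | `|ratr c.1.1 - z.1| < ratr c.2 :> R /\
           forall j, `|ratr (c.1.2 j) - z.2 0 j| < ratr c.2 :> R].

Lemma continuous_entry (j : 'I_n) : continuous (fun z : V => z.2 0 j).
Proof.
move=> z; apply: (@continuous_comp _ _ _ (@snd R 'rV[R]_n) (fun v => v 0 j)).
  exact: cvg_snd.
exact: coord_continuous.
Qed.

Lemma near_dist_lt (f : V -> R) (q r : R) z : continuous f ->
  `|q - f z| < r -> \forall w \near z, `|q - f w| < r.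
Proof.
move=> fc qr.
have gc : {for z, continuous (fun w => `|q - f w|)}.
  apply: (@continuous_comp _ _ _ (fun w => q - f w) Num.norm); last exact: norm_continuous.
  apply: (@continuousB _ R^o _ (cst q) f); [exact: cst_continuous|exact: fc].
exact: (cvgr_lt _ gc).
Qed.

Lemma open_rational_box c : open (rational_box c).
Proof.
rewrite openE => z [zt zx]; apply: filterI.
  by apply: near_dist_lt => //; move=> ?; exact: cvg_fst.
have H : nbhs z [set w : V | forall j, `|ratr (c.1.2 j) - w.2 0 j| < ratr c.2 :> R].
  refine (@filter_forall V 'I_n (fun j =>
    [set w : V | `|ratr (c.1.2 j) - w.2 0 j| < ratr c.2 :> R]) (nbhs z) _ _) => j.
  by apply: (near_dist_lt (f := fun z : V => z.2 0 j)) => //; exact: continuous_entry.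
exact: H.
Qed.

Lemma rational_approx (x r : R) : 0 < r -> exists q : rat, `|ratr q - x| < r.
Proof.
move=> r0; have xr : x - r < x + r by lra.
by have [q] := rat_in_itvoo xr; rewrite in_itv/= => qr; exists q; rewrite distrC ltr_distlC.
Qed.

Lemma rational_box_basis z (U : set V) : nbhs z U ->
  exists2 c, rational_box c z & rational_box c `<=` U.
Proof.
move=> /nbhs_ballP[e /= e0 eU].
(* Two points of a box of radius r < e/2 differ by less than e in every coordinate. *)
have [r] := rat_in_itvoo (divr_gt0 e0 (ltr0n _ 2)); rewrite in_itv/= => /andP[r0 re].
have [q0 q0P] := rational_approx z.1 r0.
have [q qP] := choice (fun j => rational_approx (z.2 0 j) r0).
exists (q0, [ffun j => q j], r); first by split => //= j; rewrite ffunE.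
move=> w [/= w0 wj]; apply: eU; split => /=.
  rewrite -ball_normE/=; move: q0P w0; rewrite !ltr_norml => /andP[? ?] /andP[? ?].
  by apply/andP; split; lra.
split => // i j; rewrite -ball_normE/= (ord1 i).
move: (wj j) (qP j); rewrite ffunE !ltr_norml => /andP[? ?] /andP[? ?].
by apply/andP; split; lra.
Qed.

Section measurability.
Context (d : measure_display) (X : measurableType d) (F : X -> V).
Hypothesis mF1 : measurable_fun setT (fun x => (F x).1).
Hypothesis mF2 : forall j, measurable_fun setT (fun x => (F x).2 0 j).

Lemma measurable_preimage_box c : measurable (F @^-1` rational_box c).
Proof.
rewrite (_ : _ @^-1` _ = [set x | `|ratr c.1.1 - (F x).1| < ratr c.2 :> R] `&`
  \bigcap_(j in [set: 'I_n]) [set x | `|ratr (c.1.2 j) - (F x).2 0 j| < ratr c.2 :> R]); last first.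
  by apply/seteqP; split => x /= [h1 h2]; split => // j; [move=> _; exact: h2|exact: h2 I].
have mlt (g : X -> R) (q r : R) : measurable_fun setT g ->
    measurable [set x | `|q - g x| < r].
  move=> mg; rewrite -[X in measurable X]setTI.
  rewrite (_ : [set x | _] = (fun x => `|q - g x|) @^-1` `]-oo, r[%classic); last first.
    by apply/seteqP; split => x /=; rewrite in_itv.
  have mh : measurable_fun setT (fun x => `|q - g x|).
    by apply: measurableT_comp => //; exact: measurable_funB.
  by apply: mh => //; exact: measurable_itv.
apply: measurableI; first exact: mlt.
by apply: fin_bigcap_measurable => // j _; exact: (mlt (fun x => (F x).2 0 j)).
Qed.

(** [F] is only known to be measurable coordinate by coordinate; but an open set is the countable
    union of the rational boxes that it contains. *)
Lemma measurable_preimage_open (U : set V) : open U -> measurable (F @^-1` U).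
Proof.
rewrite openE => Uo.
pose G k := if unpickle k is Some c then
  [set x | F x \in rational_box c /\ rational_box c `<=` U] else set0.
rewrite (_ : _ @^-1` _ = \bigcup_k G k).
  apply: bigcup_measurable => k _; rewrite /G; case: (unpickle k) => // c.
  have [cU|ncU] := pselect (rational_box c `<=` U).
    rewrite (_ : [set x | _] = F @^-1` rational_box c); first exact: measurable_preimage_box.
    by apply/seteqP; split => [x [/set_mem]//|x /mem_set xc]; split.
  by rewrite (_ : [set x | _] = set0)//; apply/seteqP; split => x // [].
apply/seteqP; split => [x /= /Uo /rational_box_basis[c cx cU]|x [k _]].
  exists (pickle c); first exact: I.
  by rewrite /G pickleK; split; [exact: mem_set|].
by rewrite /G; case: (unpickle k) => // c /= [/set_mem + cU]; exact: cU.
Qed.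

Lemma measurable_continuous_comp (f : V -> R) : continuous f ->
  measurable_fun setT (f \o F).
Proof.
move=> fc mD; apply: (measurability _ (RGenOInfty.measurableE R)) => //.
move=> /= _ [_ [x ->] <-]; rewrite setTI comp_preimage.
by apply: measurable_preimage_open; apply: open_comp => [? _|]; [exact: fc|exact: interval_open].
Qed.

End measurability.

Definition net_value (q : rat * rat) : R[i] := ratr q.1 +i* ratr q.2.

(* The value attached to the first box of the list that contains [z]. *)
Definition net (l : seq ((rat * {ffun 'I_n -> rat} * rat) * (rat * rat))) (z : V) : R[i] :=
  foldr (fun c acc => if z \in rational_box c.1 then net_value c.2 else acc) 0 l.

(** Compactness leaves finitely many boxes, each with a rational value accurate on the whole box.
    The order of the list is therefore irrelevant: whichever box comes first at z, its value is
    accurate there. *)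
Lemma net_dense (a : V -> R[i]) (K : set V) (eps : R) :
  continuous (fun z => complex.Re (a z)) -> continuous (fun z => complex.Im (a z)) ->
  compact K -> 0 < eps -> exists l, forall z, K z -> sqn (a z - net l z) <= eps.
Proof.
move=> ac1 ac2; pose T : ptopologicalType := HB.pack V (Topological.on V) (isPointed.Build V (0, 0)).
rewrite (@compact_cover T) => Kc eps0.
pose I : choiceType := ((rat * {ffun 'I_n -> rat} * rat) * (rat * rat))%type.
pose D : set I := [set i | forall z, rational_box i.1 z -> sqn (a z - net_value i.2) <= eps].
have [||D' D'D KD'] := Kc I D (fun i => rational_box i.1).
- by move=> i _; exact: open_rational_box.
- move=> z Kz.
  (* Two components, each with squared error below eps / 2. *)
  pose eta := Num.sqrt (eps / 2).
  have eta0 : 0 < eta by rewrite sqrtr_gt0 divr_gt0.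
  have eta2 : eta ^+ 2 = eps / 2 by rewrite sqr_sqrtr// ltW// divr_gt0.
  have [q1 q1P] := rational_approx (complex.Re (a z)) eta0.
  have [q2 q2P] := rational_approx (complex.Im (a z)) eta0.
  have [c cz cU] := rational_box_basis (filterI (near_dist_lt ac1 q1P) (near_dist_lt ac2 q2P)).
  exists (c, (q1, q2)) => //= w /cU [/=]; rewrite /sqn /net_value.
  case: (a w) => u v /=; rewrite !ltr_norml => /andP[h1 h2] /andP[h3 h4].
  nra.
exists (finmap.enum_fset D') => z /KD' [i /= iD' iz].
have : forall i, i \in finmap.enum_fset D' -> D i.
  by move=> j jD'; apply/set_mem/D'D.
have : exists2 i, i \in finmap.enum_fset D' & rational_box i.1 z by exists i.
elim: (finmap.enum_fset D') => [[]//|j l IH [j0 j0l j0z] lD] /=.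
case: ifPn => [/set_mem jz|njz]; first by apply: lD => //; rewrite mem_head.
apply: IH; last by move=> k kl; apply: lD; rewrite inE kl orbT.
exists j0 => //; move: j0l; rewrite inE => /orP[/eqP j0j|//].
by move: njz; rewrite -j0j mem_set.
Qed.

Lemma cmeasurable_net (d : measure_display) (X : measurableType d) (F : X -> V) l :
  measurable_fun setT (fun x => (F x).1) ->
  (forall j, measurable_fun setT (fun x => (F x).2 0 j)) ->
  cmeasurable (fun x => net l (F x)).
Proof.
move=> mF1 mF2; elim: l => [|c l IH] /=; first exact: cmeasurable_cst.
have mc := measurable_preimage_box mF1 mF2 c.1.
have E x : (if F x \in rational_box c.1 then net_value c.2 else net l (F x)) =
    cindic R (F @^-1` rational_box c.1) x * (net_value c.2 - net l (F x)) + net l (F x).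
  rewrite /cindic indicE; case: ifPn => h.
    have -> : x \in F @^-1` rational_box c.1 by move: h; rewrite !inE.
    by rewrite mul1r subrK.
  have -> : (x \in F @^-1` rational_box c.1) = false by apply/negbTE; move: h; rewrite !notin_setE.
  by rewrite mul0r add0r.
rewrite (funext E).
apply: cmeasurableD => //; apply: cmeasurableM; first exact: cmeasurable_cindic.
by apply: cmeasurableB => //; exact: cmeasurable_cst.
Qed.

(** Closed at 2 pi in order to be compact; almost every point of space-time has its coordinates in
    it. *)
Definition torus_box : set V :=
  `[0, 2 * pi]%classic `*` [set v : 'rV[R]_n | forall j, v ord0 j \in `[0, 2 * pi]].

Lemma compact_torus_box : compact torus_box.
Proof.
apply: compact_setX; first exact: segment_compact.
have := @rV_compact R n (fun=> `[0, 2 * pi]%classic) (fun=> @segment_compact R 0 (2 * pi)).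
by [].
Qed.

End rational_boxes.

Section almost_everywhere.
Context (d1 d2 : measure_display) (X1 : measurableType d1) (X2 : measurableType d2).
Context (R : realType).
Variables (m1 : {finite_measure set X1 -> \bar R}) (m2 : {finite_measure set X2 -> \bar R}).

Lemma ae_prod (Q1 : X1 -> Prop) (Q2 : X2 -> Prop) :
  {ae m1, forall x, Q1 x} -> {ae m2, forall x, Q2 x} ->
  {ae finite_product m1 m2, forall z, Q1 z.1 /\ Q2 z.2}.
Proof.
move=> [N1 [mN1 N10 QN1]] [N2 [mN2 N20 QN2]].
have mA : measurable (N1 `*` [set: X2]) by exact: measurableX.
have mB : measurable ([set: X1] `*` N2) by exact: measurableX.
exists ((N1 `*` setT) `|` (setT `*` N2)); split; first exact: measurableU.
  apply: (@null_set_setU _ _ _ (finite_product m1 m2)) => //.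
    transitivity (m1 N1 * m2 setT)%E; first exact: product_measure1E.
    by rewrite [X in (X * _)%E](N10 : m1 N1 = 0%E) mul0e.
  transitivity (m1 setT * m2 N2)%E; first exact: product_measure1E.
  by rewrite [X in (_ * X)%E](N20 : m2 N2 = 0%E) mule0.
move=> z nQ; have [Q1z|nQ1z] := pselect (Q1 z.1).
  by right; split => //=; apply: QN2 => Q2z; apply: nQ.
by left; split => //=; apply: QN1.
Qed.

End almost_everywhere.

Section bounded_ae.
Context (d : measure_display) (X : measurableType d) (R : realType).
Variable mu : {finite_measure set X -> \bar R}.

Lemma ae_bounded_integrable (Q : X -> Prop) (g : X -> R) (M : R) :
  {ae mu, forall x, Q x} -> measurable_fun setT g -> (forall x, Q x -> `|g x| <= M) ->
  mu.-integrable setT (EFin \o g).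
Proof.
move=> Qae mg gM; apply/integrableP; split; first exact/measurable_EFinP.
apply: (@le_lt_trans _ _ (\int[mu]_x (`|M|)%:E)%E); last first.
  rewrite integral_cst//; apply: lte_mul_pinfty => //.
  by rewrite ltey_eq fin_num_measure.
apply: ae_ge0_le_integral => //.
- by do 2!apply: measurableT_comp => //; exact/measurable_EFinP.
- apply: (@filterS _ _ (ae_filter_ringOfSetsType mu) _ _ _ Qae) => x Qx _ /=.
  by rewrite lee_fin (le_trans (gM _ Qx))// ler_norm.
Qed.

Lemma ae_bounded_cLfun2 (Q : X -> Prop) (f : X -> R[i]) (M : R) :
  {ae mu, forall x, Q x} -> cmeasurable f -> (forall x, Q x -> sqn (f x) <= M) ->
  cLfun mu 2%:E f.
Proof.
move=> Qae mf fM; apply/cLfun2P; split => //.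
have /integrableP[_] : mu.-integrable setT (EFin \o sqmod f).
  apply: (ae_bounded_integrable (M := M) Qae (measurable_sqmod mf)) => x Qx.
  by rewrite ger0_norm ?sqmod_ge0// sqmodE; exact: fM.
congr (_ < _)%E; apply: eq_integral => x _.
by rewrite /= ger0_norm ?sqmod_ge0.
Qed.

End bounded_ae.

Section torus_coordinates.
Context (R : realType).
Local Notation circle := (circle_measure R).

(** Tuples carry the measure and row vectors the topology; this map passes from the former to the
    latter. *)
Definition unpt n (x : torus R n) : 'rV[R]_n := \row_j tnth x j.

Lemma unptK n : cancel (@unpt n) (@pt R n).
Proof. by move=> x; apply: eq_from_tnth => j; rewrite tnth_mktuple mxE. Qed.

Definition coordinates n (z : spacetime R n) : R * 'rV[R]_n := (z.1, unpt z.2).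

Definition in_box n (x : torus R n) : Prop := forall j, tnth x j \in `[0, 2 * pi].

Lemma measurable_in_box n : measurable [set x | @in_box n x].
Proof.
rewrite (_ : [set x | _] = \bigcap_(j in [set: 'I_n]) (@tnth n R ^~ j) @^-1` `[0, 2 * pi]%classic).
  apply: fin_bigcap_measurable => // j _; rewrite -[X in measurable X]setTI.
  by apply: measurable_tnth => //; exact: measurable_itv.
by apply/seteqP; split => x /= h; [move=> j _|move=> j]; apply: h.
Qed.

Lemma circle_box : {ae circle, forall t, t \in `[0, 2 * pi]}.
Proof.
by apply: (@circle_ae R 0) => t /andP[t0 t2] _; rewrite in_itv/= !ltW.
Qed.

Lemma torus_box_ae n : {ae torus_measure R n, forall x, in_box x}.
Proof.
elim: n => [|n IH]; first by exists set0; split => // x /= h; apply: h => -[].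
have [N [mN N0 QN]] := ae_prod circle_box IH.
have mB : measurable (~` [set x | @in_box n.+1 x]).
  by apply: measurableC; exact: measurable_in_box.
exists (~` [set x | @in_box n.+1 x]); split => //.
apply/eqP; rewrite eq_le measure_ge0 andbT -N0.
apply: (@le_measure _ _ _ (finite_product circle (torus_measure R n))); rewrite ?inE//.
  by rewrite -[X in measurable X]setTI; exact: measurable_cons_pair.
move=> [t x] nbox; apply: QN => -[/= tI xI]; apply: nbox => j.
case: (unliftP ord0 j) => [i ->|->]; last by rewrite tnth0.
by rewrite tnthS.
Qed.

Lemma spacetime_box_ae n :
  {ae spacetime_fin R n, forall z, torus_box (coordinates z)}.
Proof.
apply: (@filterS _ _ (ae_filter_ringOfSetsType (spacetime_fin R n)) _ _ _
  (ae_prod circle_box (@torus_box_ae n))) => z [zI zB]; split => //= j.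
by rewrite mxE; exact: zB.
Qed.

Lemma measurable_unpt_entry n j : measurable_fun setT (fun x : torus R n => unpt x 0 j).
Proof.
rewrite (_ : (fun x => _) = @tnth n R ^~ j); first exact: measurable_tnth.
by apply/funext => x; rewrite mxE.
Qed.

Lemma measurable_continuous_spacetime n (h : R * 'rV[R]_n -> R) : continuous h ->
  measurable_fun setT (h \o @coordinates n).
Proof.
move=> ch; apply: measurable_continuous_comp => //; first exact: measurable_fst.
move=> j; exact: (measurableT_comp (measurable_unpt_entry j) measurable_snd).
Qed.

Lemma measurable_continuous_torus n (h : 'rV[R]_n -> R) : continuous h ->
  measurable_fun setT (h \o @unpt n).
Proof.
move=> ch; have ch' : continuous (h \o @snd R 'rV[R]_n).
  by move=> z; apply: continuous_comp; [exact: cvg_snd|exact: ch].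
exact: (measurable_continuous_comp (F := fun x => (0, unpt x)) _ (@measurable_unpt_entry n) ch').
Qed.

Lemma continuous_box_bounded n (h : 'rV[R]_n -> R) : continuous h ->
  exists M, forall v : 'rV[R]_n, (forall j, v 0 j \in `[0, 2 * pi]) -> `|h v| <= M.
Proof.
move=> ch.
have Kc := @rV_compact R n (fun=> `[0, 2 * pi]%classic) (fun=> @segment_compact R 0 (2 * pi)).
have /compact_bounded [M [_ MP]] := continuous_compact (continuous_subspaceT ch) Kc.
by exists (M + 1) => v vI; apply: (MP (M + 1)); [rewrite ltrDl|exists v].
Qed.

Lemma continuous_torus_integrable n (h : 'rV[R]_n -> R) : continuous h ->
  (torus_measure R n).-integrable setT (EFin \o (h \o @unpt n)).
Proof.
move=> ch; have [M hM] := continuous_box_bounded ch.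
apply: (ae_bounded_integrable (M := M) (@torus_box_ae n) (measurable_continuous_torus ch)).
by move=> x xb; apply: hM => j; rewrite mxE; exact: xb.
Qed.

Lemma continuous_cmeasurable n (f : torus R n -> R[i]) :
  continuous (fun v => complex.Re (f (pt v))) ->
  continuous (fun v => complex.Im (f (pt v))) -> cmeasurable f.
Proof.
move=> c1 c2; split.
  rewrite (_ : (fun x => _) = (fun v => complex.Re (f (pt v))) \o @unpt n).
    exact: measurable_continuous_torus.
  by apply/funext => x /=; rewrite unptK.
rewrite (_ : (fun x => _) = (fun v => complex.Im (f (pt v))) \o @unpt n).
  exact: measurable_continuous_torus.
by apply/funext => x /=; rewrite unptK.
Qed.

Lemma continuous_cLfun2 n (f : torus R n -> R[i]) :
  continuous (fun v => complex.Re (f (pt v))) ->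
  continuous (fun v => complex.Im (f (pt v))) -> cLfun (torus_measure R n) 2%:E f.
Proof.
move=> c1 c2; have [M1 M1P] := continuous_box_bounded c1.
have [M2 M2P] := continuous_box_bounded c2.
apply: (ae_bounded_cLfun2 (M := M1 ^+ 2 + M2 ^+ 2) (@torus_box_ae n)
  (continuous_cmeasurable c1 c2)) => x xb.
have xb' j : unpt x 0 j \in `[0, 2 * pi] by rewrite mxE; exact: xb.
have := M1P _ xb'; have := M2P _ xb'; rewrite unptK /sqn => h2 h1.
have sq (u M : R) : `|u| <= M -> u ^+ 2 <= M ^+ 2.
  by move=> h; rewrite -(real_normK (num_real u)) ler_pXn2r// nnegrE (le_trans _ h).
by apply: lerD; exact: sq.
Qed.

Lemma C0_cmeasurable n (a : spacetime R n -> R[i]) : C0 a -> cmeasurable a.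
Proof.
move=> [c1 c2 _ _]; split.
  rewrite (_ : (fun x => _) = (fun z : R * 'rV[R]_n => complex.Re (a (z.1, pt z.2))) \o @coordinates n).
    exact: measurable_continuous_spacetime.
  by apply/funext => -[t x] /=; rewrite unptK.
rewrite (_ : (fun x => _) = (fun z : R * 'rV[R]_n => complex.Im (a (z.1, pt z.2))) \o @coordinates n).
  exact: measurable_continuous_spacetime.
by apply/funext => -[t x] /=; rewrite unptK.
Qed.

Lemma C0_net n (a : spacetime R n -> R[i]) (eps : R) : C0 a -> 0 < eps ->
  exists l, {ae spacetime_fin R n, forall z, sqn (a z - net l (coordinates z)) <= eps}.
Proof.
move=> [c1 c2 _ _] eps0.
have [l lP] := net_dense (a := fun z => a (z.1, pt z.2)) c1 c2 (@compact_torus_box R n) eps0.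
exists l; apply: (@filterS _ _ (ae_filter_ringOfSetsType (spacetime_fin R n)) _ _ _
  (@spacetime_box_ae n)) => -[t x] /lP /=; by rewrite unptK.
Qed.

Lemma cmeasurable_net_coordinates n l : cmeasurable (fun z : spacetime R n => net l (coordinates z)).
Proof.
apply: cmeasurable_net; first exact: measurable_fst.
move=> j; exact: (measurableT_comp (measurable_unpt_entry j) measurable_snd).
Qed.

End torus_coordinates.

(** * Eigenfunctions as free waves *)

Section vanishing_sections.
Context d1 d2 (X1 : measurableType d1) (X2 : measurableType d2) (R : realType).
Variables (m1 : {finite_measure set X1 -> \bar R}) (m2 : {finite_measure set X2 -> \bar R}).
Local Notation m := (finite_product m1 m2).
Variable r : X1 * X2 -> R.
Hypothesis ir : m.-integrable setT (EFin \o r).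

Lemma Rintegral_sections_eq0l :
  {ae m1, forall x, \int[m2]_y r (x, y) = 0} -> \int[m]_z r z = 0.
Proof.
move=> r0; rewrite /Rintegral.
have ir' : (m1 \x m2)%E.-integrable setT (EFin \o r) by exact: ir.
rewrite -(integral12_prod_meas1 ir') (ae_eq_integral (cst 0%E)) ?integral0//.
  exact: measurable_fubini_F ir'.
have F := ae_filter_ringOfSetsType m1.
have ei := ae_integrable1 ir'.
apply: (@filterS2 _ _ F _ _ _ _ ei r0) => x ix rx _.
by rewrite /fubini_F -[LHS]fineK ?(integrable_fin_num _ ix)//; congr EFin; exact: rx.
Qed.

Lemma Rintegral_sections_eq0r :
  {ae m2, forall y, \int[m1]_x r (x, y) = 0} -> \int[m]_z r z = 0.
Proof.
move=> r0; rewrite /Rintegral.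
have ir' : (m1 \x m2)%E.-integrable setT (EFin \o r) by exact: ir.
rewrite -(integral12_prod_meas1 ir') (Fubini ir') (ae_eq_integral (cst 0%E)) ?integral0//.
  exact: measurable_fubini_G ir'.
have F := ae_filter_ringOfSetsType m2.
have ei := ae_integrable2 ir'.
apply: (@filterS2 _ _ F _ _ _ _ ei r0) => x ix rx _.
by rewrite /fubini_G -[LHS]fineK ?(integrable_fin_num _ ix)//; congr EFin; exact: rx.
Qed.

End vanishing_sections.

Section integration_by_parts.
Context (R : realType).
Local Notation circle := (circle_measure R).

Definition update n (x : torus R n) (j : 'I_n) (s : R) : torus R n :=
  [tuple (if i == j then s else tnth x i) | i < n].

Lemma update_cons0 n t (y : torus R n) s : update (cons_pair (t, y)) ord0 s = cons_pair (s, y).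
Proof.
apply: eq_from_tnth => i; rewrite tnth_mktuple.
by case: (unliftP ord0 i) => [k ->|->]; rewrite ?tnthS ?tnth0.
Qed.

Lemma update_consS n t (y : torus R n) i s :
  update (cons_pair (t, y)) (lift ord0 i) s = cons_pair (t, update y i s).
Proof.
apply: eq_from_tnth => k; rewrite tnth_mktuple.
case: (unliftP ord0 k) => [l ->|->]; rewrite ?tnthS ?tnth0//.
by rewrite (inj_eq lift_inj) tnth_mktuple.
Qed.

(** Fubini's theorem splits off the first coordinate only, so induction on the dimension is needed
    to reach the j-th one. A bound on the box gives integrability, since almost every point lies
    there. *)
Lemma coordinate_integral_eq0 n (g : torus R n -> R) (M : R) (j : 'I_n) :
  measurable_fun setT g -> (forall x, in_box x -> `|g x| <= M) ->
  (forall x, \int[circle]_s g (update x j s) = 0) ->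
  \int[torus_measure R n]_x g x = 0.
Proof.
elim: n g j => [g []//|n IH g j mg gM gj].
have boxS t (y : torus R n) : t \in `[0, 2 * pi] -> in_box y -> in_box (cons_pair (t, y)).
  by move=> tI yI i; case: (unliftP ord0 i) => [k ->|->]; rewrite ?tnthS ?tnth0.
have mg' : measurable_fun setT (g \o @cons_pair R n).
  by apply: measurableT_comp => //; exact: measurable_cons_pair.
have ir : (spacetime_fin R n).-integrable setT (EFin \o (g \o @cons_pair R n)).
  apply: (ae_bounded_integrable (M := M) (ae_prod (circle_box R) (@torus_box_ae R n)) mg').
  by move=> [t y] [/= tI yI]; apply: gM; exact: boxS.
rewrite Rintegral_torusS//.
case: (unliftP ord0 j) gj => [i ->|->] gj.
  apply: Rintegral_sections_eq0l => //.
  apply: (@filterS _ _ (ae_filter_ringOfSetsType circle) _ _ _ (circle_box R)) => t tI.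
  apply: (IH (fun y => g (cons_pair (t, y))) i).
  - exact: (measurableT_comp mg' (measurable_pair1 t)).
  - by move=> y yI; apply: gM; exact: boxS.
  - by move=> y; under eq_Rintegral do rewrite -update_consS; exact: gj.
apply: Rintegral_sections_eq0r => //; apply: aeW => y.
rewrite -[RHS](gj (cons_pair (0, y))).
by apply: eq_Rintegral => s _; rewrite update_cons0.
Qed.

Lemma line_integral_eq0 n (g : 'rV[R]_n -> R) (j : 'I_n) : continuous g ->
  (forall v, \int[circle]_s g (v + s *: dir R j) = 0) ->
  \int[torus_measure R n]_x g (unpt x) = 0.
Proof.
move=> cg gj; have [M gM] := continuous_box_bounded cg.
apply: (coordinate_integral_eq0 (M := M) (j := j)).
- exact: measurable_continuous_torus.
- by move=> x xb; apply: gM => i; rewrite mxE; exact: xb.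
(* Start the line at x with its j-th coordinate set to 0, so that the parameter s becomes that
   coordinate. *)
move=> x; rewrite -[RHS](gj (\row_i if i == j then 0 else tnth x i)).
apply: eq_Rintegral => s _; congr g; apply/rowP => i.
rewrite !mxE tnth_mktuple; case: eqP => _ /=; rewrite ?mulr1 ?mulr0 ?addr0 ?add0r//.
Qed.

End integration_by_parts.

Section laplacian_by_parts.
Context (R : realType) (n : nat).
Local Notation circle := (circle_measure R).
Local Notation periodic h := (forall v j, h (v + (2 * pi) *: dir R j) = h v).
Implicit Types (h : 'rV[R]_n -> R) (k : 'I_n -> int).

Lemma periodic_derive h w : periodic h -> periodic ('D_w h).
Proof.
move=> hp v j; rewrite /derive.
suff -> : (fun s : R => s^-1 *: ((h \o shift (v + (2 * pi) *: dir R j)) (s *: w) -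
  h (v + (2 * pi) *: dir R j))) = (fun s => s^-1 *: ((h \o shift v) (s *: w) - h v)) by [].
by apply/funext => s /=; rewrite hp addrA hp.
Qed.

Lemma periodic_cosines (s : seq (R * ('I_n -> int) * R)) : periodic (cosines s).
Proof.
move=> v j; apply: eq_bigr => c _; rewrite dotp_dir addrAC.
by rewrite -[cos _]/(complex.Re (expi _)) expiD expi_int mulr1.
Qed.

(** Green's identity on a circle, for [c] whose second derivative in the direction j is -k_j^2 c. *)
Lemma line_integral_by_parts h k (phi : R) j v : C2 h -> periodic h ->
  let c := cosines [:: (1, k, phi)] in
  \int[circle]_s (('D_(dir R j) ('D_(dir R j) h) (v + s *: dir R j) +
     (k j)%:~R ^+ 2 * h (v + s *: dir R j)) * c (v + s *: dir R j)) = 0.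
Proof.
move=> [ch C1 hC2] hp c.
pose e := dir R j; pose c' := cosines (dcosines j [:: (1, k, phi)]).
have ce w : is_derive w e c (c' w) by exact: is_derive_cosines.
have ce' w : is_derive w e c' (- (k j)%:~R ^+ 2 * c w).
  have := is_derive_cosines j (dcosines j [:: (1, k, phi)]) w.
  by move/is_derive_eq; apply; rewrite dcosines2 /c /cosines !big_cons !big_nil !addr0.
have he w : is_derive w e h ('D_e h w) by apply: derivableP; have [+ _] := C1 j; apply.
have he' w : is_derive w e ('D_e h) ('D_e ('D_e h) w).
  by apply: derivableP; have [+ _] := hC2 j j; apply.
pose F s := 'D_e h (v + s *: e) * c (v + s *: e) - h (v + s *: e) * c' (v + s *: e).
(* The integrand is the derivative of the periodic function [F]. *)
have F0 : F (2 * pi) - F 0 = 0.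
  rewrite /F !scale0r !addr0 (periodic_derive _ hp) hp.
  by rewrite /c /c' !periodic_cosines subrr.
rewrite -[RHS]F0; apply: circle_FTC => [t|].
  have /derive_line dh := he (v + t *: e).
  have /derive_line dh' := he' (v + t *: e).
  have /derive_line dc := ce (v + t *: e).
  have /derive_line dc' := ce' (v + t *: e).
  have d1 := is_deriveM dh' dc; have d2 := is_deriveM dh dc'.
  have := is_deriveB d1 d2.
  move/is_derive_eq; apply; rewrite /GRing.scale/=; ring.
move=> {}t.
have cl : {for t, continuous (fun s : R => v + s *: e)}.
  apply: (@continuousD R 'rV[R]_n R (cst v) (fun s : R => s *: e)); first exact: cst_continuous.
  by move=> ?; apply: cvgZr_tmp; exact: cvg_id.
have cont g : continuous g -> {for t, continuous (fun s : R => g (v + s *: e) : R)}.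
  by move=> cg; apply: (@continuous_comp _ _ _ (fun s : R => v + s *: e) g) => //; exact: cg.
apply: (@continuousM R _ (fun s : R => 'D_e ('D_e h) (v + s *: e) + (k j)%:~R ^+ 2 * h (v + s *: e))).
  apply: (@continuousD R R^o _ (fun s : R => 'D_e ('D_e h) (v + s *: e))).
    by apply: (cont ('D_e ('D_e h))); have [] := hC2 j j.
  by apply: (@continuousM R _ (cst ((k j)%:~R ^+ 2))); [exact: cst_continuous|exact: cont].
by apply: (cont c); exact: continuous_cosines.
Qed.

(** Symmetry of the Laplacian tested against a real character. The phase treats the cosine (0) and
    the sine (-pi/2) at once. *)
Lemma laplacian_by_parts h k (phi : R) : C2 h -> periodic h ->
  \int[torus_measure R n]_x ((real_laplacian h (unpt x) + sqnorm R k * h (unpt x)) *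
     cos (dotp k x + phi)) = 0.
Proof.
move=> hC hp; have [ch C1 hC2] := hC.
pose c := cosines [:: (1, k, phi)].
pose g j v := ('D_(dir R j) ('D_(dir R j) h) v + (k j)%:~R ^+ 2 * h v) * c v.
have cg j : continuous (g j).
  move=> v; apply: (@continuousM R _ (fun v => 'D_(dir R j) ('D_(dir R j) h) v + (k j)%:~R ^+ 2 * h v)).
    apply: (@continuousD R R^o _ ('D_(dir R j) ('D_(dir R j) h))).
      by have [_ +] := hC2 j j; apply.
    by apply: (@continuousM R _ (cst ((k j)%:~R ^+ 2))); [exact: cst_continuous|exact: ch].
  exact: continuous_cosines.
transitivity (\int[torus_measure R n]_x (\sum_(j < n) g j (unpt x))).
  apply: eq_Rintegral => x _; rewrite /g -mulr_suml big_split/= -mulr_suml /c /cosines big_cons big_nil.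
  by rewrite unptK mul1r addr0.
have ig j := continuous_torus_integrable (cg j).
elim: (index_enum _) => [|j l IH].
  under eq_Rintegral do rewrite big_nil.
  by rewrite /Rintegral integral0.
under eq_Rintegral do rewrite big_cons.
have il : (torus_measure R n).-integrable setT (EFin \o (fun x => \sum_(i <- l) g i (unpt x))).
  clear IH; elim: l => [|i l IHl].
    by apply: eq_integrable (integrable0 _ _) => // x _ /=; rewrite big_nil.
  apply: eq_integrable (integrableD _ (ig i) IHl) => // x _ /=.
  by rewrite big_cons EFinD.
transitivity (\int[torus_measure R n]_x (g j (unpt x)) +
    \int[torus_measure R n]_x (\sum_(i <- l) g i (unpt x))).
  by rewrite -RintegralD//; exact: ig.
rewrite IH addr0; apply: line_integral_eq0 => // v.
exact: line_integral_by_parts.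
Qed.

End laplacian_by_parts.

Lemma cLfun2Z d (X : measurableType d) (R : realType)
  (mu : {finite_measure set X -> \bar R}) c (f : X -> R[i]) :
  cLfun mu 2%:E f -> cLfun mu 2%:E (fun x => c * f x).
Proof.
move=> fL; have := cLfun2_lin c fL (cLfun2_cst mu 0).
by congr (cLfun _ _ _); apply/funext => x; rewrite addr0.
Qed.

Section eigenfunction_waves.
Context (R : realType) (n : nat).
Local Notation mu := (torus_measure R n).
Local Notation circle := (circle_measure R).

Lemma eigenfunction_cLfun2 f : @eigenfunctions R n f -> cLfun mu 2%:E f.
Proof. by move=> [_ [c1 _ _] [c2 _ _] _ _]; exact: continuous_cLfun2. Qed.

Lemma fourier_coefZ c (f : torus R n -> R[i]) k : cLfun mu 2%:E f ->
  fourier_coef (fun x => c * f x) k = c * fourier_coef f k.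
Proof.
move=> fL; rewrite /fourier_coef mulrCA; congr (_ * _); rewrite -cintegralZ.
  by congr cintegral; apply/funext => x; rewrite mulrA.
apply: cLfun2_cintegrable; apply: cLfun2M_bounded => //.
  apply: cmeasurable_expi; apply: measurableT_comp => //; exact: measurable_dotp.
by move=> x; rewrite sqn_expi.
Qed.

(** With f = p + iq and lambda + |k|^2 = a + ib, the real and imaginary parts of the eigenvalue
    equation, tested against cosine and sine, give a I(p) - b I(q) = 0 and a I(q) + b I(p) = 0,
    which combine into the claim. *)
Lemma eigenfunction_fourier (f : torus R n -> R[i]) lambda k :
  torus_periodic f -> C2 (fun v => complex.Re (f (pt v))) ->
  C2 (fun v => complex.Im (f (pt v))) ->
  (forall v, laplacian f v = lambda * f (pt v)) ->
  (lambda + (sqnorm R k)%:C) * fourier_coef f k = 0.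
Proof.
move=> fp C1 C2' fl; set K := sqnorm R k.
pose p v := complex.Re (f (@pt R n v)); pose q v := complex.Im (f (@pt R n v)).
have [cp _ _] := C1; have [cq _ _] := C2'.
pose a := complex.Re lambda + K; pose b := complex.Im lambda.
pose I (h : 'rV[R]_n -> R) phi := \int[mu]_x (h (unpt x) * cos (dotp k x + phi)).
have integ (h : 'rV[R]_n -> R) (phi : R) : continuous h ->
    mu.-integrable setT (EFin \o (fun x => h (unpt x) * cos (dotp k x + phi))).
  move=> ch; pose g v := h v * cosines [:: (1, k, phi)] v.
  have cg : continuous g.
    by move=> v; apply: continuousM; [exact: ch|exact: continuous_cosines].
  apply: eq_integrable (continuous_torus_integrable cg) => // x _ /=.
  by rewrite /g /cosines big_cons big_nil unptK mul1r addr0.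
have lin (h1 h2 : 'rV[R]_n -> R) (s t phi : R) : continuous h1 -> continuous h2 ->
    \int[mu]_x ((s * h1 (unpt x) + t * h2 (unpt x)) * cos (dotp k x + phi)) =
    s * I h1 phi + t * I h2 phi.
  move=> ch1 ch2; have i1 := integ h1 phi ch1; have i2 := integ h2 phi ch2.
  rewrite /I -!RintegralZl// -RintegralD//; first by apply: eq_Rintegral => x _; ring.
    exact: (integrableZl measurableT s i1).
  exact: (integrableZl measurableT t i2).
have e1 phi : a * I p phi - b * I q phi = 0.
  rewrite -mulNr -lin// -[RHS](laplacian_by_parts k phi C1); last first.
    by move=> v j; rewrite fp.
  apply: eq_Rintegral => x _; congr (_ * _).
  have := congr1 (@complex.Re R) (fl (unpt x)); rewrite /laplacian [complex.Re (_ +i* _)]/= => ->.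
  by rewrite -/K /a /b /p /q; case: lambda {fl a b} => u v; case: (f _) => u' v' /=; ring.
have e2 phi : a * I q phi + b * I p phi = 0.
  rewrite -lin// -[RHS](laplacian_by_parts k phi C2'); last first.
    by move=> v j; rewrite fp.
  apply: eq_Rintegral => x _; congr (_ * _).
  have := congr1 (@complex.Im R) (fl (unpt x)); rewrite /laplacian [complex.Im (_ +i* _)]/= => ->.
  by rewrite -/K /a /b /p /q; case: lambda {fl a b e1} => u v; case: (f _) => u' v' /=; ring.
have coefE : cintegral mu (fun x => f x * expi (- dotp k x)) =
    (I p 0 + I q (- (pi / 2))) +i* (I q 0 - I p (- (pi / 2))).
  rewrite /cintegral; congr (_ +i* _).
    rewrite -RintegralD//; [|exact: integ|exact: integ].
    apply: eq_Rintegral => x _; rewrite /p /q unptK cosBpihalf addr0 /expi cosN sinN.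
    by case: (f x) => u v /=; ring.
  rewrite -RintegralB//; [|exact: integ|exact: integ].
  apply: eq_Rintegral => x _; rewrite /p /q unptK cosBpihalf addr0 /expi cosN sinN.
  by case: (f x) => u v /=; ring.
rewrite /fourier_coef coefE mulrCA; apply/eqP; rewrite mulf_eq0; apply/orP; right.
have -> : lambda + K%:C = a +i* b.
  by rewrite /a /b; case: lambda {fl a b e1 e2} => u v; apply/eqP; rewrite eq_complex/= addr0 !eqxx.
rewrite eq_complex/=.
have := e1 0; have := e2 0; have := e1 (- (pi / 2)); have := e2 (- (pi / 2)).
move=> h1 h2 h3 h4; apply/andP; split; apply/eqP; lra.
Qed.

(** The eigenvalue is allowed to be complex, but at every k where f has a non-zero Fourier
    coefficient it equals -|k|^2; its real part is thus the right time frequency, and the other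
    coefficients impose nothing. *)
Lemma eigenfunction_wave f : @eigenfunctions R n f ->
  exists s : R, free_waves (fun z : spacetime R n => expi (z.1 * s) * f z.2).
Proof.
move=> fE; have fL := eigenfunction_cLfun2 fE.
have [fp C1 C2' _ [lambda fl]] := fE.
have mexp (s : R) : measurable_fun setT (fun t : R => t * s) by exact: measurable_funM.
exists (complex.Re lambda); split.
  apply: (@cLfun2_prod _ _ _ _ R circle mu (fun t => expi (t * complex.Re lambda)) f) => //.
  by apply: cLfun2_unimodular; exact: mexp.
exists f; apply: aeW => t; split => //.
  exact: (cLfun2Z (expi (t * complex.Re lambda)) fL).
move=> k; rewrite -/(fourier_coef _ k).
have -> := fourier_coefZ (expi (t * complex.Re lambda)) k fL.
have /eqP := eigenfunction_fourier k fp C1 C2' fl.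
rewrite mulf_eq0 => /orP[|/eqP ->]; last by rewrite !mulr0.
case: lambda {fl mexp} => u v; rewrite eq_complex/= => /andP[/eqP u0 _].
congr (expi _ * _); rewrite -mulrN; congr (_ * _); lra.
Qed.

End eigenfunction_waves.

(** * From multipliers to uniform integrability *)

Section diagonal.
Context d d' (X : measurableType d) (X' : measurableType d') (R : realType).
Variables (mu : {finite_measure set X -> \bar R}) (mu' : {finite_measure set X' -> \bar R}).
Variables (h : X -> X') (S : set (X -> R[i])) (a : nat -> X -> R[i]).
Hypothesis mh : measurable_fun setT h.
Hypothesis SL : S `<=` cLfun mu 2%:E.
Hypothesis ma : forall n, cmeasurable (a n).
Local Notation nu u V := (\int[mu]_(x in h @^-1` V) (sqmod u x)%:E)%E.

Hypothesis Sac : forall u (eps : R), S u -> 0 < eps -> exists2 delta : R, 0 < delta &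
  forall V, measurable V -> (mu' V < delta%:E)%E -> (nu u V < eps%:E)%E.

Hypothesis approx : forall W (eps : R), measurable W -> 0 < eps -> exists n, forall u, S u ->
  (\int[mu]_x (sqmod (fun x => (cindic R W (h x) - a n x) * u x) x)%:E <= eps%:E)%E.

Let mpre V : measurable V -> measurable (h @^-1` V).
Proof. by move=> mV; rewrite -[X in measurable X]setTI; exact: mh. Qed.

(** The measures are dominated by delta_{n+1} 2^-k, a geometric series with sum 2 delta_{n+1}. *)
Lemma tail_union_small (V : nat -> set X') (delta : nat -> R) n :
  (forall k, measurable (V k)) -> (forall k, (mu' (V k) <= (delta k)%:E)%E) ->
  (forall k, delta k.+1 <= delta k / 2) -> 0 < delta n.+1 ->
  (mu' (\bigcup_(k in [set k | (n < k)%N]) V k) <= (2 * delta n.+1)%:E)%E.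
Proof.
move=> mV Vd dd d0.
have le k : delta (n.+1 + k)%N <= delta n.+1 / 2 ^+ k.
  elim: k => [|k IH]; first by rewrite addn0 expr0 divr1.
  rewrite addnS (le_trans (dd _))// exprS invfM.
  by have := IH; lra.
apply: (le_trans (measure_sigma_subadditive mu' (F := fun k => V (n.+1 + k)%N) _ _ _)) => //.
- by apply: bigcup_measurable.
- by move=> x [k /= nk Vx]; exists (k - n.+1)%N => //; rewrite subnKC.
have := @cvg_geometric_eseries_half R (2 * delta n.+1) 0.
rewrite expr0 divr1 => /cvg_lim <- //.
apply: lee_nneseries => // k _; apply: (le_trans (Vd _)).
rewrite lee_fin (le_trans (le k))// addn1 natrX exprS invfM.
by rewrite mulrACA divff// mul1r.
Qed.

Lemma diagonal_sequence (eps : R) : 0 < eps ->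
  (forall delta : R, 0 < delta -> exists u V, [/\ S u, measurable V, (mu' V < delta%:E)%E &
     (eps%:E <= nu u V)%E]) ->
  exists (u : nat -> X -> R[i]) (V : nat -> set X'),
    [/\ forall n, S (u n), forall n, measurable (V n), forall n, (eps%:E <= nu (u n) (V n))%E &
     forall n, (nu (u n) (\bigcup_(k in [set k | (n < k)%N]) V k) < (eps / 4)%:E)%E].
Proof.
move=> eps0 bad.
have /choice[f fP] : forall delta : R, exists p : (X -> R[i]) * set X', 0 < delta ->
    [/\ S p.1, measurable p.2, (mu' p.2 < delta%:E)%E & (eps%:E <= nu p.1 p.2)%E].
  move=> delta.
  (* A choice function needs a value everywhere: the pair given for delta <= 0 is a dummy, as is the
     modulus 0 given below for u outside [S]. *)
  have [d0|nd0] := pselect (0 < delta); last by exists (fun=> 0, set0).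
  by have [u [V uV]] := bad _ d0; exists (u, V).
have /choice[rho rhoP] : forall u : X -> R[i], exists r : R, S u -> 0 < r /\
    forall V, measurable V -> (mu' V < r%:E)%E -> (nu u V < (eps / 4)%:E)%E.
  move=> u.
  have [Su|nSu] := pselect (S u); last by exists 0.
  by have [r r0 rP] := Sac Su (divr_gt0 eps0 (ltr0n _ 4)); exists r.
(* [rho] is the modulus of absolute continuity of a single function at level eps / 4. Halving bounds
   the measure of all later sets together by 2 delta_{n+1} <= rho / 2, so that they carry less than
   eps / 4 of the mass of u_n. *)
pose next delta := Num.min (delta / 2) (rho (f delta).1 / 4).
pose delta n := iter n next 1.
have d0 n : 0 < delta n.
  elim: n => [|n IH]; first exact: ltr01.
  rewrite /delta iterS -/(delta n) /next lt_min divr_gt0//=.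
  by have [/rhoP[r0 _] _ _ _] := fP _ IH; rewrite divr_gt0.
exists (fun n => (f (delta n)).1), (fun n => (f (delta n)).2).
split=> n; try by have [] := fP _ (d0 n).
have [/rhoP[r0 rP] _ _ _] := fP _ (d0 n).
apply: rP; first by apply: bigcup_measurable => k _; have [] := fP _ (d0 k).
apply: (le_lt_trans (@tail_union_small _ delta n _ _ _ _)) => //.
- by move=> k; have [] := fP _ (d0 k).
- by move=> k; have [_ _ /ltW] := fP _ (d0 k).
- by move=> k; rewrite /delta iterS -/(delta k) /next ge_min lexx.
rewrite lte_fin; have : delta n.+1 <= rho (f (delta n)).1 / 4.
  by rewrite /delta iterS -/(delta n) /next ge_min lexx orbT.
by lra.
Qed.

Lemma diagonal_uniform (eps : R) : 0 < eps -> exists2 delta : R, 0 < delta &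
  forall u V, S u -> measurable V -> (mu' V < delta%:E)%E -> (nu u V < eps%:E)%E.
Proof.
move=> eps0; apply: contrapT => H.
have [|u [V [Su mV uV tail]]] := diagonal_sequence eps0.
  move=> delta d0; apply: contrapT => H'; apply: H; exists delta => // u V Su mV Vd.
  by rewrite ltNge; apply/negP => uV; apply: H'; exists u, V.
pose U n := \bigcup_(k in [set k | (n < k)%N]) V k.
have mU n : measurable (U n) by exact: bigcup_measurable.
(* Removing all later sets makes these disjoint and costs less than eps / 4 of the mass of u_n, so
   3/4 eps remains. *)
pose D n := V n `\` U n.
have mD n : measurable (D n) by exact: measurableD.
have mu_ n : cmeasurable (u n) by have [] := SL (Su n).
have big n : (((3 / 4) * eps)%:E <= nu (u n) (D n))%E.
  have /(le_trans (uV n)) : (nu (u n) (V n) <= nu (u n) (D n) + nu (u n) (U n))%E.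
    rewrite -{1}(setUIDK (V n) (U n)) preimage_setU ge0_integral_setU//=.
    - rewrite addeC leeD2l//; apply: ge0_subset_integral => //.
      + by apply: mpre; exact: measurableI.
      + exact: mpre.
      + exact: measurable_sqmodE.
      + by move=> x _; rewrite lee_fin sqmod_ge0.
      + by apply: preimage_subset; exact: subIsetr.
    - by apply: mpre; exact: measurableI.
    - by apply: mpre; exact: mD.
    - exact: measurable_sqmodE.
    - by move=> x _; rewrite lee_fin sqmod_ge0.
    - by apply/disj_setPS => x [/= [_ ?] [_ ?]].
  move: (tail n) (int_sqmod_ge0 mu (u n) (h @^-1` D n)) (int_sqmod_ge0 mu (u n) (h @^-1` U n)).
  rewrite -/(U n); case: (nu (u n) (D n)) => [p| |]//; case: (nu (u n) (U n)) => [q| |]//.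
    by rewrite lte_fin !lee_fin => *; lra.
  by move=> *; rewrite leey.
(* Let n be the index that approximates the indicator of [W] within eps / 16. If [A n] holds, the
   indicator is 1 on [D n] and the error there is at least eps / 8. Otherwise it is 0 on [D n], and
   the mass 3/4 eps would be at most 2 eps / 8 + 2 eps / 16. *)
pose A n := ((eps / 8)%:E <= \int[mu]_(x in h @^-1` D n)
  (sqmod (fun x => (1 - a n x) * u n x)%R x)%:E)%E.
pose W := \bigcup_(n in [set n | A n]) D n.
have mW : measurable W by exact: bigcup_measurable.
have [n nP] := approx mW (divr_gt0 eps0 (ltr0n _ 16)).
have ms1 : cmeasurable (fun x => (1 - a n x) * u n x).
  by apply: cmeasurableM => //; apply: cmeasurableB => //; exact: cmeasurable_cst.
have ms2 : cmeasurable (fun x => a n x * u n x) by exact: cmeasurableM.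
have mW' : cmeasurable (fun x => (cindic R W (h x) - a n x) * u n x).
  apply: cmeasurableM => //; apply: cmeasurableB => //.
  by apply: cmeasurable_comp mh; exact: cmeasurable_cindic.
have {nP} : (\int[mu]_(x in h @^-1` D n)
    (sqmod (fun x => (cindic R W (h x) - a n x) * u n x) x)%:E <= (eps / 16)%:E)%E.
  apply: le_trans (nP _ (Su n)); apply: ge0_subset_integral => //.
  - exact: mpre.
  - exact: measurable_sqmodE.
  - by move=> x _; rewrite lee_fin sqmod_ge0.
have [An|nAn] := pselect (A n).
  rewrite (eq_integral (fun x => (sqmod (fun x => (1 - a n x) * u n x) x)%:E)).
    by move=> /(le_trans An); rewrite lee_fin => ?; lra.
  move=> x /set_mem Dx; rewrite /sqmod /cindic indicE mem_set//.
  by exists n.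
rewrite (eq_integral (fun x => (sqmod (fun x => a n x * u n x) x)%:E)); last first.
  move=> x /set_mem Dx; rewrite !sqmodE /cindic indicE memNset ?sub0r ?mulNr ?sqnN//.
  move=> [m Am Dmx]; have [mn|nm|mn] := ltngtP m n.
  - by case: Dmx => _; apply; exists n => //; case: Dx.
  - by case: Dx => _; apply; exists m => //; case: Dmx.
  - by apply: nAn; rewrite -mn.
(* |u|^2 <= 2 |(1 - a) u|^2 + 2 |a u|^2 *)
move: nAn => /negP; rewrite -ltNge => s1 s2.
have := int_sqmodD_on mu (mpre (mD n)) ms1 ms2.
rewrite (eq_integral (fun x => (sqmod (u n) x)%:E)); last first.
  by move=> x _; rewrite !sqmodE -mulrDl subrK mul1r.
move=> /(le_trans (big n)).
move: s1 s2 (int_sqmod_ge0 mu (fun x => (1 - a n x) * u n x) (h @^-1` D n))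
 (int_sqmod_ge0 mu (fun x => a n x * u n x) (h @^-1` D n)).
case: (\int[mu]_(x in _) _)%E => // p; case: (\int[mu]_(x in _) _)%E => // q.
by rewrite lte_fin !lee_fin => *; lra.
Qed.

End diagonal.

Section scaling.
Context (R : realType) (n : nat).
Local Notation mu := (spacetime_fin R n).

Lemma cLfunoo_cindic d (X : measurableType d) (m : {finite_measure set X -> \bar R}) W :
  measurable W -> cLfun m +oo%E (cindic R W).
Proof.
move=> mW; split; first exact: cmeasurable_cindic.
have := indic_Lfunoo m mW; rewrite inE => /andP[_]; rewrite !inE /= /finite_norm.
congr (_ < _)%E; rewrite /cLnorm; congr Lnorm; apply/funext => x /=; congr EFin.
by rewrite /cindic /= expr0n addr0 sqrtr_sqr ger0_norm// indicE.
Qed.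

Lemma free_wavesZ c (u : spacetime R n -> R[i]) : free_waves u ->
  free_waves (fun z => c * u z).
Proof.
move=> [uL [u0 fu]]; split; first exact: (cLfun2Z (mu := mu)).
exists (fun x => c * u0 x).
apply: (@filterS _ _ (ae_filter_ringOfSetsType (circle_measure R)) _ _ _ fu) => t [u0L utL ft].
split; [exact: cLfun2Z|exact: (cLfun2Z c utL)|move=> k].
have -> := fourier_coefZ c k u0L; have -> := fourier_coefZ c k utL.
by rewrite ft mulrCA.
Qed.

Lemma free_waves_unit_ball d' (X' : measurableType d') (h : spacetime R n -> X') V (eps : R) u :
  measurable_fun setT h -> measurable V -> 0 < eps ->
  (forall v, normalized mu (@free_waves R n) v ->
     (\int[mu]_(z in h @^-1` V) (sqmod v z)%:E < eps%:E)%E) ->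
  free_waves u -> (\int[mu]_z (sqmod u z)%:E <= 1)%E ->
  (\int[mu]_(z in h @^-1` V) (sqmod u z)%:E <= eps%:E)%E.
Proof.
move=> mh mV eps0 vP fu u1; have [uL _] := fu.
have mhV : measurable (h @^-1` V) by rewrite -[X in measurable X]setTI; exact: mh.
have := int_sqmod_le_of_normalized (mu := mu) uL mhV eps0 vP (fun a _ _ => free_wavesZ a%:C fu).
by move=> /le_trans; apply; rewrite -[leRHS]mule1 lee_wpmul2l// lee_fin ltW.
Qed.

End scaling.

Section approximation_of_multipliers.
Context (R : realType) (n : nat).
Local Notation mu := (spacetime_fin R n).
Local Notation ball := [set u : spacetime R n -> R[i] |
  free_waves u /\ (\int[mu]_z (sqmod u z)%:E <= 1)%E].

Lemma Y0_net_approx b (eps : R) : cmeasurable b -> Y0 (multiplication b) -> 0 < eps ->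
  exists l, forall u, ball u ->
    (\int[mu]_z (sqmod (fun z => (b z - net l (coordinates z)) * u z) z)%:E <= eps%:E)%E.
Proof.
move=> mb [_ bY] eps0.
(* Passing from b to a continuous a, then from a to a net, costs eps / 4 each, doubled by the
   inequality for the square of a sum. The operator norm is not squared, hence the square root
   below. *)
have e4 : 0 < eps / 4 by rewrite divr_gt0.
have [a aC oa] : exists2 a, C0 a & (opnorm (fun u z => (multiplication b u z -
    multiplication a u z)%R) < (Num.sqrt (eps / 4))%:E)%E.
  by apply: bY; rewrite sqrtr_gt0.
have ma := C0_cmeasurable aC; have [l lP] := C0_net aC e4.
have ml := @cmeasurable_net_coordinates R n l.
exists l => u [fu u1]; have [[mu_ uL] _] := fu.
have m1 : cmeasurable (fun z => (b z - a z) * u z).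
  by apply: cmeasurableM => //; exact: cmeasurableB.
have m2 : cmeasurable (fun z => (a z - net l (coordinates z)) * u z).
  by apply: cmeasurableM => //; exact: cmeasurableB.
have i1 : (\int[mu]_z (sqmod (fun z => (b z - a z) * u z) z)%:E <= (eps / 4)%:E)%E.
  rewrite -[eps / 4]sqr_sqrtr ?(ltW e4)// -cLnorm2_le ?sqrtr_ge0//.
  apply: (le_trans _ (ltW oa)); apply: ereal_sup_ubound; exists u.
    by split => //; rewrite cLnorm2_le// expr1n.
  by congr cLnorm; apply/funext => z; rewrite /multiplication mulrBl.
have i2 : (\int[mu]_z (sqmod (fun z => (a z - net l (coordinates z)) * u z) z)%:E <= (eps / 4)%:E)%E.
  apply: (@le_trans _ _ ((eps / 4)%:E * \int[mu]_z (sqmod u z)%:E)%E); last first.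
    by rewrite -[leRHS]mule1 lee_wpmul2l// lee_fin ltW.
  rewrite -ge0_integralZl_EFin ?(ltW e4)//; last 2 first.
  - by move=> x _; rewrite lee_fin sqmod_ge0.
  - exact: measurable_sqmodE.
  apply: ae_ge0_le_integral => //.
  - by move=> z _; rewrite lee_fin sqmod_ge0.
  - exact: measurable_sqmodE.
  - by move=> z _; rewrite -EFinM lee_fin mulr_ge0 ?sqmod_ge0// ltW.
  - by apply: measurable_funeM; exact: measurable_sqmodE.
  - apply: (@filterS _ _ (ae_filter_ringOfSetsType mu) _ _ _ lP) => z lz _.
    by rewrite -EFinM lee_fin !sqmodE sqnM ler_wpM2r ?sqn_ge0.
rewrite (eq_integral (fun z => (sqmod (fun z => (b z - a z) * u z +
    (a z - net l (coordinates z)) * u z) z)%:E)); last first.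
  by move=> z _; rewrite !sqmodE -mulrDl addrA subrK.
apply: (le_trans (int_sqmodD mu m1 m2)).
move: i1 i2 (int_sqmod_ge0 mu (fun z => (b z - a z) * u z) setT)
  (int_sqmod_ge0 mu (fun z => (a z - net l (coordinates z)) * u z) setT).
case: (\int[mu]_x _)%E => // p; case: (\int[mu]_x _)%E => // q.
by rewrite !lee_fin => *; lra.
Qed.

(** The constant C, which is 1 for the identity and 2 pi for the projection to space, turns
    smallness in [mu'] into smallness of the preimage, and thereby yields absolute continuity of
    each single wave. *)
Lemma Y0_uniform d' (X' : measurableType d') (mu' : {finite_measure set X' -> \bar R})
    (h : spacetime R n -> X') (C : R) :
  measurable_fun setT h -> 0 < C ->
  (forall V, measurable V -> (mu (h @^-1` V) <= C%:E * mu' V)%E) ->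
  (forall W, measurable W -> Y0 (multiplication (cindic R W \o h))) ->
  forall eps : R, 0 < eps -> exists2 delta : R, 0 < delta &
    forall u V, ball u -> measurable V -> (mu' V < delta%:E)%E ->
      (\int[mu]_(z in h @^-1` V) (sqmod u z)%:E < eps%:E)%E.
Proof.
move=> mh C0 hC WY.
(* An enumeration of all nets; integers that code no list are sent to 0. *)
pose a k := if unpickle k is Some l then fun z => net l (coordinates z) else
  fun _ : spacetime R n => 0 : R[i].
apply: (@diagonal_uniform _ _ _ _ R mu mu' h ball a mh) => //.
- by move=> u [[]].
- move=> k; rewrite /a; case: (unpickle k) => [l|]; last exact: cmeasurable_cst.
  exact: cmeasurable_net_coordinates.
- move=> u eps [[uL _] _] eps0.
  have [delta d0 dP] := sqmod_absolutely_continuous (uL : cLfun mu 2%:E u) eps0.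
  exists (delta / C); first by rewrite divr_gt0.
  move=> V mV Vd; apply: dP; first by rewrite -[X in measurable X]setTI; exact: mh.
  apply: (le_lt_trans (hC _ mV)).
  have [v vE /andP[v0 vd]] := ge0_lt_EFin (measure_ge0 mu' V) Vd.
  by rewrite vE -EFinM lte_fin mulrC -ltr_pdivlMr.
- move=> W eps mW eps0.
  have mWh : cmeasurable (cindic R W \o h).
    by apply: cmeasurable_comp mh; exact: cmeasurable_cindic.
  have [l lP] := Y0_net_approx mWh (WY _ mW) eps0.
  exists (pickle l) => u Bu.
  have := lP u Bu.
  by rewrite /a pickleK.
Qed.

End approximation_of_multipliers.

(** * Multipliers and uniform integrability in both settings *)

Section multipliers_and_uniform_integrability.
Context (R : realType) (n : nat).
Local Notation mu := (spacetime_fin R n).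
Local Notation tmu := (torus_measure R n).
Local Notation circle := (circle_measure R).

Lemma circle_measureT : circle setT = (2 * pi)%:E.
Proof.
change (lebesgue_measure (setT `&` @fundamental_interval R) = (2 * pi)%:E).
rewrite setTI /fundamental_interval lebesgue_measure_itv/= lte_fin.
by rewrite mulr_gt0 ?pi_gt0// oppr0 addr0.
Qed.

Lemma integral_circle_cst (c : R) : (\int[circle]_t c%:E = (2 * pi * c)%:E)%E.
Proof.
have := integral_cst circle measurableT c%:E; rewrite /cst => ->.
by rewrite [X in (_ * X)%E]circle_measureT -EFinM mulrC.
Qed.

Lemma normalized_bounded d (X : measurableType d) (m : {finite_measure set X -> \bar R}) S :
  exists M : R, forall f, normalized m S f -> (cLnorm m 2%:E f <= M%:E)%E.
Proof. by exists 1 => f [_ ->]. Qed.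

Lemma free_waves_normalized_cLfun2 : normalized mu (@free_waves R n) `<=` cLfun mu 2%:E.
Proof. by move=> u [[]]. Qed.

Lemma eigenfunctions_normalized_cLfun2 :
  normalized tmu (@eigenfunctions R n) `<=` cLfun tmu 2%:E.
Proof. by move=> f [/eigenfunction_cLfun2]. Qed.

(** The exponential has modulus 1, and the factor 1 / sqrt(2 pi) compensates the length of the time
    circle, so normalization is preserved. *)
Lemma int_sqmod_eigenfunction_wave (f : torus R n -> R[i]) (s : R) V :
  cmeasurable f -> measurable V ->
  (\int[mu]_(z in snd @^-1` V) (sqmod (fun z : spacetime R n =>
     ((Num.sqrt (2 * pi))^-1)%:C * (expi (z.1 * s) * f z.2)) z)%:E =
   \int[tmu]_(x in V) (sqmod f x)%:E)%E.
Proof.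
move=> mf mV.
have pi2 : 0 < 2 * pi :> R by rewrite mulr_gt0 ?pi_gt0.
have E z : sqmod (fun z : spacetime R n =>
    ((Num.sqrt (2 * pi))^-1)%:C * (expi (z.1 * s) * f z.2)) z = (2 * pi)^-1 * sqmod f z.2.
  by rewrite !sqmodE !sqnM sqn_expi mul1r sqn_real exprVn sqr_sqrtr// ltW.
under eq_integral do rewrite E.
rewrite (integral_slab (f := fun z => ((2 * pi)^-1 * sqmod f z.2)%:E))//.
- apply: eq_integral => x _.
  by rewrite /= integral_circle_cst mulrA divff ?mul1r// gt_eqF.
- apply/measurable_EFinP; apply: measurable_funM => //.
  by apply: measurableT_comp (measurable_sqmod mf) measurable_snd.
- by move=> z; rewrite lee_fin mulr_ge0 ?sqmod_ge0// invr_ge0 ltW.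
Qed.

Lemma Y0_free_waves_usi :
  [set multiplication b | b in cLfun mu +oo%E] `<=` @Y0 R n ->
  uniformly_square_integrable mu (normalized mu (@free_waves R n)).
Proof.
move=> bY; split; [exact: free_waves_normalized_cLfun2|exact: normalized_bounded|].
move=> eps eps0.
have [|||W mW|delta d0 dP] := @Y0_uniform R n _ _ mu id 1 _ _ _ _ eps eps0.
- exact: measurable_id.
- exact: ltr01.
- by move=> V mV; rewrite mul1e.
- by apply: bY; exists (cindic R W) => //; exact: cLfunoo_cindic.
exists delta => // u w [fu /cLnorm2_eq1 u1] mw wd.
by apply: (dP u w) => //; split => //; rewrite u1.
Qed.

Lemma Y0_eigenfunctions_usi :
  [set multiplication (time_independent b) | b in cLfun tmu +oo%E] `<=` @Y0 R n ->
  uniformly_square_integrable tmu (normalized tmu (@eigenfunctions R n)).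
Proof.
move=> bY; split; [exact: eigenfunctions_normalized_cLfun2|exact: normalized_bounded|].
move=> eps eps0.
have [|||W mW|delta d0 dP] := @Y0_uniform R n _ _ tmu snd (2 * pi) _ _ _ _ eps eps0.
- exact: measurable_snd.
- by rewrite mulr_gt0 ?pi_gt0.
- move=> V mV; rewrite -circle_measureT.
  rewrite (_ : snd @^-1` V = [set: R] `*` V); last by apply/seteqP; split => z // [].
  by rewrite -(@product_measure1E _ _ _ _ _ circle tmu).
- apply: bY; exists (cindic R W) => //; exact: cLfunoo_cindic.
exists delta => // f w [fE /cLnorm2_eq1 f1] mw wd.
have [mf _] := eigenfunction_cLfun2 fE.
have [s fw] := eigenfunction_wave fE.
rewrite -(int_sqmod_eigenfunction_wave s mf mw); apply: dP => //.
split; first exact: free_wavesZ.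
by have := int_sqmod_eigenfunction_wave s mf measurableT; rewrite preimage_setT f1 => ->.
Qed.

Lemma free_waves_usi_Y0 :
  uniformly_square_integrable mu (normalized mu (@free_waves R n)) ->
  [set multiplication b | b in cLfun mu +oo%E] `<=` @Y0 R n.
Proof.
move=> [_ _ UI] _ [b bL <-].
apply: (@multiplication_Y0 R n _ _ mu id (trig (@spacetime_phase R n)) b) => //.
- move=> eps eps0; have [delta d0 dP] := UI eps eps0.
  exists delta => // w u mw wd fu u1.
  apply: (@free_waves_unit_ball R n _ _ id) => // v vS.
  exact: dP.
- exact: (@trig_cLfun2 _ _ _ _ mu _ (@measurable_spacetime_phase R n)).
- by move=> f; exact: spacetime_density.
- by move=> B p; exact: clip_trig_C0.
Qed.

Lemma eigenfunctions_usi_Y0 :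
  uniformly_square_integrable tmu (normalized tmu (@eigenfunctions R n)) ->
  [set multiplication (time_independent b) | b in cLfun tmu +oo%E] `<=` @Y0 R n.
Proof.
move=> UI _ [b bL <-].
apply: (@multiplication_Y0 R n _ _ tmu snd (trig (@dotp R n)) b) => //.
- move=> Q; exact: ae_snd.
- exact: (free_wave_slab_bound (mode_uniform_bound UI)).
- exact: (@trig_cLfun2 _ _ _ _ tmu _ (@measurable_dotp R n)).
- by move=> f; exact: torus_density.
- by move=> B p; exact: clip_trig_time_independent_C0.
Qed.

End multipliers_and_uniform_integrability.

Theorem theorem1p11 (R : realType) (d : nat) (d_ge1 : (1 <= d)%N) :
  [<-> [set multiplication b | b in cLfun (spacetime_measure R d) +oo%E]
         `<=` @Y0 R d;
       uniformly_square_integrable (spacetime_measure R d)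
         (normalized (spacetime_measure R d) (@free_waves R d));
       precompact (sqmod_family (spacetime_measure R d)
         (normalized (spacetime_measure R d) (@free_waves R d)));
       exists Phi : R -> R, strict_young Phi /\
         L1_bounded_image (spacetime_measure R d) Phi
           (normalized (spacetime_measure R d) (@free_waves R d))] /\
  [<-> [set multiplication (time_independent b) |
         b in cLfun (torus_measure R d) +oo%E] `<=` @Y0 R d;
       uniformly_square_integrable (torus_measure R d)
         (normalized (torus_measure R d) (@eigenfunctions R d));
       precompact (sqmod_family (torus_measure R d)
         (normalized (torus_measure R d) (@eigenfunctions R d)));
       exists Phi : R -> R, strict_young Phi /\
         L1_bounded_image (torus_measure R d) Phi
           (normalized (torus_measure R d) (@eigenfunctions R d))].
Proof.
have SL := @free_waves_normalized_cLfun2 R d.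
have SM := normalized_bounded (spacetime_fin R d) (@free_waves R d).
have EL := @eigenfunctions_normalized_cLfun2 R d.
have EM := normalized_bounded (torus_measure R d) (@eigenfunctions R d).
split; tfae.
- exact: Y0_free_waves_usi.
(* The statement carries the bare product measure; naming the convertible [spacetime_fin] brings in
   its finiteness. *)
- exact: (@usi_precompact _ _ _ (spacetime_fin R d)).
- move=> pc; apply: (@usi_young _ _ _ (spacetime_fin R d)).
  exact: precompact_usi SL SM pc.
- move=> [Phi [yPhi bPhi]]; apply: free_waves_usi_Y0.
  exact: young_usi SL SM yPhi bPhi.
- exact: Y0_eigenfunctions_usi.
- exact: usi_precompact.
- move=> pc; apply: usi_young; exact: precompact_usi EL EM pc.
- move=> [Phi [yPhi bPhi]]; apply: eigenfunctions_usi_Y0.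
  exact: young_usi EL EM yPhi bPhi.
Qed.
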